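(* Let $F$ be a germ of automorphisms of $\mathbb{C}^d$ at the origin and $B_h$, for some fixed $h\in\{0,\ldots,k-1\}$, a local basin of attraction of $F$, both as described in the context. Then for $z\in B_h$ and $z_n=F^n(z)$, $n\in\mathbb{N}$, the limit $$v(z):=\lim_{n\to\infty}\frac{|z_n|}{\|z_n\|_2}\in\mathbb{R}_+^d$$ exists and is a unit vector with positive entries, and the set of accumulation points of the sequence of directions $\{z_n/\|z_n\|_2\}_n$ is $$\omega(z):=\{w\in\mathbb{C}^d : |w|=v(z),\ \arg w^1+\cdots+\arg w^d\equiv 2\pi h/k \ (\mathrm{mod}\ 2\pi)\}.$$ In other words, $\{z_n\}_n$ converges to $0$ tangent to the linear cone $[0,\infty)\cdot\omega(z)$. Furthermore, for any unit vector $v\in\mathbb{R}_+^d$ (with positive entries) there exists $z\in B_h$ such that $v(z)=v$. Hence the set of all accumulation points of directions $\{z_n/\|z_n\|_2\}_n$ of orbits in $B_h$ is $$\omega(B_h)=\{w\in(\mathbb{C}^* )^d : \|w\|_2=1,\ \arg w^1+\cdots+\arg w^d\equiv2\pi h/k\ (\mathrm{mod}\ 2\pi)\}.$$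
   Context: Notation: $\mathbb{N}=\{0,1,\ldots\}$, $\mathbb{R}_+=(0,\infty)$; upper indices denote components; for $z\in\mathbb{C}^d$, $|z|:=(|z^1|,\ldots,|z^d|)$; $e_j$ is the $j$-th unit vector. Setting: $d\ge2$, $k\ge1$, $l>2kd+1$ are integers; $\lambda_1,\ldots,\lambda_d$ have unit modulus and are one-resonant of index $(1,\ldots,1)$, i.e. for $m\in\mathbb{N}^d$ and $j\le d$, $\lambda_1^{m_1}\cdots\lambda_d^{m_d}=\lambda_j$ if and only if $m=(q,\ldots,q)+e_j$ for some $q\in\mathbb{N}$; and $$F(z)=\Lambda z\Bigl(1-\frac{(z^1\cdots z^d)^k}{kd}\Bigr)+O(\|z\|^l),\qquad \Lambda=\mathrm{diag}(\lambda_1,\ldots,\lambda_d).$$ For $\pi(z)=z^1\cdots z^d$, $R>0$, $\theta\in(0,\frac{\pi}{2k})$, $\beta\in(0,\frac1d)$ put $S_h(R,\theta)=\{u\in\mathbb{C}: |u^k-\frac1{2R}|<\frac1{2R},\ |\arg(u)-\frac{2\pi h}{k}|<\theta\}$ (arguments modulo $2\pi$), $W(\beta)=\{z\in\mathbb{C}^d: |z^j|<|\pi(z)|^\beta \text{ for } 1\le j\le d\}$, $B_h(R,\theta,\beta)=\{z\in W(\beta):\pi(z)\in S_h(R,\theta)\}$. Fix $\beta_0\in(0,1/d)$ with $\beta_0(l+d-1)>2k+1$, $\theta_0\in(0,\frac\pi{2k})$, and $R_0>0$ large enough that the sets $B_h:=B_h(R_0,\theta_0,\beta_0)$ are uniform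 local basins of attraction: $F(B_h)\subseteq B_h$ and $F^n\to0$ uniformly on $B_h$, for all $h=0,\ldots,k-1$ (such $R_0$ exists). A sequence $z_n\to0$ of non-zero points converges to $0$ tangent to a closed cone if all accumulation points of $z_n/\|z_n\|_2$ lie in that cone. *)

(* Defs.v *)
From HB Require Import structures.
From mathcomp Require Import all_boot all_order all_algebra.
From mathcomp Require Import complex.
From mathcomp Require Import all_classical all_reals all_analysis.
Set Implicit Arguments.
Unset Strict Implicit.
Unset Printing Implicit Defensive.
Import Order.TTheory GRing.Theory Num.Theory.
Import numFieldNormedType.Exports.
Local Open Scope classical_set_scope.
Local Open Scope complex_scope.
Local Open Scope ring_scope.

(* The topology of R[i] is the one every numFieldType carries, so that
   'rV[R[i]]_d is a normed space over R[i] and [differentiable] below means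
   complex differentiable. *)
HB.instance Definition _ (R : realType) :=
  NormedModule.copy R[i] (R[i] : numFieldType)^o.

Definition cabs (R : realType) (x : R[i]) : R := complex.Re `|x|.

(* Multivalued: t is one of the arguments of the nonzero number x. *)
Definition is_arg (R : realType) (x : R[i]) (t : R) : Prop :=
  x != 0 /\ x = (cabs x)%:C * (cos t +i* sin t).

Definition eqmod2pi (R : realType) (a b : R) : Prop :=
  exists m : int, a = b + 2 * pi * m%:~R.

Definition enorm (R : realType) (d : nat) (v : 'rV[R]_d) : R :=
  Num.sqrt (\sum_j v 0 j ^+ 2).

Definition vabs (R : realType) (d : nat) (z : 'rV[R[i]]_d) : 'rV[R]_d :=
  map_mx (@cabs R) z.

Definition norm2 (R : realType) (d : nat) (z : 'rV[R[i]]_d) : R :=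
  enorm (vabs z).

Definition direction (R : realType) (d : nat) (z : 'rV[R[i]]_d) :
  'rV[R[i]]_d := ((norm2 z)^-1)%:C *: z.

Definition abs_direction (R : realType) (d : nat) (z : 'rV[R[i]]_d) :
  'rV[R]_d := (norm2 z)^-1 *: vabs z.

Definition holomorphic_on (R : realType) (d : nat) (U : set 'rV[R[i]]_d)
  (F : 'rV[R[i]]_d -> 'rV[R[i]]_d) : Prop :=
  open U /\ forall z, U z -> differentiable F z.

(* F, with values outside U irrelevant, represents on the neighbourhood U of 0
   a germ of automorphisms at 0: a germ of holomorphic maps fixing 0 that has an
   inverse G for the composition of germs. *)
Definition automorphism_germ (R : realType) (d : nat) (U : set 'rV[R[i]]_d)
  (F : 'rV[R[i]]_d -> 'rV[R[i]]_d) : Prop :=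
  [/\ U 0, holomorphic_on U F, F 0 = 0 &
   exists (V : set 'rV[R[i]]_d) (G : 'rV[R[i]]_d -> 'rV[R[i]]_d),
     [/\ V 0, holomorphic_on V G, G 0 = 0,
         \forall z \near (0 : 'rV[R[i]]_d), G (F z) = z &
         \forall z \near (0 : 'rV[R[i]]_d), F (G z) = z]].

Definition one_resonant (R : realType) (d : nat) (lambda : 'rV[R[i]]_d) : Prop :=
  forall (m : 'I_d -> nat) (j : 'I_d),
    \prod_i lambda 0 i ^+ m i = lambda 0 j <->
    exists q : nat, forall i, m i = (q + (i == j))%N.

Definition coord_prod (R : realType) (d : nat) (z : 'rV[R[i]]_d) : R[i] :=
  \prod_j z 0 j.

(* Points are row vectors, hence Lambda z is z *m Lambda. *)
Definition normal_form (R : realType) (d k : nat) (lambda z : 'rV[R[i]]_d) :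
  'rV[R[i]]_d :=
  (1 - coord_prod z ^+ k / (k * d)%:R) *: (z *m diag_mx lambda).

Definition sector (R : realType) (k h : nat) (R0 theta : R) : set R[i] :=
  [set u | cabs (u ^+ k - ((2 * R0)^-1)%:C) < (2 * R0)^-1 /\
           exists t, is_arg u t /\ `|t - 2 * pi * h%:R / k%:R| < theta].

Definition W (R : realType) (d : nat) (beta : R) : set 'rV[R[i]]_d :=
  [set z : 'rV[R[i]]_d | forall j, cabs (z 0 j) < cabs (coord_prod z) `^ beta].

Definition B (R : realType) (d k h : nat) (R0 theta beta : R) :
  set 'rV[R[i]]_d :=
  [set z : 'rV[R[i]]_d | W beta z /\ sector k h R0 theta (coord_prod z)].

Definition uniform_local_basin (R : realType) (d : nat)
  (F : 'rV[R[i]]_d -> 'rV[R[i]]_d) (A : set 'rV[R[i]]_d) : Prop :=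
  F @` A `<=` A /\
  {uniform A, (fun n (z : 'rV[R[i]]_d) => iter n F z) @ \oo -->
              (fun=> (0 : 'rV[R[i]]_d))}.

Definition accumulation_directions (R : realType) (d : nat)
  (u : nat -> 'rV[R[i]]_d) : set 'rV[R[i]]_d :=
  cluster (direction (u n) @[n --> \oo]).

Definition closed_cone (R : realType) (d : nat) (K : set 'rV[R[i]]_d) : Prop :=
  closed K /\ forall (t : R) (w : 'rV[R[i]]_d), 0 <= t -> K w -> K (t%:C *: w).

Definition cvg0_tangent_to (R : realType) (d : nat)
  (u : nat -> 'rV[R[i]]_d) (K : set 'rV[R[i]]_d) : Prop :=
  [/\ closed_cone K, forall n, u n != 0, u n @[n --> \oo] --> (0 : 'rV[R[i]]_d) &
      accumulation_directions u `<=` K].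

Definition cone_over (R : realType) (d : nat) (A : set 'rV[R[i]]_d) :
  set 'rV[R[i]]_d :=
  [set w : 'rV[R[i]]_d | exists t : R, 0 <= t /\ exists2 a, A a & w = t%:C *: a].

Definition positive_unit (R : realType) (d : nat) (v : 'rV[R]_d) : Prop :=
  (forall j, 0 < v 0 j) /\ enorm v = 1.

Definition limit_abs_direction (R : realType) (d : nat)
  (F : 'rV[R[i]]_d -> 'rV[R[i]]_d) (z : 'rV[R[i]]_d) : 'rV[R]_d :=
  lim (abs_direction (iter n F z) @[n --> \oo]).

Definition arg_sum (R : realType) (d k h : nat) (w : 'rV[R[i]]_d) : Prop :=
  exists t : 'I_d -> R, (forall j, is_arg (w 0 j) (t j)) /\
    eqmod2pi (\sum_j t j) (2 * pi * h%:R / k%:R).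

Definition omega (R : realType) (d k h : nat) (v : 'rV[R]_d) :
  set 'rV[R[i]]_d :=
  [set w : 'rV[R[i]]_d | vabs w = v /\ arg_sum k h w].

(* Main.v *)
(* Put u = pi(z), x = u^k and p = kd.  On W(beta) one has
   |z^j| >= |u|^(1-(d-1) beta), so beta (l+d-1) > 2k+1 makes the remainder of F
   relatively O(|x|^2): an orbit in B_h satisfies
     z_{n+1}^j = lambda_j z_n^j (1 - x_n/p + O(|x_n|^2)),
     x_{n+1} = x_n (1 - x_n + O(|x_n|^2)),   1/x_n = n + O(sqrt n).
   Compare it with the orbits lambda^n q_n a of the normal form, where q_n > 0 and
   q_{n+1} = q_n (1 - q_n^p/p): the quotients z_n^j / (lambda_j^n q_n) have relative
   increments O(n^(-3/2)), hence converge to some a^j != 0.  This gives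
   v(z) = |a|/|a|_2, and the sector forces the product of the a^j to be
   exp(2 pi i h/k).  By one-resonance and Kronecker's theorem (lambda^n)_n is dense in
   the torus of unimodular t with product 1, so that omega(z) is exactly the set of
   limit points of the directions, which are asymptotic to lambda^n a/|a|_2.

   To realize a prescribed v, shoot backwards: for a suitable A and large n, every
   point of the tube |w^j / (lambda_j^n q_n a^j) - 1| <= A q_n^(p+1) of index n+1
   is the image under F of a point of the tube of index n, and by compactness some
   orbit stays in all tubes. *)
Require Import Defs.
From HB Require Import structures.
From mathcomp Require Import all_boot all_order all_algebra.
From mathcomp Require Import complex ring lra zify.
From mathcomp Require Import all_classical all_reals all_analysis.
Set Implicit Arguments.
Unset Strict Implicit.
Unset Printing Implicit Defensive.
Import Order.TTheory GRing.Theory Num.Theory.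
Import numFieldNormedType.Exports.
Local Open Scope classical_set_scope.
Local Open Scope complex_scope.
Local Open Scope ring_scope.

(** * The real-valued modulus and the points of the unit circle *)

Section ComplexModulus.
Variable R : realType.
Implicit Types (x y z : R[i]) (r s t : R).

(** The product of the 1 - x_n/p tends to 0, so no coordinate can be followed by itself; only its
    quotient by the same product for the model converges. This is why two parabolic sequences, x_n
    and q_n^p, are compared. The natural error O(log n) in 1/x_n is coarsened to O(sqrt n): sqrt n /
    n^2 is still summable, and both 1/n and n^(-3/2) are bounded by differences of powers of sqrt n.
    Summability is always expressed by such a telescoping bound [g n - g n.+1], never by a series.
    The tube width has exponent p+1 because, to first order in xi = q^p, a backward step amplifies
    relative errors by 1 + xi, which is exactly the rate at which q^p shrinks. Exponent p would give
    a tie; exponent p+1 gains xi/p per step. The relative remainder of F in a tube is O(q^(l-1)),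
    and l > 2p+1 makes it O(xi^2 q), the order of this gain times the width. Since every backward
    step stays inside the tubes, compactness alone yields the orbit: no continuity of v(z) and no
    fixed point is involved. *)

Lemma normc_cabs x : `|x| = (cabs x)%:C.
Proof. by rewrite /cabs normc_def. Qed.

Lemma cabsE x : cabs x = Num.sqrt (complex.Re x ^+ 2 + complex.Im x ^+ 2).
Proof. by rewrite /cabs normc_def. Qed.

Lemma sqr_cabs x : cabs x ^+ 2 = complex.Re x ^+ 2 + complex.Im x ^+ 2.
Proof. by rewrite cabsE sqr_sqrtr // addr_ge0 ?sqr_ge0. Qed.

Lemma cabs_ge0 x : 0 <= cabs x.
Proof. by rewrite cabsE sqrtr_ge0. Qed.

Lemma rcB r s : (r - s)%:C = r%:C - s%:C :> R[i]. Proof. exact: rmorphB. Qed.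

Lemma rcM r s : (r * s)%:C = r%:C * s%:C :> R[i]. Proof. exact: rmorphM. Qed.

Lemma rcV r : (r^-1)%:C = (r%:C)^-1 :> R[i]. Proof. exact: fmorphV. Qed.

Lemma rcX r n : (r ^+ n)%:C = r%:C ^+ n :> R[i]. Proof. exact: rmorphXn. Qed.

Lemma rc1 : (1 : R)%:C = 1 :> R[i]. Proof. by []. Qed.

Lemma rc_nat n : (n%:R : R)%:C = n%:R :> R[i]. Proof. exact: rmorph_nat. Qed.

Lemma cabs_le x r : (`|x| <= r%:C) = (cabs x <= r).
Proof. by rewrite normc_cabs lecR. Qed.

Lemma cabs_lt x r : (`|x| < r%:C) = (cabs x < r).
Proof. by rewrite normc_cabs ltcR. Qed.

Lemma cabs0 : cabs (0 : R[i]) = 0.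
Proof. by apply: complexI; rewrite -normc_cabs normr0. Qed.

Lemma cabs1 : cabs (1 : R[i]) = 1.
Proof. by apply: complexI; rewrite -normc_cabs normr1. Qed.

Lemma cabs_eq0 x : (cabs x == 0) = (x == 0).
Proof. by rewrite -(normr_eq0 x) normc_cabs -(inj_eq (@complexI _)). Qed.

Lemma cabs_gt0 x : (0 < cabs x) = (x != 0).
Proof. by rewrite lt_def cabs_ge0 andbT cabs_eq0. Qed.

Lemma cabsM x y : cabs (x * y) = cabs x * cabs y.
Proof. by apply: complexI; rewrite rmorphM/= -!normc_cabs normrM. Qed.

Lemma cabsV x : cabs x^-1 = (cabs x)^-1.
Proof. by apply: complexI; rewrite fmorphV/= -!normc_cabs normfV. Qed.

Lemma cabsf x y : cabs (x / y) = cabs x / cabs y.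
Proof. by rewrite cabsM cabsV. Qed.

Lemma cabsX x n : cabs (x ^+ n) = cabs x ^+ n.
Proof. by apply: complexI; rewrite rmorphXn/= -!normc_cabs normrX. Qed.

Lemma cabs_prod (I : Type) (r : seq I) (P : pred I) (f : I -> R[i]) :
  cabs (\prod_(i <- r | P i) f i) = \prod_(i <- r | P i) cabs (f i).
Proof. by apply: (big_morph _ cabsM cabs1). Qed.

Lemma cabsN x : cabs (- x) = cabs x.
Proof. by rewrite /cabs normrN. Qed.

Lemma cabsBC x y : cabs (x - y) = cabs (y - x).
Proof. by rewrite /cabs distrC. Qed.

Lemma cabsD x y : cabs (x + y) <= cabs x + cabs y.
Proof. by rewrite -lecR rmorphD/= -!normc_cabs ler_normD. Qed.

Lemma cabsB x y : cabs (x - y) <= cabs x + cabs y.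
Proof. by rewrite -(cabsN y) cabsD. Qed.

Lemma cabs_distD z x y : cabs (x - y) <= cabs (x - z) + cabs (z - y).
Proof. by rewrite -{1}(subrK z x) -addrA cabsD. Qed.

Lemma cabs_subl x y : cabs x - cabs y <= cabs (x - y).
Proof. by rewrite lerBlDr -{1}(subrK y x) cabsD. Qed.

Lemma cabs_addl x y : cabs x - cabs y <= cabs (x + y).
Proof. by rewrite lerBlDr -{1}(addrK y x) cabsB. Qed.

Lemma cabs_dist_norm x y : `|cabs x - cabs y| <= cabs (x - y).
Proof. by rewrite ler_norml lerNl opprB (cabsBC x) cabs_subl cabsBC cabs_subl. Qed.

Lemma cabs_sum (I : Type) (r : seq I) (P : pred I) (f : I -> R[i]) :
  cabs (\sum_(i <- r | P i) f i) <= \sum_(i <- r | P i) cabs (f i).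
Proof.
elim/big_ind2 : _ => [|x a y b xa yb|//]; first by rewrite cabs0.
by rewrite (le_trans (cabsD _ _))// lerD.
Qed.

Lemma cabs_real r : cabs r%:C = `|r|.
Proof. by rewrite cabsE /= expr0n addr0 sqrtr_sqr. Qed.

Lemma cabs_real_ge0 r : 0 <= r -> cabs r%:C = r.
Proof. by move=> r0; rewrite cabs_real ger0_norm. Qed.

Lemma cabs_nat n : cabs (n%:R : R[i]) = n%:R.
Proof. by rewrite -(rmorph_nat (real_complex R)) cabs_real_ge0. Qed.

Lemma Re_le_cabs x : `|complex.Re x| <= cabs x.
Proof. by rewrite -lecR -normc_cabs normc_ge_Re. Qed.

Lemma Im_le_cabs x : `|complex.Im x| <= cabs x.
Proof. by rewrite cabsE -sqrtr_sqr ler_wsqrtr// lerDr sqr_ge0. Qed.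

Lemma cabs_le_ReIm x : cabs x <= `|complex.Re x| + `|complex.Im x|.
Proof.
rewrite -(@ler_pXn2r _ 2)// ?nnegrE ?addr_ge0 ?cabs_ge0//.
rewrite sqr_cabs -(real_normK (num_real (complex.Re x))).
rewrite -(real_normK (num_real (complex.Im x))).
have := normr_ge0 (complex.Re x); have := normr_ge0 (complex.Im x); nra.
Qed.

Definition cis t : R[i] := cos t +i* sin t.

Lemma cabs_cis t : cabs (cis t) = 1.
Proof. by rewrite cabsE /= cos2Dsin2 sqrtr1. Qed.

Lemma cis_neq0 t : cis t != 0.
Proof. by rewrite -cabs_gt0 cabs_cis. Qed.

Lemma cis0 : cis 0 = 1.
Proof. by rewrite /cis cos0 sin0. Qed.

Lemma cisD s t : cis (s + t) = cis s * cis t.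
Proof.
by apply/eqP; rewrite eq_complex /= cosD sinD; apply/andP; split; apply/eqP; ring.
Qed.

Lemma cis_sum (I : Type) (r : seq I) (P : pred I) (f : I -> R) :
  cis (\sum_(i <- r | P i) f i) = \prod_(i <- r | P i) cis (f i).
Proof. exact: (big_morph cis cisD cis0). Qed.

Lemma cisMn t n : cis (t *+ n) = cis t ^+ n.
Proof. by elim: n => [|n IH]; rewrite ?cis0// mulrS cisD IH exprS. Qed.

Lemma cisN t : cis (- t) = (cis t)^-1.
Proof. by apply: (mulfI (cis_neq0 t)); rewrite -cisD subrr cis0 divff ?cis_neq0. Qed.

End ComplexModulus.

(** * Neighbourhoods, cluster points and compactness in C^d with real radii *)

Section Topology.
Variables (R : realType) (d : nat).

Lemma nbhs_rVP (K : numFieldType) (z : 'rV[K]_d) (A : set 'rV[K]_d) :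
  nbhs z A <-> exists2 e : K, 0 < e & forall w : 'rV[K]_d, (forall j, `|z 0 j - w 0 j| < e) -> A w.
Proof.
split=> [/nbhs_ballP[e /= e0 eA]|[e e0 eA]].
  by exists e => // w zw; apply: eA; split => // i j; rewrite ord1; apply: zw.
by apply/nbhs_ballP; exists e => //= w [_ zw]; apply: eA => j; exact: (zw 0 j).
Qed.

(** Norms and radii over [R[i]] are themselves complex numbers; a positive one equals its real part,
    so later estimates may use real radii and [cabs]. *)
Lemma nbhs_rVcP (z : 'rV[R[i]]_d) (A : set 'rV[R[i]]_d) :
  nbhs z A <->
  exists2 e : R, 0 < e & forall w : 'rV[R[i]]_d, (forall j, cabs (z 0 j - w 0 j) < e) -> A w.
Proof.
rewrite (@nbhs_rVP R[i]); split=> -[e e0 eA].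
  exists (complex.Re e); first by move: e0; rewrite ltcE => /andP[].
  move=> w zw; apply: eA => j; rewrite -(@RRe_real _ e) ?gtr0_real//.
  by rewrite cabs_lt.
by exists e%:C; rewrite ?ltcR// => w zw; apply: eA => j; rewrite -cabs_lt.
Qed.

Lemma cvg_rVP (T : Type) (F : set_system T) (FF : Filter F) (f : T -> 'rV[R[i]]_d)
    (z : 'rV[R[i]]_d) :
  f @ F --> z <->
  forall e : R, 0 < e -> \forall x \near F, forall j, cabs (z 0 j - f x 0 j) < e.
Proof.
split=> [fz e e0|fz A /nbhs_rVcP[e e0 eA]].
  apply: (fz [set w : 'rV[R[i]]_d | forall j, cabs (z 0 j - w 0 j) < e]).
  by apply/nbhs_rVcP; exists e.
by apply: filterS (fz e e0) => x /eA.
Qed.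

Lemma cvg_rVrP (T : Type) (F : set_system T) (FF : Filter F) (f : T -> 'rV[R]_d)
    (z : 'rV[R]_d) :
  f @ F --> z <->
  forall e : R, 0 < e -> \forall x \near F, forall j, `|z 0 j - f x 0 j| < e.
Proof.
split=> [fz e e0|fz A /(@nbhs_rVP R)[e e0 eA]].
  apply: (fz [set w : 'rV[R]_d | forall j, `|z 0 j - w 0 j| < e]).
  by apply/(@nbhs_rVP R); exists e.
by apply: filterS (fz e e0) => x /eA.
Qed.

Lemma cluster_seqP (u : nat -> 'rV[R[i]]_d) (w : 'rV[R[i]]_d) :
  cluster (u n @[n --> \oo]) w <->
  forall (e : R) N, 0 < e -> exists2 n, (N <= n)%N & forall j, cabs (w 0 j - u n 0 j) < e.
Proof.
split=> [clw e N e0|clw A B [N _ NA] /nbhs_rVcP[e e0 eB]].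
  have [||_ [[n Nn <-] wn]] :=
    clw [set x | exists2 n, (N <= n)%N & u n = x]
        [set x : 'rV[R[i]]_d | forall j, cabs (w 0 j - x 0 j) < e].
  - by exists N => // n Nn; exists n.
  - by apply/nbhs_rVcP; exists e.
  by exists n.
have [n Nn wn] := clw e N e0.
by exists (u n); split; [exact: NA|exact: eB].
Qed.

Lemma closed_rVP (A : set 'rV[R[i]]_d) :
  (forall w : 'rV[R[i]]_d,
     (forall e : R, 0 < e -> exists2 x, A x & forall j, cabs (w 0 j - x 0 j) < e) -> A w) ->
  closed A.
Proof.
move=> AP w clw; apply: AP => e e0.
have [|x [Ax xw]] := clw [set x : 'rV[R[i]]_d | forall j, cabs (w 0 j - x 0 j) < e].
  by apply/nbhs_rVcP; exists e.
by exists x.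
Qed.

Lemma continuous_rVP (f : 'rV[R[i]]_d -> 'rV[R[i]]_d) (z : 'rV[R[i]]_d) :
  {for z, continuous f} -> forall e : R, 0 < e -> exists2 r : R, 0 < r &
    forall w : 'rV[R[i]]_d, (forall j, cabs (z 0 j - w 0 j) < r) ->
      forall j, cabs (f z 0 j - f w 0 j) < e.
Proof.
move=> /cvg_rVP cf e e0; have /nbhs_rVcP[r r0 rP] := cf e e0.
by exists r.
Qed.

Lemma cabs_le_norm (z : 'rV[R[i]]_d) j : (cabs (z 0 j))%:C <= `|z|.
Proof.
rewrite -normc_cabs [leRHS]mx_normE; exact: (le_bigmax _ (fun i => `|z i.1 i.2|%:nng) (0, j)).
Qed.

Lemma norm_le_cabs (z : 'rV[R[i]]_d) (M : R) :
  0 <= M -> (forall j, cabs (z 0 j) <= M) -> `|z| <= M%:C.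
Proof.
move=> M0 zM; have M0' : 0 <= M%:C by rewrite lecR.
rewrite [leLHS]mx_normE -[M%:C]/((NngNum M0')%:num) num_le; apply/bigmax_leP; split=> [|[i j] _] /=.
  by rewrite -num_le.
by rewrite -num_le/= ord1 cabs_le.
Qed.

(** [M] is any majorant of the coordinate moduli, not the norm: on W(beta) it will be |pi(z)|^beta,
    in the tubes the largest coordinate. *)
Lemma bigO_rVP (f : 'rV[R[i]]_d -> 'rV[R[i]]_d) (l : nat) :
  f =O_ (0 : 'rV[R[i]]_d) (fun z : 'rV[R[i]]_d => `|z| ^+ l : R[i]) ->
  exists C r : R, [/\ 0 < C, 0 < r & forall (z : 'rV[R[i]]_d) (M : R), 0 <= M -> M < r ->
    (forall j, cabs (z 0 j) <= M) -> forall j, cabs (f z 0 j) <= C * M ^+ l].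
Proof.
move=> /eqO_exP[k k0] /nbhs_rVcP[r r0 rP].
exists (complex.Re k), r; split => //; first by move: k0; rewrite ltcE => /andP[].
move=> z M M0 Mr zM j.
have kE : (complex.Re k)%:C = k by rewrite RRe_real// gtr0_real.
rewrite -lecR (le_trans (cabs_le_norm _ _))//.
apply: le_trans (rP z _) _.
  by move=> i; rewrite mxE sub0r cabsN (le_lt_trans (zM i)).
rewrite rmorphM rmorphXn/= kE ler_wpM2l// ?(ltW k0)// normrX normr_id lerXn2r ?nnegrE//.
- by rewrite lecR.
exact: norm_le_cabs.
Qed.

(** The disc is closed and lies in the continuous image of a compact square of R x R. *)
Lemma compact_disc (c : R[i]) (r : R) : compact [set x : R[i] | cabs (x - c) <= r].
Proof.
pose f (p : R * R) : R[i] := p.1 +i* p.2.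
have cf : continuous f.
  move=> p; apply/cvgrPdist_lt => e e0.
  have eE : e = (complex.Re e)%:C by rewrite RRe_real// gtr0_real.
  have e'0 : 0 < complex.Re e by move: e0; rewrite ltcE => /andP[].
  have e20 : 0 < complex.Re e / 2 by rewrite divr_gt0.
  have /cvgrPdist_lt/(_ _ e20) h1 : (fun q : R * R => q.1) @ p --> p.1 by exact: cvg_fst.
  have /cvgrPdist_lt/(_ _ e20) h2 : (fun q : R * R => q.2) @ p --> p.2 by exact: cvg_snd.
  near=> q; rewrite [ltRHS]eE cabs_lt (le_lt_trans (cabs_le_ReIm _))//=.
  by rewrite [ltRHS]splitr ltrD//; near: q.
pose a := complex.Re c; pose b := complex.Im c.
have cI : compact (f @` (`[a - r, a + r] `*` `[b - r, b + r])).
  apply: continuous_compact; first exact: continuous_subspaceT.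
  by apply: compact_setX; exact: segment_compact.
apply: (subclosed_compact _ cI).
  move=> w clw /=; apply/ler_addgt0Pr => e e0.
  have e0' : 0 < e%:C by rewrite ltcR.
  have [x [/= xr wx]] := clw _ (nbhsx_ballx w e%:C e0').
  move: wx; rewrite -ball_normE /= cabs_lt => wx.
  by rewrite (le_trans (cabs_distD x _ _))// addrC lerD// ltW.
move=> x /= xr; exists (complex.Re x, complex.Im x); last by case: (x).
have := le_trans (Re_le_cabs _) xr; have := le_trans (Im_le_cabs _) xr.
by rewrite !raddfB/= !in_itv/= -/a -/b !ler_distl => -> ->.
Unshelve. all: by end_near.
Qed.

Lemma compact_box (c : 'I_d -> R[i]) (r : 'I_d -> R) :
  compact [set w : 'rV[R[i]]_d | forall j, cabs (w 0 j - c j) <= r j].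
Proof.
exact: (@rV_compact _ _ (fun j => [set x : R[i] | cabs (x - c j) <= r j])
  (fun j => @compact_disc (c j) (r j))).
Qed.

End Topology.

(** * Convergence of complex sequences and of perturbed products *)

Section ComplexSequences.
Variable R : realType.

Lemma ccvgP (u : nat -> R[i]) (l : R[i]) :
  u n @[n --> \oo] --> l <->
  forall e : R, 0 < e -> exists N, forall n, (N <= n)%N -> cabs (u n - l) < e.
Proof.
split=> [/cvgrPdist_lt ul e e0|ul].
  have e0' : 0 < e%:C by rewrite ltcR.
  have [N _ NP] := ul _ e0'; exists N => n /NP/=.
  by rewrite cabs_lt cabsBC.
apply/cvgrPdist_lt => e e0.
have eE : e = (complex.Re e)%:C by rewrite RRe_real// gtr0_real.
have /ul[N NP] : 0 < complex.Re e by move: e0; rewrite ltcE => /andP[].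
by exists N => // n /NP/=; rewrite eE cabs_lt cabsBC.
Qed.

Lemma cvg_cabs (u : nat -> R[i]) (l : R[i]) :
  u n @[n --> \oo] --> l -> cabs (u n) @[n --> \oo] --> cabs l.
Proof.
move=> /ccvgP ul; apply/cvgrPdist_lt => e /ul[N NP]; exists N => // n /NP /=.
by apply: le_lt_trans; rewrite cabsBC cabs_dist_norm.
Qed.

Lemma cvg_prod (I : Type) (r : seq I) (u : I -> nat -> R[i]) (l : I -> R[i]) :
  (forall i, u i n @[n --> \oo] --> l i) ->
  \prod_(i <- r) u i n @[n --> \oo] --> \prod_(i <- r) l i.
Proof.
move=> ul; elim: r => [|i r IH].
  by under eq_fun do rewrite big_nil; rewrite big_nil; exact: cvg_cst.
under eq_fun do rewrite big_cons; rewrite big_cons.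
exact: (@cvgM R[i] _ _ _ (u i) (fun n => \prod_(j <- r) u j n) (l i) _ (ul i) IH).
Qed.

(** Real and imaginary parts are 1-Lipschitz for [cabs], so completeness of R applies to each. *)
Lemma ccauchy_cvg (u : nat -> R[i]) :
  (forall e : R, 0 < e -> exists N, forall m n, (N <= m)%N -> (N <= n)%N ->
     cabs (u m - u n) < e) -> exists l : R[i], u n @[n --> \oo] --> l.
Proof.
move=> uC.
have aux (f : R[i] -> R) : (forall x y, `|f x - f y| <= cabs (x - y)) ->
    exists l, forall e, 0 < e -> exists N, forall n, (N <= n)%N -> `|f (u n) - l| < e.
  move=> fd; suff /cvg_ex[l /cvgrPdist_lt ul] : cvg (f (u n) @[n --> \oo]).
    by exists l => e /ul[N _ NP]; exists N => n /NP; rewrite distrC.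
  apply/cauchy_cvgP/cauchy_ballP => e e0; have [N NP] := uC e e0.
  exists ([set x | exists2 n, (N <= n)%N & f (u n) = x],
          [set x | exists2 n, (N <= n)%N & f (u n) = x]).
    by split; exists N => // n Nn; exists n.
  move=> [_ _] /= [[m Nm <-] [n Nn <-]]; rewrite /ball/=.
  exact: le_lt_trans (fd _ _) (NP _ _ Nm Nn).
have [a aP] := aux (@complex.Re R) ltac:(by move=> x y; rewrite -raddfB; exact: Re_le_cabs).
have [b bP] := aux (@complex.Im R) ltac:(by move=> x y; rewrite -raddfB; exact: Im_le_cabs).
exists (a +i* b); apply/ccvgP => e e0.
have e20 : 0 < e / 2 by rewrite divr_gt0.
have [N1 N1P] := aP _ e20; have [N2 N2P] := bP _ e20.
exists (maxn N1 N2) => n; rewrite geq_max => /andP[/N1P h1 /N2P h2].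
rewrite (le_lt_trans (cabs_le_ReIm _))// !raddfB/= [ltRHS]splitr ltrD//.
Qed.

(* The partial products of 1 + b_n stay within the factors 1 - s and 1/(1 - s),
   where s is the sum of the |b_n|. *)
Lemma cvg_mul_perturb (a b : nat -> R[i]) (g : nat -> R) (N : nat) :
  (forall n, (N <= n)%N -> a n != 0) ->
  (forall n, (N <= n)%N -> a n.+1 = a n * (1 + b n)) ->
  (forall n, (N <= n)%N -> cabs (b n) <= g n - g n.+1) ->
  (forall n, 0 <= g n) -> g n @[n --> \oo] --> 0 ->
  exists2 l : R[i], l != 0 & a n @[n --> \oo] --> l.
Proof.
move=> a0 aS bg g0 /cvgrPdist_lt gcvg.
(* From [M] on, the |b n| sum to at most [g M] <= 1/2; this will keep |a n| between A/2 and 2A and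
   the limit away from 0. *)
have [N1 _ N1P] := gcvg 2^-1 ltac:(by rewrite invr_gt0).
pose M := maxn N N1; pose A := cabs (a M).
have A0 : 0 < A by rewrite cabs_gt0 a0// leq_maxl.
have gM : g M <= 2^-1.
  by have := N1P M (leq_maxr _ _); rewrite /= sub0r normrN ger0_norm// => /ltW.
have Hb n : (M <= n)%N -> cabs (b n) <= g n - g n.+1.
  by move=> Mn; apply: bg; rewrite (leq_trans (leq_maxl _ _) Mn).
have HS n : (M <= n)%N -> a n.+1 = a n * (1 + b n).
  by move=> Mn; apply: aS; rewrite (leq_trans (leq_maxl _ _) Mn).
(* With s = g M - g n, both bounds pass to [n.+1] since (1 - s)(1 - |b|) >= 1 - s - |b| and (1 +
   |b|)(1 - s - |b|) <= 1 - s. *)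
have key n : (M <= n)%N ->
    [/\ g n <= g M, cabs (a n) * (1 - (g M - g n)) <= A & A * (1 - (g M - g n)) <= cabs (a n)].
  elim: n => [|n IH].
    by rewrite leqn0 => /eqP M0; rewrite /A M0 subrr subr0 !mulr1.
  rewrite leq_eqVlt => /orP[/eqP <-|]; first by rewrite subrr subr0 !mulr1.
  rewrite ltnS => Mn; have [i1 i2 i3] := IH Mn.
  have b0 := cabs_ge0 (b n); have bn := Hb n Mn; have gn := g0 n; have gn1 := g0 n.+1.
  have h1 : cabs (1 + b n) <= 1 + cabs (b n) by rewrite -[X in _ <= X + _](cabs1 R) cabsD.
  have h2 : 1 - cabs (b n) <= cabs (1 + b n) by rewrite -[X in X - _ <= _](cabs1 R) cabs_addl.
  have an0 := cabs_ge0 (a n).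
  split; first lra.
    rewrite (HS n Mn) cabsM; apply: le_trans i2; rewrite -mulrA ler_wpM2l//.
    have : cabs (1 + b n) * (1 - (g M - g n.+1)) <= (1 + cabs (b n)) * (1 - (g M - g n.+1)).
      by rewrite ler_wpM2r//; lra.
    nra.
  rewrite (HS n Mn) cabsM.
  have : cabs (a n) * (1 - cabs (b n)) <= cabs (a n) * cabs (1 + b n) by rewrite ler_wpM2l.
  have : A * (1 - (g M - g n)) * (1 - cabs (b n)) <= cabs (a n) * (1 - cabs (b n)).
    by rewrite ler_wpM2r//; lra.
  have : A * (1 - (g M - g n.+1)) <= A * (1 - (g M - g n)) * (1 - cabs (b n)).
    rewrite -mulrA ler_wpM2l//; [exact: ltW|nra].
  lra.
have bnd n : (M <= n)%N -> cabs (a n) <= 2 * A.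
  by move=> /key[h1 h2 _]; have := g0 n; have := cabs_ge0 (a n); nra.
have diff n k : (M <= n)%N -> cabs (a (n + k)%N - a n) <= 2 * A * (g n - g (n + k)%N).
  move=> Mn; elim: k => [|k IH]; first by rewrite addn0 !subrr cabs0 mulr0.
  have Mnk : (M <= n + k)%N by rewrite (leq_trans Mn)// leq_addr.
  rewrite addnS; apply: le_trans (cabs_distD (a (n + k)%N) _ _) _.
  have -> : a (n + k).+1 - a (n + k)%N = a (n + k)%N * b (n + k)%N by rewrite HS//; ring.
  rewrite cabsM.
  have := bnd _ Mnk; have := Hb _ Mnk; have := cabs_ge0 (b (n + k)%N).
  have := cabs_ge0 (a (n + k)%N); nra.
have [l al] : exists l : R[i], a n @[n --> \oo] --> l.
  apply: ccauchy_cvg => e e0.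
  have [N2 _ N2P] := gcvg (e / (4 * A)) ltac:(by rewrite divr_gt0// mulr_gt0).
  pose P := maxn M N2.
  have hP n : (P <= n)%N -> cabs (a n - a P) < e / 2.
    move=> Pn; rewrite -(subnKC Pn); apply: le_lt_trans (diff _ _ (leq_maxl _ _)) _.
    have := N2P P (leq_maxr _ _); rewrite /= sub0r normrN ger0_norm//.
    rewrite ltr_pdivlMr; last by rewrite mulr_gt0.
    have := g0 (P + (n - P))%N; nra.
  exists P => m n Pm Pn; apply: le_lt_trans (cabs_distD (a P) _ _) _.
  by rewrite [ltRHS]splitr ltrD ?hP// cabsBC hP.
exists l => //; rewrite -cabs_gt0; apply: lt_le_trans (_ : A / 2 <= _).
  by rewrite divr_gt0.
apply: (cvgr_to_ge (cvg_cabs al)); exists M => // n /= /key[h1 h2 h3].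
apply: le_trans h3; rewrite ler_pM2l//; have := g0 n; lra.
Qed.

End ComplexSequences.

(** * Parabolic recursions x_{n+1} = x_n (1 - x_n + O(|x_n|^2)) *)

Section ParabolicSequences.
Variable R : realType.

(** Replaces the logarithmic growth of the harmonic sum by a telescoping square root, which is
    coarser but sufficient. *)
Lemma invn_le_sqrt_diff (n : nat) : (0 < n)%N ->
  (n%:R^-1 : R) <= 4 * (Num.sqrt n.+1%:R - Num.sqrt n%:R).
Proof.
move=> n0; set a := Num.sqrt n%:R; set b := Num.sqrt n.+1%:R.
have a2 : a ^+ 2 = n%:R by rewrite sqr_sqrtr.
have b2 : b ^+ 2 = n%:R + 1 by rewrite sqr_sqrtr// natr1.
have a0 : 0 <= a := sqrtr_ge0 _. have b0 : 0 <= b := sqrtr_ge0 _.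
have n1 : (1 : R) <= n%:R by rewrite ler1n.
have a1 : 1 <= a by nra.
have ab : b <= 2 * a by nra.
have n0' : (0 : R) < n%:R by rewrite ltr0n.
rewrite -(ler_pM2r n0') mulVf ?gt_eqF// -a2.
have : (b - a) * (b + a) = 1 by lra.
nra.
Qed.

(** The left side is n^(-3/2); the telescoping form on the right is the one [cvg_mul_perturb] asks
    for. *)
Lemma sqrt_div_sqr_le (n : nat) : (0 < n)%N ->
  (Num.sqrt n%:R / n%:R ^+ 2 : R) <= 6 * ((Num.sqrt n%:R)^-1 - (Num.sqrt n.+1%:R)^-1).
Proof.
move=> n0; set a := Num.sqrt n%:R; set b := Num.sqrt n.+1%:R.
have a2 : a ^+ 2 = n%:R by rewrite sqr_sqrtr.
have b2 : b ^+ 2 = n%:R + 1 by rewrite sqr_sqrtr// natr1.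
have a0 : 0 <= a := sqrtr_ge0 _. have b0 : 0 <= b := sqrtr_ge0 _.
have n1 : (1 : R) <= n%:R by rewrite ler1n.
have a1 : 1 <= a by nra.
have ab : b <= 2 * a by nra.
have b1 : 1 <= b by nra.
have ba : b - a = (b + a)^-1.
  by apply: (@mulIf _ (b + a)); [|rewrite mulVf]; rewrite ?gt_eqF//; lra.
have -> : a^-1 - b^-1 = (b + a)^-1 * (a * b)^-1.
  by rewrite -ba; field; rewrite !gt_eqF//; lra.
have -> : a / n%:R ^+ 2 = (a ^+ 3)^-1 by rewrite -a2; field; rewrite gt_eqF//; lra.
have a3 : 0 < a ^+ 3 by rewrite exprn_gt0//; lra.
have ab3 : 0 < (b + a) * (a * b) by rewrite !mulr_gt0//; lra.
rewrite -invfM -[leLHS]mul1r ler_pdivrMr// mulrAC ler_pdivlMr// mul1r.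
have : (b + a) * (a * b) <= (3 * a) * (a * (2 * a)).
  by rewrite ler_pM// ?mulr_ge0// ?addr_ge0//; [lra|rewrite ler_wpM2l].
by rewrite (exprS a 2) expr2; lra.
Qed.

(* The reciprocals move by almost exactly one unit at each step. *)
Lemma parabolic_inv_asymp (x e : nat -> R[i]) (C : R) (N0 : nat) :
  (forall n, (N0 <= n)%N -> x n != 0) -> x n @[n --> \oo] --> (0 : R[i]) ->
  (forall n, (N0 <= n)%N -> x n.+1 = x n * (1 - x n + e n)) ->
  0 <= C -> (forall n, (N0 <= n)%N -> cabs (e n) <= C * cabs (x n) ^+ 2) ->
  exists K N, [/\ 0 <= K, (0 < N)%N & forall n, (N <= n)%N ->
    cabs (x n) <= 4 / n%:R /\ cabs ((x n)^-1 - n%:R) <= K * Num.sqrt n%:R].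
Proof.
move=> x0 /ccvgP xcvg xS C0 eC.
(* The increment of 1/x_n differs from 1 by (x - e - e/x) / (1 - x + e). The numerator is at most (1
   + 2C)|x|, and the denominator is at least 1/2 in modulus. *)
pose D := 2 * (1 + 2 * C).
have D0 : 0 < D by rewrite /D; lra.
have [N1 N1P] := xcvg (2 * D)^-1 ltac:(by rewrite invr_gt0 mulr_gt0).
pose N := maxn N0 N1.
have step n : (N <= n)%N -> cabs ((x n.+1)^-1 - (x n)^-1 - 1) <= D * cabs (x n) /\
    D * cabs (x n) <= 2^-1.
  rewrite geq_max => /andP[n0 /N1P]; rewrite subr0 => xn.
  have xn0 := x0 n n0; have xSn0 := x0 n.+1 (leqW n0).
  have {}xn : D * cabs (x n) <= 2^-1.
    by move/ltW: xn; rewrite invfM -(ler_pM2l D0) mulrCA divff ?gt_eqF// mulr1.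
  split => //; have en := eC n n0; have xp := cabs_ge0 (x n).
  set y := 1 - x n + e n.
  have x4 : cabs (x n) <= 4^-1 by rewrite /D in xn; nra.
  have e4 : cabs (e n) <= 4^-1 by rewrite /D in xn; nra.
  have y2 : 2^-1 <= cabs y.
    have := cabs_addl (1 - x n) (e n); have := cabs_subl 1 (x n).
    by rewrite cabs1 -/y; lra.
  have y0 : y != 0 by rewrite -cabs_gt0; lra.
  have -> : (x n.+1)^-1 - (x n)^-1 - 1 = (x n - e n - e n / x n) / y.
    by rewrite xS// -/y /y; field; rewrite xn0 andbT -/y.
  rewrite cabsf ler_pdivrMr ?cabs_gt0//.
  have h1 : cabs (e n / x n) <= C * cabs (x n).
    by rewrite cabsf ler_pdivrMr ?cabs_gt0// -mulrA -expr2.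
  have := cabsB (x n - e n) (e n / x n); have := cabsB (x n) (e n).
  have : D * cabs (x n) * 2^-1 <= D * cabs (x n) * cabs y by rewrite ler_wpM2l// mulr_ge0// ltW.
  have : cabs (e n) <= C * cabs (x n).
    by rewrite (le_trans en)// expr2 ler_wpM2l// ler_piMl//; lra.
  have : D * cabs (x n) * 2^-1 = cabs (x n) + 2 * (C * cabs (x n)) by rewrite /D; field.
  lra.
(* Each step moves 1/x_n by 1 up to an error of at most 1/2, so its real part grows linearly; this
   is the first, rough decay of x_n. *)
have Regrow n : complex.Re (x N)^-1 + n%:R / 2 <= complex.Re (x (N + n)%N)^-1.
  elim: n => [|n IH]; first by rewrite mul0r addr0 addn0.
  have [s1 s2] := step (N + n)%N (leq_addr _ _).
  have := le_trans (Re_le_cabs _) (le_trans s1 s2).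
  rewrite addnS !raddfB/= ler_norml => /andP[h _].
  rewrite -natr1 mulrDl; lra.
pose a := complex.Re (x N)^-1.
(* Beyond this threshold a + (n - N)/2 is at least n/4. *)
have [M MP] : exists M : nat, 4 * `|a| + 2 * N%:R < M%:R.
  by exists (Num.truncn (4 * `|a| + 2 * N%:R)).+1; rewrite truncnS_gt.
pose N2 := (maxn N M).+1.
have xbig n : (N2 <= n)%N -> n%:R / 4 <= cabs (x n)^-1.
  move=> N2n; have [Nn Mn] : (N <= n)%N /\ (M <= n)%N.
    by move: N2n; rewrite /N2 -maxnSS geq_max => /andP[/ltnW ? /ltnW].
  apply: le_trans (le_trans (ler_norm _) (Re_le_cabs _)).
  apply: le_trans (_ : a + (n - N)%:R / 2 <= _); last first.
    by rewrite -[X in x X](subnKC Nn); exact: Regrow.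
  rewrite natrB//; have : (M%:R : R) <= n%:R by rewrite ler_nat.
  have := ler_norm (- a); rewrite normrN; lra.
have xsmall n : (N2 <= n)%N -> cabs (x n) <= 4 / n%:R.
  move=> N2n; have n0 : (0 : R) < n%:R by rewrite ltr0n; apply: leq_trans N2n.
  have := xbig n N2n; rewrite cabsV.
  rewrite -lef_pV2 ?posrE ?invrK ?divr_gt0// ?invr_gt0; last first.
    rewrite cabs_gt0 x0//; apply: leq_trans N2n; apply: leqW; rewrite leq_max.
    by rewrite leq_max leqnn.
  by rewrite invfM invrK mulrC.
pose K0 := cabs ((x N2)^-1 - N2%:R).
exists (K0 + 16 * D), N2; split => //; first by rewrite addr_ge0 ?cabs_ge0// mulr_ge0// ltW.
(* The rough bound |x n| <= 4/n is fed back: the errors D |x n| are dominated by 16 D times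
   differences of square roots, which telescope. *)
have near k : cabs ((x (N2 + k)%N)^-1 - (N2 + k)%:R) <= K0 + 16 * D * Num.sqrt (N2 + k)%:R.
  elim: k => [|k IH]; first by rewrite addn0 lerDl mulr_ge0 ?sqrtr_ge0// mulr_ge0// ltW.
  set n := (N2 + k)%N in IH *; rewrite addnS -/n.
  have N2n : (N2 <= n)%N by rewrite leq_addr.
  have [s1 _] : _ := step n ltac:(by apply: leq_trans N2n; rewrite /N2 leqW// leq_maxl).
  have -> : (x n.+1)^-1 - n.+1%:R = ((x n)^-1 - n%:R) + ((x n.+1)^-1 - (x n)^-1 - 1).
    by rewrite -natr1; ring.
  have n0 : (0 < n)%N by apply: leq_trans N2n.
  have h := invn_le_sqrt_diff n0.
  have h2 : D * cabs (x n) <= D * (4 / n%:R) by rewrite ler_wpM2l ?xsmall// ltW.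
  have h3 : D * (4 / n%:R) <= 16 * D * (Num.sqrt n.+1%:R - Num.sqrt n%:R) by nra.
  apply: le_trans (cabsD _ _) _; lra.
move=> n N2n; split; first exact: xsmall.
have := near (n - N2)%N; rewrite subnKC// => h; apply: le_trans h _.
rewrite [leRHS]mulrDl lerD2r ler_peMr ?cabs_ge0//.
by rewrite -[leLHS]sqrtr1 ler_wsqrtr// ler1n; apply: leq_trans N2n.
Qed.

(** Both reciprocals are n + O(sqrt n), so 1/y - 1/x is O(sqrt n). Multiplying by x gives x/y - 1 =
    O(n^(-1/2)), and multiplying by x y gives x - y = O(n^(-3/2)). *)
Lemma parabolic_compare (x y e f : nat -> R[i]) (C : R) (N0 : nat) :
  (forall n, (N0 <= n)%N -> x n != 0) -> x n @[n --> \oo] --> (0 : R[i]) ->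
  (forall n, (N0 <= n)%N -> y n != 0) -> y n @[n --> \oo] --> (0 : R[i]) ->
  (forall n, (N0 <= n)%N -> x n.+1 = x n * (1 - x n + e n)) ->
  (forall n, (N0 <= n)%N -> y n.+1 = y n * (1 - y n + f n)) ->
  0 <= C ->
  (forall n, (N0 <= n)%N -> cabs (e n) <= C * cabs (x n) ^+ 2) ->
  (forall n, (N0 <= n)%N -> cabs (f n) <= C * cabs (y n) ^+ 2) ->
  (exists K N, [/\ 0 <= K, (0 < N)%N & forall n, (N <= n)%N ->
    cabs (x n - y n) + cabs (x n) ^+ 2 <=
      K * ((Num.sqrt n%:R)^-1 - (Num.sqrt n.+1%:R)^-1)]) /\
  x n / y n @[n --> \oo] --> (1 : R[i]).
Proof.
move=> x0 xc y0 yc xS yS C0 eC fC.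
have [K1 [N1 [K10 N10 H1]]] := parabolic_inv_asymp x0 xc xS C0 eC.
have [K2 [N2 [K20 N20 H2]]] := parabolic_inv_asymp y0 yc yS C0 fC.
split; last first.
  apply/ccvgP => e0 e00; pose c := 4 * (K1 + K2); have c0 : 0 <= c by rewrite mulr_ge0// addr_ge0.
  exists (maxn (Num.truncn ((c / e0) ^+ 2)).+1 (maxn N0 (maxn N1 N2))) => n.
  rewrite !geq_max => /and4P[Nn N0n N1n N2n].
  have [x4 xn] := H1 n N1n; have [_ yn] := H2 n N2n.
  have n0' : (0 : R) < n%:R by rewrite ltr0n; apply: leq_trans N1n.
  set s := Num.sqrt n%:R in xn yn *.
  have s0 : 0 < s by rewrite sqrtr_gt0.
  have hn : (c / e0) ^+ 2 < n%:R by apply: lt_le_trans (truncnS_gt _) _; rewrite ler_nat.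
  have cs : c / e0 < s.
    rewrite -(@ltr_pXn2r _ 2)// ?nnegrE ?(ltW s0) ?divr_ge0 ?(ltW e00)//.
    by rewrite sqr_sqrtr// ltW.
  have -> : x n / y n - 1 = ((y n)^-1 - n%:R - ((x n)^-1 - n%:R)) * x n.
    by field; rewrite x0// y0.
  rewrite cabsM; set A := cabs (_ - _).
  have hA : A <= (K1 + K2) * s by apply: le_trans (cabsB _ _) _; lra.
  apply: (@le_lt_trans _ _ ((K1 + K2) * s * (4 / n%:R))); first by rewrite ler_pM ?cabs_ge0.
  have -> : (K1 + K2) * s * (4 / n%:R) = c / s.
    by rewrite -[n%:R]sqr_sqrtr ?(ltW n0')// -/s /c; field; rewrite gt_eqF.
  by rewrite ltr_pdivrMr// -ltr_pdivrMl// mulrC.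
exists (6 * (16 * (K1 + K2) + 16)), (maxn N0 (maxn N1 N2)).
split; first by rewrite mulr_ge0// addr_ge0// mulr_ge0// addr_ge0.
  by rewrite !leq_max N10 orbT.
move=> n; rewrite !geq_max => /and3P[N0n N1n N2n].
have [x4 xn] := H1 n N1n; have [y4 yn] := H2 n N2n.
have n0 : (0 < n)%N by apply: leq_trans N1n.
have n0' : (0 : R) < n%:R by rewrite ltr0n.
apply: le_trans (_ : (16 * (K1 + K2) + 16) * (Num.sqrt n%:R / n%:R ^+ 2) <= _); last first.
  rewrite [6 * _]mulrC -[leRHS]mulrA ler_wpM2l ?sqrt_div_sqr_le//.
  by rewrite addr_ge0// mulr_ge0// addr_ge0.
set s := Num.sqrt n%:R in xn yn *.
have s1 : 1 <= s by rewrite -[leLHS]sqrtr1 ler_wsqrtr// ler1n.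
have -> : x n - y n = ((y n)^-1 - n%:R - ((x n)^-1 - n%:R)) * (x n * y n).
  by field; rewrite x0// y0.
rewrite !cabsM; set A := cabs (_ - _).
have hA : A <= (K1 + K2) * s by apply: le_trans (cabsB _ _) _; lra.
have h1 : cabs (x n) * cabs (y n) <= (4 / n%:R) * (4 / n%:R) by rewrite ler_pM ?cabs_ge0.
have h2 : A * (cabs (x n) * cabs (y n)) <= (K1 + K2) * s * ((4 / n%:R) * (4 / n%:R)).
  by rewrite ler_pM ?cabs_ge0// mulr_ge0 ?cabs_ge0.
have h3 : cabs (x n) ^+ 2 <= (4 / n%:R) * (4 / n%:R) by rewrite expr2 ler_pM ?cabs_ge0.
have -> : (16 * (K1 + K2) + 16) * (s / n%:R ^+ 2) =
   (K1 + K2) * s * ((4 / n%:R) * (4 / n%:R)) + s * ((4 / n%:R) * (4 / n%:R)).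
  by field; rewrite gt_eqF.
rewrite lerD// (le_trans h3)// ler_peMl// mulr_ge0// divr_ge0// ltW.
Qed.

End ParabolicSequences.

(** * First-order expansion of products of factors close to 1 *)

Section Products.
Variable R : realType.

(** A new factor turns the error into (1 + b i) times the old error plus b i times the old sum, at
    most (2 * 4^n + n) m^2 for n earlier factors; n <= 2 * 4^n closes the induction. *)
Lemma prod1D_expand (I : Type) (r : seq I) (b : I -> R[i]) (m : R) :
  0 <= m <= 1 -> (forall i, cabs (b i) <= m) ->
  cabs (\prod_(i <- r) (1 + b i) - (1 + \sum_(i <- r) b i)) <= 4 ^+ size r * m ^+ 2.
Proof.
move=> /andP[m0 m1] bm.
have Sle (s : seq I) : cabs (\sum_(i <- s) b i) <= (size s)%:R * m.
  elim: s => [|i s IH]; first by rewrite big_nil cabs0 mul0r.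
  by rewrite big_cons (le_trans (cabsD _ _))//= -natr1 mulrDl mul1r addrC lerD.
have pow4 n : (n%:R : R) <= 2 * 4 ^+ n.
  elim: n => [|n IH]; first by rewrite expr0 mulr1.
  have : (1 : R) <= 4 ^+ n by rewrite exprn_ege1// ler1n.
  by rewrite -[n.+1%:R]natr1 exprS; lra.
elim: r => [|i r IH]; first by rewrite !big_nil addr0 subrr cabs0 mul1r sqr_ge0.
rewrite !big_cons; set P := \prod_(j <- r) _ in IH *; set S := \sum_(j <- r) _ in IH *.
have -> : (1 + b i) * P - (1 + (b i + S)) = (1 + b i) * (P - (1 + S)) + b i * S by ring.
apply: le_trans (cabsD _ _) _; rewrite !cabsM /=.
have h1 : cabs (1 + b i) <= 2.
  by have := cabsD 1 (b i); have := bm i; rewrite cabs1; lra.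
have h2 : cabs (1 + b i) * cabs (P - (1 + S)) <= 2 * (4 ^+ size r * m ^+ 2).
  by rewrite ler_pM ?cabs_ge0.
have h3 : cabs (b i) * cabs S <= m * ((size r)%:R * m).
  by rewrite ler_pM ?cabs_ge0// Sle.
have h4 : (size r)%:R * m ^+ 2 <= 2 * 4 ^+ size r * m ^+ 2 by rewrite ler_wpM2r ?sqr_ge0.
rewrite (exprS 4); lra.
Qed.

(** The k-th power of a product over ['I_d] is a single product over the pairs ['I_k * 'I_d], to
    which the previous expansion applies. *)
Lemma exp_prod1D_expand (d k : nat) (b : 'I_d -> R[i]) (m : R) :
  0 <= m <= 1 -> (forall j, cabs (b j) <= m) ->
  cabs ((\prod_j (1 + b j)) ^+ k - (1 + k%:R * \sum_j b j)) <= 4 ^+ (k * d) * m ^+ 2.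
Proof.
move=> m01 bm.
have -> : (\prod_j (1 + b j)) ^+ k = \prod_(i : 'I_k * 'I_d) (1 + b i.2).
  rewrite -(pair_bigA _ (fun (_ : 'I_k) j => 1 + b j))/= prodr_const card_ord.
  by [].
have -> : k%:R * \sum_j b j = \sum_(i : 'I_k * 'I_d) b i.2.
  rewrite -(pair_bigA _ (fun (_ : 'I_k) j => b j))/= sumr_const card_ord.
  by rewrite mulr_natl.
apply: le_trans (prod1D_expand _ m01 (fun i => bm i.2)) _.
have -> : size (index_enum ('I_k * 'I_d)%type) = (k * d)%N.
  by rewrite -sum1_size sum1_card card_prod !card_ord.
by [].
Qed.

(** Transfers a step of the coordinates to a step of x = pi(z)^k: the kd linear terms -x/(kd) add up
    to -x. *)
Lemma exp_prod_step (d k : nat) (x : R[i]) (eps : 'I_d -> R[i]) (C : R) :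
  (0 < k * d)%N -> 0 <= C -> (1 + C) * cabs x <= 1 ->
  (forall j, cabs (eps j) <= C * cabs x ^+ 2) ->
  cabs ((\prod_j (1 - x / (k * d)%:R + eps j)) ^+ k - (1 - x)) <=
    ((k * d)%:R * C + 4 ^+ (k * d) * (1 + C) ^+ 2) * cabs x ^+ 2.
Proof.
move=> p0 C0 x1 epsC; set p := (k * d)%N in p0 *.
have x0 := cabs_ge0 x.
have p1 : (1 : R) <= p%:R by rewrite ler1n.
have Cx0 : 0 <= C * cabs x by rewrite mulr_ge0.
have pn0 : (p%:R : R[i]) != 0 by rewrite pnatr_eq0 -lt0n.
pose b j := - (x / p%:R) + eps j.
have bm j : cabs (b j) <= (1 + C) * cabs x.
  apply: le_trans (cabsD _ _) _; rewrite cabsN cabsf cabs_nat mulrDl mul1r lerD//.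
    by rewrite ler_pdivrMr ?ler_peMr//; lra.
  rewrite (le_trans (epsC j))// expr2 mulrA ler_piMr//; lra.
have m01 : 0 <= (1 + C) * cabs x <= 1 by rewrite x1 mulr_ge0// addr_ge0.
have := @exp_prod1D_expand d k b _ m01 bm; rewrite -/p.
under eq_bigr do rewrite /b addrA.
set Y := _ ^+ k; set S := \sum_j b j => h.
have SE : k%:R * S = - x + k%:R * \sum_j eps j.
  rewrite /S /b big_split/= sumr_const card_ord mulrDr; congr (_ + _).
  have /andP[k0 d0] : (0 < k)%N && (0 < d)%N by rewrite -muln_gt0.
  by rewrite -mulr_natr /p natrM; field; rewrite !pnatr_eq0 -!lt0n k0 d0.
have hs : cabs (k%:R * \sum_j eps j) <= p%:R * C * cabs x ^+ 2.
  rewrite cabsM cabs_nat /p natrM -!mulrA ler_wpM2l//.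
  apply: le_trans (cabs_sum _ _ _) _.
  apply: le_trans (ler_sum _ (fun j _ => epsC j)) _.
  by rewrite sumr_const card_ord -[leLHS]mulr_natl.
have -> : Y - (1 - x) = (Y - (1 + k%:R * S)) + k%:R * \sum_j eps j by rewrite SE; ring.
apply: le_trans (cabsD _ _) _; rewrite exprMn in h.
by rewrite mulrDl addrC lerD// -mulrA.
Qed.

End Products.

(** * The scalar model q_{n+1} = q_n (1 - q_n^p / p) *)

Section Model.
Variables (R : realType) (p : nat) (q : nat -> R).
Hypothesis p1 : (1 < p)%N.
Hypothesis q0 : 0 < q 0%N < 1.
Hypothesis qS : forall n, q n.+1 = q n * (1 - q n ^+ p / p%:R).

Lemma model_bounds n : 0 < q n < 1 /\ q n.+1 <= q n.
Proof.
have p0 : (0 : R) < p%:R by rewrite ltr0n ltnW.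
have aux m : 0 < q m < 1 -> 0 < q m.+1 < 1 /\ q m.+1 <= q m.
  move=> /andP[qm0 qm1].
  have a0 : 0 < q m ^+ p by rewrite exprn_gt0.
  have a1 : q m ^+ p < 1 by rewrite exprn_ilt1 ?ltW// -lt0n ltnW.
  have t0 : 0 < q m ^+ p / p%:R by rewrite divr_gt0.
  have t1 : q m ^+ p / p%:R < 1.
    rewrite ltr_pdivrMr// mul1r (lt_le_trans a1)// ler1n; exact: ltnW.
  have h : q m.+1 <= q m by rewrite qS ler_piMr ?ltW//; lra.
  split => //; apply/andP; split; last exact: le_lt_trans h _.
  by rewrite qS mulr_gt0//; lra.
suff H : 0 < q n < 1 by split => //; have [] := aux n H.
by elim: n => // n /aux[].
Qed.

Lemma model_gt0 n : 0 < q n. Proof. by have [/andP[]] := model_bounds n. Qed.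

Lemma model_lt1 n : q n < 1. Proof. by have [/andP[]] := model_bounds n. Qed.

(** The reciprocal of q_n^p grows by at least 1/p at every step. *)
Lemma model_exp_le n : q n ^+ p <= p%:R / n.+1%:R.
Proof.
have p0 : (0 : R) < p%:R by rewrite ltr0n ltnW.
have qp m : 0 < q m ^+ p by rewrite exprn_gt0 ?model_gt0.
have qp1 m : q m ^+ p <= 1 by rewrite exprn_ile1 ?ltW ?model_gt0 ?model_lt1.
rewrite -[leLHS]invrK -[leRHS]invrK lef_pV2 ?posrE ?invr_gt0 ?divr_gt0//.
rewrite invf_div; elim: n => [|n IH].
  apply: (@le_trans _ _ 1); first by rewrite ler_pdivrMr// mul1r ler1n ltnW.
  by rewrite invf_ge1.
set t := q n ^+ p / p%:R.
have t0 : 0 < t by rewrite divr_gt0.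
have t1 : t < 1.
  by rewrite ltr_pdivrMr// mul1r (le_lt_trans (qp1 n))// ltr1n.
(* Only (1 - t)^p <= 1 - t is kept, which costs the factor p in the bound; decay of order 1/n is all
   that is needed. *)
have h1 : q n.+1 ^+ p <= q n ^+ p * (1 - t).
  rewrite qS -/t exprMn ler_pM2l// -[leRHS]expr1.
  by apply: ler_wiXn2l; [lra|lra|exact: ltnW].
have h2 : (q n ^+ p * (1 - t))^-1 <= (q n.+1 ^+ p)^-1.
  by rewrite lef_pV2 ?posrE// mulr_gt0//; lra.
apply: le_trans h2; rewrite invfM -natr1 mulrDl.
have h3 : 1 + t <= (1 - t)^-1.
  by rewrite -[leRHS]mul1r ler_pdivlMr; nra.
have h4 : (q n ^+ p)^-1 * (1 + t) <= (q n ^+ p)^-1 * (1 - t)^-1.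
  by rewrite ler_wpM2l// invr_ge0 ltW.
have h5 : (q n ^+ p)^-1 * t = 1 / p%:R.
  by rewrite /t; field; rewrite !gt_eqF.
by rewrite mulrDr mulr1 h5 in h4; lra.
Qed.

Lemma model_exp_cvg0 : (q n ^+ p)%:C @[n --> \oo] --> (0 : R[i]).
Proof.
apply/ccvgP => e e0; exists (Num.truncn (p%:R / e)) => n Nn.
rewrite subr0 cabs_real_ge0 ?exprn_ge0 ?ltW ?model_gt0//.
apply: le_lt_trans (model_exp_le n) _.
rewrite ltr_pdivrMr// mulrC -ltr_pdivrMr//.
have := truncnS_gt (p%:R / e); move=> /lt_le_trans; apply.
by rewrite ler_nat ltnS.
Qed.

Lemma model_small (e : R) : 0 < e -> exists N, forall n, (N <= n)%N -> q n < e.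
Proof.
move=> e0; have /ccvgP/(_ (e ^+ p)) := model_exp_cvg0.
case=> [|N NP]; first by rewrite exprn_gt0.
exists N => n /NP; rewrite subr0 cabs_real_ge0 ?exprn_ge0 ?ltW ?model_gt0//.
by rewrite ltr_pXn2r ?nnegrE ?ltW ?model_gt0// ltnW.
Qed.

End Model.

(** Multiplying the coordinates removes the multipliers, as their product is 1, so x = (prod z)^k
    and y = q^p satisfy parabolic recursions with the same quadratic error. Their difference is
    summable and drives the quotients of z by the model. *)
Lemma normalized_orbit_cvg (R : realType) (d k : nat) (lambda : 'I_d -> R[i])
    (z eps : nat -> 'I_d -> R[i]) (q : nat -> R) (C : R) (N0 : nat) :
  (1 < k * d)%N -> (forall j, lambda j != 0) -> \prod_j lambda j = 1 ->
  0 < q 0%N < 1 ->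
  (forall n, q n.+1 = q n * (1 - q n ^+ (k * d) / (k * d)%:R)) ->
  (forall n, (N0 <= n)%N -> \prod_j z n j != 0) ->
  (\prod_j z n j) ^+ k @[n --> \oo] --> (0 : R[i]) ->
  (forall n j, (N0 <= n)%N ->
     z n.+1 j = lambda j * z n j * (1 - (\prod_i z n i) ^+ k / (k * d)%:R + eps n j)) ->
  0 <= C ->
  (forall n j, (N0 <= n)%N -> cabs (eps n j) <= C * cabs ((\prod_i z n i) ^+ k) ^+ 2) ->
  (forall j, exists2 a : R[i], a != 0 &
    z n j / (lambda j ^+ n * (q n)%:C) @[n --> \oo] --> a) /\
  (\prod_j z n j) ^+ k / (q n ^+ (k * d))%:C @[n --> \oo] --> (1 : R[i]).
Proof.
move=> p1 l0 l1 q0 qS u0 xcvg zS C0 epsC.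
have p0 : (0 < k * d)%N by exact: ltnW.
have [k0 d0] : (0 < k)%N /\ (0 < d)%N by apply/andP; rewrite -muln_gt0.
set p := (k * d)%N in p0 p1 qS zS.
pose x n := (\prod_i z n i) ^+ k.
pose y n : R[i] := (q n ^+ p)%:C.
have qn0 n : 0 < q n := model_gt0 p1 q0 qS n.
have ycvg : y n @[n --> \oo] --> (0 : R[i]) := model_exp_cvg0 p1 q0 qS.
have x0 n : (N0 <= n)%N -> x n != 0 by move=> /u0 h; rewrite expf_neq0.
have y0 n : (N0 <= n)%N -> y n != 0 by rewrite -cabs_gt0 cabs_real_ge0 ?exprn_ge0 ?exprn_gt0// ltW.
pose D := p%:R * C + 4 ^+ p * (1 + C) ^+ 2.
have D0 : 0 <= D by rewrite addr_ge0// mulr_ge0 ?sqr_ge0 ?exprn_ge0.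
have small (w : nat -> R[i]) : w n @[n --> \oo] --> (0 : R[i]) ->
    exists N, forall n, (N <= n)%N -> (1 + C) * cabs (w n) <= 1.
  move=> /ccvgP/(_ (1 + C)^-1)[|N NP]; first by rewrite invr_gt0; lra.
  exists N => n /NP/ltW; rewrite subr0 -[leRHS]mul1r ler_pdivlMr ?ltr_pwDl//.
  by rewrite mulrC.
have [N1 N1P] := small _ xcvg; have [N2 N2P] := small _ ycvg.
pose N := maxn N0 (maxn N1 N2).
have [NN0 [NN1 NN2]] : (N0 <= N)%N /\ (N1 <= N)%N /\ (N2 <= N)%N by rewrite !leq_max !leqnn !orbT.
pose e n := x n.+1 / x n - (1 - x n).
pose f n := y n.+1 / y n - (1 - y n).
have xS n : (N <= n)%N -> x n.+1 = x n * (1 - x n + e n).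
  by move=> Nn; rewrite /e [1 - _ + _]addrC subrK mulrC divfK// x0// (leq_trans NN0).
have yS n : (N <= n)%N -> y n.+1 = y n * (1 - y n + f n).
  by move=> Nn; rewrite /f [1 - _ + _]addrC subrK mulrC divfK// y0// (leq_trans NN0).
have eD n : (N <= n)%N -> cabs (e n) <= D * cabs (x n) ^+ 2.
  move=> Nn; have Nn0 := leq_trans NN0 Nn.
  have := exp_prod_step p0 C0 (N1P n (leq_trans NN1 Nn)) (fun j => epsC n j Nn0).
  rewrite /e; congr (cabs (_ - _) <= _).
  rewrite {1}/x; under [in RHS]eq_bigr do rewrite zS//.
  rewrite !big_split/= l1 mul1r exprMn [RHS]mulrC -/(x n) mulKf//.
  exact: x0.
have fD n : (N <= n)%N -> cabs (f n) <= D * cabs (y n) ^+ 2.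
  move=> Nn.
  (* The model is the case of d equal factors 1 - y/p without error. *)
  have := exp_prod_step (eps := fun _ : 'I_d => 0) p0 C0 (N2P n (leq_trans NN2 Nn)).
  move=> /(_ ltac:(by move=> _; rewrite cabs0 mulr_ge0 ?sqr_ge0)).
  rewrite /f; congr (cabs (_ - _) <= _).
  rewrite prodr_const card_ord -exprM [(d * k)%N]mulnC -/p addr0 /y qS.
  rewrite exprMn rcM [RHS]mulrC mulKf; last exact: (y0 _ (leq_trans NN0 Nn)).
  by rewrite [RHS]rcX rcB rcM rcV rc_nat rc1.
have [[K [M [K0 M0 MP]]] xy1] := parabolic_compare (fun n h => x0 n (leq_trans NN0 h)) xcvg
  (fun n h => y0 n (leq_trans NN0 h)) ycvg xS yS D0 eD fD.
split=> [j|]; last exact: xy1.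
(* The quotient (1 - x/p + eps) / (1 - y/p), minus 1. *)
pose b n := ((y n - x n) / p%:R + eps n j) / (1 - y n / p%:R).
(* The 2 bounds 1/|1 - y/p|, the factor 1 + C covers both |x - y| and C |x|^2, and [K] comes from
   the parabolic comparison. *)
pose g n := 2 * (1 + C) * K * (Num.sqrt n%:R)^-1 : R.
have c0 : 0 <= 2 * (1 + C) * K by rewrite mulr_ge0// mulr_ge0// addr_ge0.
have yp n : cabs (y n / p%:R) <= 2^-1.
  have h0 : 0 <= q n ^+ p by rewrite exprn_ge0// ltW.
  have h1 : q n ^+ p <= 1 by rewrite exprn_ile1 ?ltW// (model_lt1 p1 q0 qS).
  have h2 : (2 : R) <= p%:R by rewrite ler_nat.
  by rewrite cabsf cabs_nat cabs_real_ge0// ler_pdivrMr; lra.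
have yp2 n : 2^-1 <= cabs (1 - y n / p%:R).
  have := cabs_subl 1 (y n / p%:R); have := yp n; rewrite cabs1; lra.
have yp0 n : 1 - y n / p%:R != 0 by rewrite -cabs_gt0; have := yp2 n; lra.
have pn0 : (p%:R : R[i]) != 0 by rewrite pnatr_eq0 -lt0n.
have qC n : ((q n)%:C : R[i]) != 0 by rewrite -cabs_gt0 cabs_real_ge0// ltW.
have ln0 n : lambda j ^+ n != 0 by rewrite expf_neq0.
have zn0 n : (N0 <= n)%N -> z n j != 0.
  by move=> /u0; apply: contraNneq => zj; rewrite (bigD1 j)//= zj mul0r.
apply: (@cvg_mul_perturb _ _ b g (maxn N M)).
- move=> n; rewrite geq_max => /andP[Nn _].
  by rewrite !mulf_neq0 ?invr_neq0 ?mulf_neq0 ?zn0// (leq_trans NN0).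
- move=> n; rewrite geq_max => /andP[Nn _].
  rewrite zS ?(leq_trans NN0)// -/(x n) qS rcM rcB rcM rcV rc_nat rc1 -/(y n) exprS.
  rewrite /b; field; apply/and5P; split => //; [|exact: qC].
  have -> : p%:R - (q n ^+ p)%:C = p%:R * (1 - y n / p%:R) by rewrite /y; field.
  by rewrite mulf_neq0.
- move=> n; rewrite geq_max => /andP[Nn Mn].
  have := MP n Mn; set G := (_ - _ : R) => h.
  have -> : g n - g n.+1 = 2 * (1 + C) * K * G by rewrite /g /G; ring.
  have ej := epsC n j (leq_trans NN0 Nn); rewrite -/(x n) in ej.
  rewrite cabsf ler_pdivrMr ?cabs_gt0//.
  have h1 : cabs ((y n - x n) / p%:R) <= cabs (x n - y n).
    rewrite cabsf cabs_nat cabsBC ler_pdivrMr ?ltr0n// ler_peMr ?cabs_ge0//.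
    by rewrite ler1n.
  have h2 := cabsD ((y n - x n) / p%:R) (eps n j).
  have h3 : (1 + C) * (cabs (x n - y n) + cabs (x n) ^+ 2) <= (1 + C) * (K * G).
    by rewrite ler_wpM2l//; lra.
  have h4 : 0 <= C * cabs (x n - y n) by rewrite mulr_ge0 ?cabs_ge0.
  have h5 : 0 <= cabs (x n) ^+ 2 := sqr_ge0 _.
  have h6 : 0 <= 2 * (1 + C) * K * G.
    have : 0 <= K * G by apply: le_trans h; rewrite addr_ge0 ?cabs_ge0.
    by rewrite -[_ * K * G]mulrA => KG; rewrite mulr_ge0// mulr_ge0// addr_ge0.
  have h7 : 2 * (1 + C) * K * G * 2^-1 <= 2 * (1 + C) * K * G * cabs (1 - y n / p%:R).
    by rewrite ler_wpM2l.
  lra.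
- by move=> n; rewrite /g mulr_ge0// invr_ge0 sqrtr_ge0.
- apply/cvgrPdist_lt => e' e'0.
  pose c := 2 * (1 + C) * K.
  exists (Num.truncn ((c / e') ^+ 2)).+1 => // n /= Nn.
  rewrite sub0r normrN /g -/c ger0_norm; last by rewrite mulr_ge0// invr_ge0 sqrtr_ge0.
  have hn : (c / e') ^+ 2 < n%:R by apply: lt_le_trans (truncnS_gt _) _; rewrite ler_nat.
  have n0 : (0 : R) < n%:R by apply: le_lt_trans hn; exact: sqr_ge0.
  rewrite ltr_pdivrMr ?sqrtr_gt0// -ltr_pdivrMl// mulrC.
  rewrite -(@ltr_pXn2r _ 2)// ?nnegrE ?sqrtr_ge0 ?divr_ge0 ?(ltW e'0)//.
  by rewrite sqr_sqrtr// ltW.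
Qed.

(** * Simultaneous approximation on the torus by a moment method *)

Section Kronecker.
Variable R : realType.

(** Take p = s m with m = D+1 and A = 1 + s (r - 1). Bernoulli gives r^p >= A^(D+1), while p + 1 <=
    K A with K independent of s; it remains to choose s with K^D < s (r - 1) < A. *)
Lemma expr_gt_polynomial (r : R) (D : nat) : 1 < r ->
  exists p : nat, p.+1%:R ^+ D < r ^+ p.
Proof.
move=> r1; pose e := r - 1; have e0 : 0 < e by rewrite /e; lra.
pose m := D.+1; pose K := 1 + m%:R / e.
have K1 : 1 <= K by rewrite /K lerDl divr_ge0// ltW.
pose s := (Num.truncn (K ^+ D / e)).+1.
have sK : K ^+ D < s%:R * e by rewrite -ltr_pdivrMr// truncnS_gt.
exists (s * m)%N; pose A := 1 + s%:R * e.
have se0 : 0 <= s%:R * e by rewrite mulr_ge0// ltW.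
have A0 : 0 < A by rewrite /A; lra.
have rA : A <= r ^+ s.
  have -> : A = 1 + e *+ s by rewrite /A mulr_natl.
  have -> : r = 1 + e by rewrite /e addrC subrK.
  elim: s {sK A A0 se0} => [|n IH]; first by rewrite mulr0n addr0.
  have en : 0 <= e *+ n by rewrite mulrn_wge0// ltW.
  have : (1 + e *+ n) * (1 + e) <= (1 + e) ^+ n * (1 + e) by rewrite ler_wpM2r//; lra.
  by rewrite mulrSr exprSr; nra.
have pK : (s * m).+1%:R <= K * A.
  rewrite -natr1 natrM /K /A mulrDl mul1r.
  have : m%:R / e * (1 + s%:R * e) = m%:R / e + s%:R * m%:R by field; rewrite gt_eqF.
  have : 0 <= m%:R / e by rewrite divr_ge0// ltW.
  have : 0 <= s%:R * e by rewrite mulr_ge0// ltW.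
  lra.
apply: (@le_lt_trans _ _ (K ^+ D * A ^+ D)).
  by rewrite -exprMn; apply: lerXn2r; rewrite ?nnegrE//; apply: mulr_ge0; lra.
apply: (@lt_le_trans _ _ (A ^+ m)).
  by rewrite exprS ltr_pM2r ?exprn_gt0// (lt_le_trans sK)// /A; lra.
rewrite exprM; apply: lerXn2r rA; rewrite nnegrE ?ltW//.
by rewrite exprn_gt0//; lra.
Qed.

(** The bound depends neither on [L] nor on [N]: a nontrivial character has average 0 over long
    blocks. *)
Lemma geometric_sum_bounded (x : R[i]) (L N : nat) : cabs x = 1 -> x != 1 ->
  cabs (\sum_(n < L) x ^+ (N + n)%N) <= 2 / cabs (x - 1).
Proof.
move=> x1 xn1; have x10 : x - 1 != 0 by rewrite subr_eq0.
rewrite ler_pdivlMr ?cabs_gt0// -cabsM.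
have -> : (\sum_(n < L) x ^+ (N + n)) * (x - 1) = x ^+ N * (x ^+ L - 1).
  by under eq_bigr do rewrite exprD; rewrite -mulr_sumr subrX1 -mulrA [_ * (x - 1)]mulrC.
rewrite cabsM cabsX x1 expr1n mul1r (le_trans (cabsB _ _))//.
by rewrite cabsX x1 expr1n cabs1.
Qed.

Variables (d : nat) (mu t : 'I_d -> R[i]).
Hypothesis mu1 : forall j, cabs (mu j) = 1.
Hypothesis t1 : forall j, cabs (t j) = 1.
Hypothesis mu_indep : forall a b : 'I_d -> nat, (\sum_j a j = \sum_j b j)%N ->
  \prod_j mu j ^+ a j = \prod_j mu j ^+ b j -> a =1 b.

Lemma prod_word (p : nat) (f : {ffun 'I_p -> 'I_d}) (y : 'I_d -> R[i]) :
  \prod_i y (f i) = \prod_j y j ^+ #|[pred i | f i == j]|.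
Proof.
rewrite (partition_big f xpredT)//=; apply: eq_bigr => j _.
by rewrite (eq_bigr (fun=> y j)) ?prodr_const// => i /eqP ->.
Qed.

(* Moment method: on average over n, the 2p-th power of the modulus of the sum is
   the number of pairs of words of length p with the same letters. *)
Lemma kronecker_moment (s : R) (N p : nat) :
  (forall n, (N <= n)%N -> cabs (\sum_j mu j ^+ n / t j) <= s) ->
  d%:R ^+ p <= (p.+1%:R ^+ d) * s ^+ p.
Proof.
move=> Ss; have s0 : 0 <= s := le_trans (cabs_ge0 _) (Ss N (leqnn N)).
have m0 j : mu j != 0 by rewrite -cabs_gt0 mu1.
have t0 j : t j != 0 by rewrite -cabs_gt0 t1.
pose S n := \sum_j mu j ^+ n / t j.
(* The terms are unimodular, so inverting each of them conjugates the sum; written with inverses,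
   the product with [S] expands into the characters [chi]. *)
pose T n := \sum_j (mu j ^+ n / t j)^-1.
have ST n : S n ^+ p * T n ^+ p = (cabs (S n) ^+ (2 * p))%:C.
  have -> : T n = (S n)^*.
    rewrite /T /S rmorph_sum; apply: eq_bigr => j _; set x := _ / _.
    have x1 : cabs x = 1 by rewrite /x cabsf cabsX mu1 t1 expr1n divr1.
    have x0 : x != 0 by rewrite -cabs_gt0 x1.
    by apply: (mulfI x0); rewrite divff// -sqr_normc normc_cabs x1 expr1n.
  by rewrite -exprMn -sqr_normc normc_cabs -exprM rcX.
pose W := {ffun 'I_p -> 'I_d}.
pose M (f : W) := \prod_i mu (f i); pose U (f : W) := \prod_i t (f i).
have M0 f : M f != 0 by apply/prodf_neq0 => i _.
have U0 f : U f != 0 by apply/prodf_neq0 => i _.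
pose chi (h : W * W) := M h.1 / M h.2; pose c (h : W * W) := U h.2 / U h.1.
have expand n : S n ^+ p * T n ^+ p = \sum_h c h * chi h ^+ n.
  have E (y : 'I_d -> R[i]) : (\sum_j y j) ^+ p = \sum_(f : W) \prod_i y (f i).
    rewrite -[p in _ ^+ p]card_ord -prodr_const.
    exact: (bigA_distr_bigA (fun (_ : 'I_p) j => y j)).
  rewrite /S /T !E big_distrlr/= pair_big/=; apply: eq_bigr => -[f g] _ /=.
  rewrite -!(big_morph _ (@invfM R[i]) (@invr1 _)) !big_split/= !prodrXl.
  rewrite -!(big_morph _ (@invfM R[i]) (@invr1 _)) -/(M f) -/(M g) -/(U f) -/(U g).
  by rewrite /c /chi/= invfM invrK expr_div_n; field; rewrite U0 expf_neq0.
have cnt_eq f g : chi (f, g) = 1 ->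
    (fun j => #|[pred i | f i == j]|) =1 (fun j => #|[pred i | g i == j]|).
  rewrite /chi/= => /(canRL (divfK (M0 g))); rewrite mul1r /M !prod_word => h.
  apply: mu_indep h.
  have cs (k : W) : (\sum_j #|[pred i | k i == j]| = p)%N.
    rewrite -[RHS]card_ord -sum1_card (partition_big k xpredT)//=.
    by apply: eq_bigr => j _; rewrite sum1_card.
  by rewrite !cs.
have c1 h : chi h == 1 -> c h = 1.
  case: h => f g /eqP/cnt_eq e; rewrite /c /U/= !prod_word.
  by under eq_bigr do rewrite -e; apply: divff; apply/prodf_neq0 => j _; rewrite expf_neq0.
have ch1 h : cabs (c h) = 1.
  rewrite /c cabsf /U !cabs_prod; under eq_bigr do rewrite t1.
  by under [X in _ / X]eq_bigr do rewrite t1; rewrite !big1// divr1.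
have chi1 h : cabs (chi h) = 1.
  rewrite /chi cabsf /M !cabs_prod; under eq_bigr do rewrite mu1.
  by under [X in _ / X]eq_bigr do rewrite mu1; rewrite !big1// divr1.
pose E := [pred h | chi h == 1].
(* Total contribution of the nontrivial characters, uniform in the block length [L]. *)
pose B0 : R := \sum_(h | chi h != 1) 2 / cabs (chi h - 1).
have main L : L%:R * #|E|%:R <= L%:R * s ^+ (2 * p) + B0.
  have tot : \sum_(n < L) S (N + n)%N ^+ p * T (N + n)%N ^+ p =
      L%:R * #|E|%:R + \sum_(h | chi h != 1) c h * \sum_(n < L) chi h ^+ (N + n)%N.
    under eq_bigr do rewrite expand.
    rewrite exchange_big (bigID (fun h => chi h == 1)); congr (_ + _).
      rewrite (eq_bigr (fun=> L%:R)) => [|h /= h1].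
        by rewrite sumr_const -[LHS]mulr_natr.
      rewrite c1// (eqP h1); under eq_bigr do rewrite mul1r expr1n.
      by rewrite sumr_const card_ord.
    by apply: eq_bigr => h _; rewrite mulr_sumr.
  have h1 : cabs (\sum_(n < L) S (N + n)%N ^+ p * T (N + n)%N ^+ p) <= L%:R * s ^+ (2 * p).
    apply: le_trans (cabs_sum _ _ _) _.
    rewrite -[L in L%:R]card_ord mulr_natl -sumr_const; apply: ler_sum => n _.
    rewrite ST cabs_real_ge0 ?exprn_ge0 ?cabs_ge0// lerXn2r ?nnegrE ?cabs_ge0//.
    by apply: Ss; rewrite leq_addr.
  have h2 : cabs (\sum_(h | chi h != 1) c h * \sum_(n < L) chi h ^+ (N + n)%N) <= B0.
    apply: le_trans (cabs_sum _ _ _) _; apply: ler_sum => h h1'.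
    by rewrite cabsM ch1 mul1r geometric_sum_bounded.
  have h3 : cabs (L%:R * #|E|%:R : R[i]) = L%:R * #|E|%:R by rewrite cabsM !cabs_nat.
  rewrite -h3; have := cabs_addl (L%:R * #|E|%:R)
    (\sum_(h | chi h != 1) c h * \sum_(n < L) chi h ^+ (N + n)%N).
  by rewrite -tot; lra.
(* Divide by L and let L grow; concretely, one L exceeding B0/D contradicts [main]. *)
have Es : #|E|%:R <= s ^+ (2 * p).
  rewrite leNgt; apply/negP; rewrite -subr_gt0; set D := _ - _ => D0.
  have := main (Num.truncn (B0 / D)).+1; set L := _.+1.
  have : B0 < L%:R * D by rewrite -ltr_pdivrMr// truncnS_gt.
  by rewrite /D mulrBr; lra.
pose cnt (f : W) : {ffun 'I_d -> 'I_p.+1} := [ffun j => inord #|[pred i | f i == j]|].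
have cntE (f g : W) : cnt f = cnt g -> chi (f, g) = 1.
  move=> /ffunP e; rewrite /chi/= /M !prod_word.
  suff -> : \prod_j mu j ^+ #|[pred i | f i == j]| = \prod_j mu j ^+ #|[pred i | g i == j]|.
    by apply: divff; apply/prodf_neq0 => j _; rewrite expf_neq0.
  apply: eq_bigr => j _; congr (_ ^+ _).
  have := e j; rewrite !ffunE => /(congr1 val) /=.
  by rewrite !inordK// ltnS -[leqRHS]card_ord max_card.
(* Two words with the same letter counts form a pair in [E], so the square of a fibre of [cnt]
   embeds in [E]. There are at most (p+1)^d fibres to cover all d^p words. *)
have fib (v : {ffun 'I_d -> 'I_p.+1}) : #|[pred f | cnt f == v]|%:R <= s ^+ p.
  rewrite -(@ler_pXn2r _ 2)// ?nnegrE ?exprn_ge0// -exprM mulnC.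
  apply: le_trans Es; rewrite -natrX ler_nat -mulnn -cardX subset_leq_card//.
  apply/fintype.subsetP => -[f g]; rewrite !inE/= => /andP[/eqP fv /eqP gv].
  by apply/eqP/cntE; rewrite fv gv.
have -> : d%:R ^+ p = #|{: W}|%:R :> R by rewrite card_ffun !card_ord natrX.
rewrite -sum1_card (partition_big cnt xpredT)//= natr_sum.
have -> : p.+1%:R ^+ d = #|{: {ffun 'I_d -> 'I_p.+1}}|%:R :> R by rewrite card_ffun !card_ord natrX.
rewrite mulr_natl -sumr_const; apply: ler_sum => v _.
by rewrite sum1_card fib.
Qed.

(** Otherwise the moment bound d^p <= (p+1)^d s^p would hold for every p, against exponential growth
    of (d/s)^p. *)
Lemma kronecker_sum (s : R) (N : nat) : s < d%:R ->
  exists2 n, (N <= n)%N & s < cabs (\sum_j mu j ^+ n / t j).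
Proof.
move=> sd; apply: contrapT => no.
have Ss n : (N <= n)%N -> cabs (\sum_j mu j ^+ n / t j) <= s.
  by move=> Nn; rewrite leNgt; apply/negP => sn; apply: no; exists n.
have s0 : 0 <= s := le_trans (cabs_ge0 _) (Ss N (leqnn N)).
have d0 : (0 : R) < d%:R := le_lt_trans s0 sd.
(* [s] itself may be 0; the midpoint is a positive divisor still below d. *)
pose s' := (s + d%:R) / 2.
have s'0 : 0 < s' by rewrite /s'; lra.
have [p] := @expr_gt_polynomial (d%:R / s') d ltac:(by rewrite ltr_pdivlMr// /s'; lra).
rewrite expr_div_n ltr_pdivlMr ?exprn_gt0// ltNge => /negP; apply.
apply: (@kronecker_moment s' N p) => n /Ss/le_trans; apply.
by rewrite /s'; lra.
Qed.

(** A sum of d unimodular terms of modulus almost d has almost equal terms. It determines them only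
    up to a common rotation, which the constant term 1 at [j0] fixes. *)
Lemma kronecker (j0 : 'I_d) (e : R) (N : nat) : mu j0 = 1 -> t j0 = 1 -> 0 < e ->
  exists2 n, (N <= n)%N & forall j, cabs (mu j ^+ n - t j) < e.
Proof.
(* From |1 + x| > 2 - r follows |x - 1|^2 = 4 - |1 + x|^2 < 4 r < e^2. *)
move=> mj0 tj0 e0; pose r := Num.min 1 (e ^+ 2 / 5).
have r0 : 0 < r by rewrite lt_min ltr01 divr_gt0// exprn_gt0.
have [re r1] : r <= e ^+ 2 / 5 /\ r <= 1 by rewrite !ge_min !lexx orbT.
have [|n Nn Sn] := @kronecker_sum (d%:R - r) N; first by rewrite ltrBlDr ltrDl.
exists n => // j; set x := mu j ^+ n / t j.
have t0 : t j != 0 by rewrite -cabs_gt0 t1.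
have x1 : cabs x = 1 by rewrite /x cabsf cabsX mu1 t1 expr1n divr1.
have -> : mu j ^+ n - t j = t j * (x - 1) by rewrite /x; field.
rewrite cabsM t1 mul1r -(@ltr_pXn2r _ 2)// ?nnegrE ?cabs_ge0 ?(ltW e0)//.
have par : cabs (x - 1) ^+ 2 = 4 - cabs (1 + x) ^+ 2.
  have := sqr_cabs x; rewrite x1 !sqr_cabs; case: (x) => a b /=.
  by rewrite expr1n => h; rewrite /= add0r subr0; lra.
have [jj|jj] := eqVneq j j0.
  by rewrite /x jj mj0 tj0 expr1n divr1 subrr cabs0 expr0n exprn_gt0.
suff x2 : 2 - r < cabs (1 + x) by rewrite par; have := cabs_ge0 (1 + x); nra.
have d2 : d%:R = 2 + (\sum_(i | (i != j0) && (i != j)) 1) :> R.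
  by rewrite -[d in LHS]card_ord -sumr_const (bigD1 j0)//= (bigD1 j)//=; ring.
have : cabs (\sum_j mu j ^+ n / t j) <= cabs (1 + x) + \sum_(i | (i != j0) && (i != j)) 1.
  rewrite (bigD1 j0)//= (bigD1 j)//= mj0 tj0 expr1n divr1 addrA -/x.
  apply: le_trans (cabsD _ _) _; rewrite lerD2l.
  apply: le_trans (cabs_sum _ _ _) _; apply: ler_sum => i _.
  by rewrite cabsf cabsX mu1 t1 expr1n divr1.
by rewrite d2 in Sn; lra.
Qed.

End Kronecker.

(** * Density of the powers of a one-resonant multiplier *)

Section Resonance.
Variable R : realType.

Lemma cabs_prodB (I : Type) (r : seq I) (P : pred I) (x y : I -> R[i]) :
  (forall i, cabs (x i) <= 1) -> (forall i, cabs (y i) <= 1) ->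
  cabs (\prod_(i <- r | P i) x i - \prod_(i <- r | P i) y i) <=
  \sum_(i <- r | P i) cabs (x i - y i).
Proof.
move=> x1 y1; elim: r => [|i r IH]; first by rewrite !big_nil subrr cabs0.
rewrite !big_cons; case: (P i) => //.
set X := \prod_(j <- r | _) _; set Y := \prod_(j <- r | _) _.
have -> : x i * X - y i * Y = x i * (X - Y) + (x i - y i) * Y by ring.
have Y1 : cabs Y <= 1.
  by rewrite cabs_prod; apply: prodr_ile1 => j _; rewrite cabs_ge0 y1.
apply: le_trans (cabsD _ _) _; rewrite !cabsM addrC lerD//.
  by rewrite ler_piMr ?cabs_ge0.
by rewrite (le_trans _ IH)// ler_piMl ?cabs_ge0.
Qed.

Variables (d : nat) (lambda : 'rV[R[i]]_d).
Hypothesis lambda1 : forall j, cabs (lambda 0 j) = 1.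
Hypothesis reso : one_resonant lambda.

Lemma lambda_neq0 j : lambda 0 j != 0.
Proof. by rewrite -cabs_gt0 lambda1. Qed.

(** The resonance with q = 1, divided by the multiplier at [j0]. *)
Lemma one_resonant_prod : (0 < d)%N -> \prod_j lambda 0 j = 1.
Proof.
move=> d0; have j0 : 'I_d := Ordinal d0.
have [_ /(_ (ex_intro _ 1%N (fun i => erefl)))] := reso (fun i => (1 + (i == j0))%N) j0.
have lj : \prod_i lambda 0 i ^+ (i == j0) = lambda 0 j0.
  rewrite (bigD1 j0)// eqxx expr1 big1 => [|i /negPf ->]; last by rewrite expr0.
  exact: mulr1.
under eq_bigr do rewrite exprD expr1.
rewrite big_split lj => /(canRL (mulfK (lambda_neq0 j0))).
by rewrite divff ?lambda_neq0.
Qed.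

(** Resonances have natural exponents and a single multiplier on the right. Multiplying the relation
    by the powers m - b j and by one extra factor at [j0] brings it to that form, and then a - b is
    constant. *)
Lemma one_resonant_indep (a b : 'I_d -> nat) : (0 < d)%N ->
  \prod_j lambda 0 j ^+ a j = \prod_j lambda 0 j ^+ b j ->
  exists m q : nat, forall j, (a j + m = b j + q)%N.
Proof.
move=> d0 ab; have j0 : 'I_d := Ordinal d0; pose m := (\sum_j b j)%N.
have bm j : (b j <= m)%N by rewrite /m (bigD1 j)//= leq_addr.
have h : \prod_i lambda 0 i ^+ (a i + (m - b i) + (i == j0)) = lambda 0 j0.
  under eq_bigr do rewrite !exprD.
  rewrite !big_split/= ab -big_split/=.
  under eq_bigr do rewrite -exprD subnKC//.
  rewrite prodrXl one_resonant_prod// expr1n mul1r.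
  rewrite (bigD1 j0)// eqxx expr1 big1 => [|i /negPf ->]; last by rewrite expr0.
  exact: mulr1.
have [q qP] := (reso (fun i => (a i + (m - b i) + (i == j0))%N) j0).1 h.
exists m, q => j; have := qP j; have := bm j; lia.
Qed.

(** Coordinate [j0] is replaced by 1 to meet the normalization of [kronecker]; this discards no
    information, since the product condition recovers it from the others. *)
Lemma one_resonant_dense (t : 'I_d -> R[i]) (e : R) (N : nat) : (0 < d)%N ->
  (forall j, cabs (t j) = 1) -> \prod_j t j = 1 -> 0 < e ->
  exists2 n, (N <= n)%N & forall j, cabs (lambda 0 j ^+ n - t j) < e.
Proof.
move=> d0 t1 tp e0; have j0 : 'I_d := Ordinal d0.
pose mu j := if j == j0 then 1 else lambda 0 j.
pose t' j := if j == j0 then 1 else t j.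
have mu1 j : cabs (mu j) = 1 by rewrite /mu; case: ifP; rewrite ?cabs1.
have t'1 j : cabs (t' j) = 1 by rewrite /t'; case: ifP; rewrite ?cabs1.
have indep (a b : 'I_d -> nat) : (\sum_j a j = \sum_j b j)%N ->
    \prod_j mu j ^+ a j = \prod_j mu j ^+ b j -> a =1 b.
  move=> sab pab.
  have muE (c : 'I_d -> nat) : \prod_j mu j ^+ c j =
      \prod_j lambda 0 j ^+ (if j == j0 then 0%N else c j).
    by apply: eq_bigr => j _; rewrite /mu; case: ifP => //; rewrite expr1n expr0.
  rewrite !muE in pab; have [m [q mq]] := one_resonant_indep d0 pab.
  (* The exponent at [j0] has been set to 0 on both sides, so the constant difference vanishes;
     equality of the totals then gives the exponent at [j0]. *)
  have mqE : m = q by have := mq j0; rewrite eqxx.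
  have ab j : j != j0 -> a j = b j.
    by move=> /negPf jj; have := mq j; rewrite jj mqE => /addIn.
  move=> j; have [->|] := eqVneq j j0; last exact: ab.
  move: sab; rewrite (bigD1 j0)//= [RHS](bigD1 j0)//= (eq_bigr b) => [/addIn//|i].
  exact: ab.
(* The error at [j0] is bounded by the sum of the others, at most d e' < e. *)
pose e' := e / (d%:R + 1).
have dp : (0 : R) < d%:R + 1 by rewrite ltr_wpDl.
have e'0 : 0 < e' by rewrite divr_gt0.
have e'e : e' <= e by rewrite ler_pdivrMr// ler_peMr ?(ltW e0)// lerDr.
have [n Nn nP] := kronecker mu1 t'1 indep (j0 := j0) N
  ltac:(by rewrite /mu eqxx) ltac:(by rewrite /t' eqxx) e'0.
exists n => // j; have [->|jj] := eqVneq j j0; last first.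
  by apply: lt_le_trans e'e; have := nP j; rewrite /mu /t' (negPf jj).
(* [X] and [Y] are the inverses of the two numbers compared at [j0]; for unimodular numbers
   inversion preserves distances. *)
pose X := \prod_(i | i != j0) lambda 0 i ^+ n; pose Y := \prod_(i | i != j0) t i.
have lX : lambda 0 j0 ^+ n * X = 1.
  by rewrite /X prodrXl -exprMn -(bigD1 j0 (P := xpredT))//= one_resonant_prod// expr1n.
have tY : t j0 * Y = 1 by rewrite /Y -(bigD1 j0 (P := xpredT)).
have X1 : cabs X = 1 by rewrite /X cabs_prod big1// => i _; rewrite cabsX lambda1 expr1n.
have Y1 : cabs Y = 1 by rewrite /Y cabs_prod big1.
have dE : (lambda 0 j0 ^+ n - t j0) * (X * Y) = Y - X.
  by rewrite mulrBl mulrA lX mul1r [X * Y]mulrC mulrA tY mul1r.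
have -> : cabs (lambda 0 j0 ^+ n - t j0) = cabs (X - Y).
  by rewrite [RHS]cabsBC -dE !cabsM X1 Y1 !mulr1.
apply: (@le_lt_trans _ _ (\sum_(i | i != j0) cabs (lambda 0 i ^+ n - t i))).
  by apply: cabs_prodB => i; rewrite ?t1// cabsX lambda1 expr1n.
apply: (@le_lt_trans _ _ (\sum_(i < d) e')).
  rewrite [leRHS](bigD1 j0)//= ler_wpDl ?(ltW e'0)//; apply: ler_sum => i ij.
  by apply: ltW; have := nP i; rewrite /mu /t' (negPf ij).
rewrite sumr_const card_ord -mulr_natl /e' mulrA ltr_pdivrMr// mulrC.
by rewrite ltr_pM2l// ltrDl.
Qed.

End Resonance.

(** * Arguments modulo 2 pi *)

Section Arguments.
Variable R : realType.
Implicit Types (x y : R[i]) (s t : R).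

Lemma cis_2pi_int (m : int) : cis (2 * pi * m%:~R : R) = 1.
Proof.
have c2 : cis (pi *+ 2 : R) = 1 by rewrite /cis cos2pi sin2pi.
have cn (n : nat) : cis (2 * pi * n%:R : R) = 1.
  by rewrite mulr_natl mulr_natr cisMn c2 expr1n.
case: m => n; first exact: cn.
by rewrite NegzE mulrNz mulrN cisN -pmulrn cn invr1.
Qed.

(** A floor reduces the difference to y in [0, 2 pi) with cos y = 1; injectivity of cos on [0, pi]
    settles y, or else its reflection 2 pi - y. *)
Lemma cis_eqmod2pi s t : cis s = cis t <-> eqmod2pi s t.
Proof.
split=> [st|[m ->]]; last by rewrite cisD cis_2pi_int mulr1.
have p0 : 0 < 2 * pi :> R by rewrite mulr_gt0 ?pi_gt0.
pose m := Num.floor ((s - t) / (2 * pi)); pose y := s - t - 2 * pi * m%:~R.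
have cy : cis y = 1.
  by rewrite /y cisD cisN cis_2pi_int invr1 mulr1 cisD cisN st divff ?cis_neq0.
have y0 : 0 <= y.
  have := floor_le ((s - t) / (2 * pi)).
  by rewrite -/m ler_pdivlMr// /y mulrC; lra.
have y2 : y < 2 * pi.
  have := floorD1_gt ((s - t) / (2 * pi)).
  by rewrite -/m intrD ltr_pdivrMr// /y; lra.
exists m; suff : y = 0 by rewrite /y; lra.
have cy1 : cos y = 1 by have := congr1 (@complex.Re R) cy.
have [yp|yp] := leP y pi.
  by apply: cos_inj; rewrite ?in_itv/= ?y0 ?yp ?lexx ?pi_ge0// cos0.
exfalso; have : 2 * pi - y = 0.
  apply: cos_inj; rewrite ?in_itv/= ?lexx ?pi_ge0//; first by apply/andP; split; lra.
  rewrite cos0 cosB mulr_natl cos2pi sin2pi cy1; lra.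
lra.
Qed.

Lemma cis_exists x : cabs x = 1 -> exists t, [/\ - pi <= t <= pi, x = cis t & cos t = complex.Re x].
Proof.
case: x => a b x1; have ab : a ^+ 2 + b ^+ 2 = 1 by rewrite -(sqr_cabs (a +i* b)) x1 expr1n.
have a1 : -1 <= a <= 1 by apply/andP; split; nra.
have ca : cos (acos a) = a by rewrite acosK// in_itv/=.
have sa : sin (acos a) = `|b| by rewrite sin_acos// -sqrtr_sqr; congr Num.sqrt; lra.
have := acos_ge0 a1; have := acos_lepi a1; have := @pi_ge0 R => p0 ap a0.
have [b0|b0] := leP 0 b.
  exists (acos a); split => //; first by apply/andP; split; lra.
  by rewrite /cis ca sa ger0_norm.
exists (- acos a); rewrite /cis cosN sinN ca sa; split => //.
  by apply/andP; split; lra.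
by rewrite ltr0_norm// opprK.
Qed.

Lemma arg_exists x : x != 0 -> exists t, is_arg x t.
Proof.
move=> x0; have [|t [_ xt _]] := @cis_exists (x / (cabs x)%:C).
  by rewrite cabsf cabs_real_ge0 ?cabs_ge0// divff// cabs_eq0.
exists t; split => //; rewrite -/(cis t) -xt mulrC divfK//.
by rewrite -cabs_gt0 cabs_real_ge0 ?cabs_ge0// cabs_gt0.
Qed.

Lemma rc_prod (I : Type) (r : seq I) (P : pred I) (f : I -> R) :
  (\prod_(i <- r | P i) f i)%:C = \prod_(i <- r | P i) (f i)%:C :> R[i].
Proof. exact: rmorph_prod. Qed.

(** Trades the multivalued arguments for one algebraic equation, which passes to limits and
    multiplies along products. *)
Lemma arg_sumP (d k h : nat) (w : 'rV[R[i]]_d) :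
  arg_sum k h w <-> (forall j, w 0 j != 0) /\
    \prod_j w 0 j = (\prod_j cabs (w 0 j))%:C * cis (2 * pi * h%:R / k%:R).
Proof.
split=> [[t [wt st]]|[w0 pw]].
  split=> [j|]; first by have [] := wt j.
  under eq_bigr do rewrite (proj2 (wt _)).
  rewrite big_split/= -rc_prod; congr (_ * _).
  by move/cis_eqmod2pi : st => <-; rewrite cis_sum.
have /choice[t tP] : forall j, exists t, is_arg (w 0 j) t by move=> j; exact: arg_exists.
exists t; split => //; apply/cis_eqmod2pi; rewrite cis_sum.
have p0 : ((\prod_j cabs (w 0 j))%:C : R[i]) != 0.
  rewrite rc_prod; apply/prodf_neq0 => j _.
  by rewrite -cabs_gt0 cabs_real_ge0 ?cabs_ge0// cabs_gt0.
apply: (mulfI p0); rewrite -pw rc_prod -big_split/=.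
by apply: eq_bigr => j _; rewrite [RHS](proj2 (tP j)).
Qed.

End Arguments.

(** * Normalized vectors and their continuity *)

Section Directions.
Variables (R : realType) (d : nat).
Implicit Types z w a : 'rV[R[i]]_d.

Lemma vabsE z j : vabs z 0 j = cabs (z 0 j).
Proof. by rewrite mxE. Qed.

Lemma norm2E z : norm2 z = Num.sqrt (\sum_j cabs (z 0 j) ^+ 2).
Proof. by congr Num.sqrt; apply: eq_bigr => j _; rewrite vabsE. Qed.

Lemma norm2_ge0 z : 0 <= norm2 z.
Proof. exact: sqrtr_ge0. Qed.

Lemma norm2_gt0 z j : z 0 j != 0 -> 0 < norm2 z.
Proof.
move=> zj; rewrite norm2E sqrtr_gt0 (bigD1 j)//= ltr_pwDl ?exprn_gt0 ?cabs_gt0//.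
by rewrite sumr_ge0// => i _; rewrite sqr_ge0.
Qed.

Lemma directionE z j : direction z 0 j = z 0 j / (norm2 z)%:C.
Proof. by rewrite mxE rcV mulrC. Qed.

Lemma abs_directionE z j : abs_direction z 0 j = cabs (z 0 j) / norm2 z.
Proof. by rewrite mxE vabsE mulrC. Qed.

Lemma cabs_direction z j : cabs (direction z 0 j) = abs_direction z 0 j.
Proof. by rewrite directionE abs_directionE cabsf cabs_real_ge0 ?norm2_ge0. Qed.

Lemma enorm_abs_direction z j : z 0 j != 0 -> enorm (abs_direction z) = 1.
Proof.
move=> /norm2_gt0 z0; rewrite /enorm.
under eq_bigr do rewrite abs_directionE expr_div_n.
rewrite -mulr_suml sqrtrM ?sumr_ge0// => [|i _]; last exact: sqr_ge0.
by rewrite -norm2E sqrtrV ?sqr_ge0// sqrtr_sqr ger0_norm ?norm2_ge0// divff// gt_eqF.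
Qed.

Lemma prod_direction a (phi : R) :
  \prod_j a 0 j = (\prod_j cabs (a 0 j))%:C * cis phi ->
  \prod_j direction a 0 j = (\prod_j abs_direction a 0 j)%:C * cis phi.
Proof.
move=> pa; under eq_bigr do rewrite directionE; rewrite big_split/= pa.
under [in RHS]eq_bigr do rewrite abs_directionE; rewrite big_split/= rcM.
rewrite mulrAC; congr (_ * _ * _); rewrite rc_prod.
by apply: eq_bigr => j _; rewrite rcV.
Qed.

Lemma cabs_direction_le1 z j : cabs (direction z 0 j) <= 1.
Proof.
have [zj|zj] := eqVneq (z 0 j) 0; first by rewrite directionE zj mul0r cabs0.
have z0 := norm2_gt0 zj.
rewrite cabs_direction abs_directionE ler_pdivrMr// mul1r norm2E.
rewrite -[leLHS](ger0_norm (cabs_ge0 _)) -sqrtr_sqr ler_wsqrtr// (bigD1 j)//= lerDl.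
by rewrite sumr_ge0// => i _; rewrite sqr_ge0.
Qed.

Lemma norm2_cvg (A : nat -> 'rV[R[i]]_d) a :
  (forall j, A n 0 j @[n --> \oo] --> a 0 j) -> norm2 (A n) @[n --> \oo] --> norm2 a.
Proof.
move=> Aa; under eq_fun do rewrite norm2E; rewrite norm2E.
apply: (@continuous_cvg _ _ _ _ _ _ (@Num.sqrt R)); first exact: sqrt_continuous.
apply: cvg_big => [|j _]; [exact: add_continuous|]; under eq_fun do rewrite expr2; rewrite expr2.
by apply: cvgM; apply: cvg_cabs.
Qed.

Lemma rc_cvg (u : nat -> R) (l : R) :
  u n @[n --> \oo] --> l -> (u n)%:C @[n --> \oo] --> (l%:C : R[i]).
Proof.
move=> /cvgrPdist_lt ul; apply/ccvgP => e /ul[N _ NP]; exists N => n /NP /=.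
by rewrite -rcB cabs_real distrC.
Qed.

Lemma direction_cvg (A : nat -> 'rV[R[i]]_d) a j :
  (forall j, a 0 j != 0) ->
  (forall j, A n 0 j @[n --> \oo] --> a 0 j) ->
  direction (A n) 0 j @[n --> \oo] --> direction a 0 j.
Proof.
move=> a0 Aa; under eq_fun do rewrite directionE; rewrite directionE.
apply: (@cvgM R[i] _ _ _ (fun n => A n 0 j) (fun n => (norm2 (A n))%:C^-1)); first exact: Aa.
apply: (@cvgV R[i]); last exact/rc_cvg/norm2_cvg.
by rewrite -cabs_gt0 cabs_real_ge0 ?norm2_ge0// (norm2_gt0 (a0 j)).
Qed.

Lemma cvg_rVr_coord (u : nat -> 'rV[R]_d) (v : 'rV[R]_d) :
  (forall j, u n 0 j @[n --> \oo] --> v 0 j) -> u n @[n --> \oo] --> v.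
Proof.
move=> uv; apply/cvg_rVrP => e e0; apply: filter_forall => j.
by have /cvgrPdist_lt/(_ e e0) := uv j.
Qed.

End Directions.

(** * Accumulation of the directions of orbits asymptotic to the model *)

Section OrbitDirections.
Variables (R : realType) (d k h : nat) (lambda : 'rV[R[i]]_d).
Hypothesis d0 : (0 < d)%N.
Hypothesis lambda1 : forall j, cabs (lambda 0 j) = 1.
Hypothesis reso : one_resonant lambda.

Lemma omega_direction (a : 'rV[R[i]]_d) : (forall j, a 0 j != 0) ->
  \prod_j a 0 j = (\prod_j cabs (a 0 j))%:C * cis (2 * pi * h%:R / k%:R) ->
  omega k h (abs_direction a) (direction a).
Proof.
move=> a0 pa; split; first by apply/rowP => j; rewrite vabsE cabs_direction.
apply/arg_sumP; split=> [j|].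
  by rewrite -cabs_gt0 cabs_direction abs_directionE divr_gt0 ?cabs_gt0// (norm2_gt0 (a0 j)).
rewrite (prod_direction pa); congr (_%:C * _).
by apply: eq_bigr => j _; rewrite cabs_direction.
Qed.

(** Put A_n = z_n / (lambda^n q_n). Positive scaling does not affect directions and unimodular
    factors do not affect moduli, so the direction of z_n is that of A_n rotated by lambda^n, and
    the absolute directions of the two agree. *)
Lemma orbit_directions (z : nat -> 'rV[R[i]]_d) (q : nat -> R) (a : 'rV[R[i]]_d) :
  (forall n, 0 < q n) -> (forall j, a 0 j != 0) ->
  (forall j, z n 0 j / (lambda 0 j ^+ n * (q n)%:C) @[n --> \oo] --> a 0 j) ->
  \prod_j a 0 j = (\prod_j cabs (a 0 j))%:C * cis (2 * pi * h%:R / k%:R) ->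
  [/\ abs_direction (z n) @[n --> \oo] --> abs_direction a,
      positive_unit (abs_direction a) &
      accumulation_directions z = omega k h (abs_direction a)].
Proof.
move=> q0 a0 za pa; have j0 : 'I_d := Ordinal d0.
pose A n : 'rV[R[i]]_d := \row_j (z n 0 j / (lambda 0 j ^+ n * (q n)%:C)).
have qC n : ((q n)%:C : R[i]) != 0 by rewrite -cabs_gt0 cabs_real_ge0// ltW.
have ln1 n j : cabs (lambda 0 j ^+ n) = 1 by rewrite cabsX lambda1 expr1n.
have ln0 n j : lambda 0 j ^+ n != 0 by rewrite -cabs_gt0 ln1.
have zE n j : z n 0 j = lambda 0 j ^+ n * (q n)%:C * A n 0 j.
  by rewrite mxE mulrC divfK// mulf_neq0.
have czE n j : cabs (z n 0 j) = q n * cabs (A n 0 j).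
  by rewrite zE !cabsM ln1 mul1r cabs_real_ge0// ltW.
have nzE n : norm2 (z n) = q n * norm2 (A n).
  rewrite !norm2E; under eq_bigr do rewrite czE exprMn.
  by rewrite -mulr_sumr sqrtrM ?sqr_ge0// sqrtr_sqr ger0_norm// ltW.
have Acvg j : A n 0 j @[n --> \oo] --> a 0 j.
  by under eq_fun do rewrite mxE; exact: za.
have dzE n j : direction (z n) 0 j = lambda 0 j ^+ n * direction (A n) 0 j.
  rewrite !directionE zE nzE rcM invfM.
  by move: ((norm2 (A n))%:C^-1) => m; field; exact: qC.
have adzE n : abs_direction (z n) = abs_direction (A n).
  apply/rowP => j; rewrite -!cabs_direction dzE cabsM ln1 mul1r //.
have dcvg j := @direction_cvg R d A a j a0 Acvg.
have vunit : positive_unit (abs_direction a).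
  split=> [j|]; last exact: enorm_abs_direction (a0 j0).
  by rewrite abs_directionE divr_gt0 ?cabs_gt0// (norm2_gt0 (a0 j)).
have adcvg : abs_direction (z n) @[n --> \oo] --> abs_direction a.
  under eq_fun do rewrite adzE; apply: cvg_rVr_coord => j.
  under eq_fun do rewrite -cabs_direction; rewrite -cabs_direction.
  exact: cvg_cabs.
split => //.
have pda := prod_direction pa.
have dunif e : 0 < e -> exists N, forall n j, (N <= n)%N ->
    cabs (direction (A n) 0 j - direction a 0 j) < e.
  move=> e0; have : \forall n \near \oo, forall j,
      cabs (direction (A n) 0 j - direction a 0 j) < e.
    apply: filter_forall => j; have /ccvgP/(_ e e0)[N NP] := dcvg j.
    by exists N.
  by case=> N _ NP; exists N => n j /NP.
have da1 j : cabs (direction a 0 j) <= 1 by exact: cabs_direction_le1.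
apply/seteqP; split => w.
- move=> /cluster_seqP clw.
  have close e : 0 < e -> exists n, (forall j, cabs (w 0 j - direction (z n) 0 j) < e) /\
      (forall j, cabs (direction (A n) 0 j - direction a 0 j) < e).
    move=> e0; have [N NP] := dunif e e0; have [n Nn nP] := clw e N e0.
    by exists n; split => // j; exact: NP.
  have wv j : cabs (w 0 j) = abs_direction a 0 j.
    apply/eqP; rewrite -subr_eq0 -normr_eq0 eq_le normr_ge0 andbT.
    apply/ler_addgt0Pr => e e0; rewrite add0r.
    have [n [/(_ j) h1 /(_ j) h2]] := close (e / 2) ltac:(by rewrite divr_gt0).
    have h3 := cabs_dist_norm (w 0 j) (direction (z n) 0 j).
    have h4 := cabs_dist_norm (direction (A n) 0 j) (direction a 0 j).
    rewrite !cabs_direction -adzE in h4; rewrite cabs_direction in h3.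
    have := ler_distD (abs_direction (z n) 0 j) (cabs (w 0 j)) (abs_direction a 0 j).
    lra.
  have w0 j : w 0 j != 0 by rewrite -cabs_gt0 wv; have [/(_ j)] := vunit.
  have w1 j : cabs (w 0 j) <= 1 by rewrite wv -cabs_direction.
  split; first by apply/rowP => j; rewrite vabsE.
  apply/arg_sumP; split => //; under [in RHS]eq_bigr do rewrite wv.
  rewrite -pda; apply/eqP; rewrite -subr_eq0 -cabs_eq0 eq_le cabs_ge0 andbT.
  apply/ler_addgt0Pr => e e0; rewrite add0r.
  have dp : (0 : R) < d%:R by rewrite ltr0n.
  have [n [h1 h2]] := close (e / (2 * d%:R)) ltac:(by rewrite divr_gt0// mulr_gt0).
  (* The rotation by lambda^n leaves the product of the coordinates unchanged, which is how the
     argument sum survives in the limit. *)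
  have pz : \prod_j direction (z n) 0 j = \prod_j direction (A n) 0 j.
    under eq_bigr do rewrite dzE.
    by rewrite big_split/= prodrXl (one_resonant_prod lambda1 reso d0) expr1n mul1r.
  apply: le_trans (cabs_distD (\prod_j direction (z n) 0 j) _ _) _.
  have sum_small (f : 'I_d -> R) : (forall j, f j < e / (2 * d%:R)) -> \sum_j f j <= e / 2.
    move=> fe; apply: (@le_trans _ _ (\sum_(j < d) e / (2 * d%:R))).
      by apply: ler_sum => j _; exact: ltW.
    rewrite sumr_const card_ord -mulr_natl le_eqVlt; apply/orP; left; apply/eqP.
    by field; rewrite gt_eqF.
  have dz1 j : cabs (direction (z n) 0 j) <= 1 by exact: cabs_direction_le1.
  have dA1 j : cabs (direction (A n) 0 j) <= 1 by rewrite cabs_direction -adzE -cabs_direction.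
  rewrite [leRHS]splitr lerD//.
    by apply: le_trans (cabs_prodB _ _ w1 dz1) _; exact: sum_small.
  by rewrite pz; apply: le_trans (cabs_prodB _ _ dA1 da1) _; exact: sum_small.
move=> [wv /arg_sumP[w0 pw]]; apply/cluster_seqP => e N e0.
have wvj j : cabs (w 0 j) = cabs (direction a 0 j).
  by rewrite cabs_direction -wv vabsE.
have da0 j : direction a 0 j != 0 by rewrite -cabs_gt0 -wvj cabs_gt0.
(* The torus element carrying the limit direction to [w]; its product is 1 because both have the
   same argument sum, so powers of lambda approach it. *)
pose t j := w 0 j / direction a 0 j.
have t1 j : cabs (t j) = 1 by rewrite /t cabsf wvj divff// cabs_eq0.
have tp : \prod_j t j = 1.
  rewrite big_split/= pw -(big_morph _ (@invfM R[i]) (@invr1 _)) pda.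
  under eq_bigr do rewrite wvj cabs_direction.
  rewrite divff// mulf_neq0 ?cis_neq0// rc_prod; apply/prodf_neq0 => j _.
  by rewrite -cabs_gt0 -cabs_direction cabs_real_ge0 ?cabs_ge0// cabs_gt0.
have e20 : 0 < e / 2 by rewrite divr_gt0.
have [N1 N1P] := dunif _ e20.
have [n] := one_resonant_dense lambda1 reso (maxn N N1) d0 t1 tp e20.
rewrite geq_max => /andP[Nn N1n] nP; exists n => // j.
have -> : w 0 j - direction (z n) 0 j = (t j - lambda 0 j ^+ n) * direction a 0 j
    + lambda 0 j ^+ n * (direction a 0 j - direction (A n) 0 j).
  by rewrite dzE /t; field.
apply: le_lt_trans (cabsD _ _) _; rewrite !cabsM ln1 mul1r [ltRHS]splitr ltr_leD//.
  by rewrite (le_lt_trans _ (nP j))// cabsBC ler_piMr ?cabs_ge0.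
by rewrite cabsBC; apply/ltW/N1P.
Qed.

Lemma closed_seq (K : set 'rV[R[i]]_d) :
  (forall (x : nat -> 'rV[R[i]]_d) (w : 'rV[R[i]]_d), (forall n, K (x n)) ->
     (forall j, x n 0 j @[n --> \oo] --> w 0 j) -> K w) -> closed K.
Proof.
move=> KP; apply: closed_rVP => w Kw.
have /choice[x xP] : forall n : nat, exists x, K x /\ forall j, cabs (w 0 j - x 0 j) < n.+1%:R^-1.
  by move=> n; have [x Kx wx] := Kw n.+1%:R^-1 ltac:(by rewrite invr_gt0); exists x.
apply: (KP x) => [n|j]; first by have [] := xP n.
apply/ccvgP => e e0; exists (Num.truncn e^-1) => n Nn.
have [_ /(_ j)] := xP n; rewrite cabsBC => /lt_le_trans; apply.
rewrite invf_ple ?posrE ?ltr0n//; apply: ltW; apply: lt_le_trans (truncnS_gt _) _.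
by rewrite ler_nat ltnS.
Qed.

Lemma cvg_eq (u v : nat -> R[i]) (a b : R[i]) : (forall n, u n = v n) ->
  u n @[n --> \oo] --> a -> v n @[n --> \oo] --> b -> a = b.
Proof.
move=> uv; have -> : u = v by apply: funext.
move=> ua ub; exact: (cvg_unique (@norm_hausdorff _ R[i]) ua ub).
Qed.

(** The cone is cut out by the closed conditions that |w| be proportional to v and that the product
    of the w j be the product of moduli times a fixed unit number. These also hold at the vertex,
    where arguments are undefined. *)
Lemma closed_cone_omega (v : 'rV[R]_d) : positive_unit v ->
  (exists w, omega k h v w) -> closed_cone (cone_over (omega k h v)).
Proof.
move=> [v0 v1] [w0 ow0]; have j0 : 'I_d := Ordinal d0.
have vC j : ((v 0 j)%:C : R[i]) != 0 by rewrite -cabs_gt0 cabs_real_ge0// ltW.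
pose K := [set w : 'rV[R[i]]_d |
  (forall i j, (cabs (w 0 i))%:C * (v 0 j)%:C = (cabs (w 0 j))%:C * (v 0 i)%:C :> R[i]) /\
  \prod_j w 0 j = (\prod_j (cabs (w 0 j))%:C) * cis (2 * pi * h%:R / k%:R)].
have KE : cone_over (omega k h v) = K.
  apply/seteqP; split=> w.
  - move=> [t [t0 [a [av /arg_sumP[a0 pa]] ->]]].
    have wE j : (t%:C *: a) 0 j = t%:C * a 0 j by rewrite mxE.
    have cE j : cabs ((t%:C *: a) 0 j) = t * v 0 j.
      by rewrite wE cabsM cabs_real_ge0// -av vabsE.
    split=> [i j|]; first by rewrite !cE !rcM; ring.
    under eq_bigr do rewrite wE; under [in RHS]eq_bigr do rewrite cE rcM.
    rewrite !big_split/= pa rc_prod mulrA; congr (_ * _ * _).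
    by apply: eq_bigr => j _; rewrite -av vabsE.
  move=> [wv pw]; pose t := cabs (w 0 j0) / v 0 j0.
  have t0 : 0 <= t by rewrite divr_ge0 ?cabs_ge0// ltW.
  have wt j : cabs (w 0 j) = t * v 0 j.
    apply: (@complexI R); rewrite rcM rcM rcV.
    apply: (mulIf (vC j0)); rewrite [LHS]wv; field; exact: vC.
  exists t; split => //.
  (* The vertex is 0 times a point of [omega], hence the hypothesis that there is one. *)
  have [tz|tn0] := eqVneq t 0.
    exists w0 => //; apply/rowP => j; rewrite mxE tz mul0r.
    by apply/eqP; rewrite -cabs_eq0 wt tz mul0r.
  have tC : (t%:C : R[i]) != 0 by rewrite -cabs_gt0 cabs_real_ge0// lt_def tn0.
  exists ((t%:C)^-1 *: w); last by rewrite scalerA divff// scale1r.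
  have cE j : cabs (((t%:C)^-1 *: w) 0 j) = v 0 j.
    by rewrite mxE cabsM cabsV cabs_real_ge0// wt mulKf.
  split; first by apply/rowP => j; rewrite vabsE cE.
  apply/arg_sumP; split=> [j|]; first by rewrite -cabs_gt0 cE.
  under eq_bigr do rewrite mxE; under [in RHS]eq_bigr do rewrite cE.
  rewrite big_split/= pw mulrA rc_prod -big_split/=; congr (_ * _).
  by apply: eq_bigr => j _; rewrite wt (rcM t) mulKf.
split=> [|t w t0 [s [s0 [a oa ->]]]]; last first.
  by exists (t * s); split; [exact: mulr_ge0|exists a => //; rewrite scalerA rcM].
rewrite KE; apply: closed_seq => x w xK xw; split=> [i j|].
  apply: (@cvg_eq (fun n => (cabs (x n 0 i))%:C * (v 0 j)%:C)
                  (fun n => (cabs (x n 0 j))%:C * (v 0 i)%:C)).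
  - by move=> n; have [/(_ i j)] := xK n.
  - by apply: (@cvgM R[i]); [exact/rc_cvg/cvg_cabs|exact: cvg_cst].
  - by apply: (@cvgM R[i]); [exact/rc_cvg/cvg_cabs|exact: cvg_cst].
apply: (@cvg_eq (fun n => \prod_j x n 0 j)
  (fun n => (\prod_j (cabs (x n 0 j))%:C) * cis (2 * pi * h%:R / k%:R))).
- by move=> n; have [] := xK n.
- by apply: cvg_prod => j; exact: xw.
- apply: (@cvgM R[i]); last exact: cvg_cst.
  by apply: cvg_prod => j; exact/rc_cvg/cvg_cabs.
Qed.

End OrbitDirections.

(** * Selecting the k-th root of unity by the sector *)

Section SectorLimit.
Variable R : realType.

Lemma cvg_Re (u : nat -> R[i]) (l : R[i]) :
  u n @[n --> \oo] --> l -> complex.Re (u n) @[n --> \oo] --> complex.Re l.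
Proof.
move=> /ccvgP ul; apply/cvgrPdist_lt => e /ul[N NP]; exists N => // n /NP /=.
by apply: le_lt_trans; rewrite distrC -raddfB; exact: Re_le_cabs.
Qed.

Lemma ccvgX (u : nat -> R[i]) (l : R[i]) (k : nat) :
  u n @[n --> \oo] --> l -> u n ^+ k @[n --> \oo] --> l ^+ k.
Proof.
move=> ul; elim: k => [|k IH].
  by rewrite expr0; under eq_fun do rewrite expr0; exact: cvg_cst.
under eq_fun do rewrite exprS; rewrite exprS.
exact: (@cvgM R[i] _ _ _ u (fun n => u n ^+ k) l (l ^+ k) ul IH).
Qed.

(* Within the sector k |s| <= pi/2, so that cos (k s) <= cos s. *)
Lemma sector_limit (k : nat) (phi theta : R) (P : nat -> R[i]) (p : R[i]) :
  (0 < k)%N -> k%:R * theta <= pi / 2 -> cis (k%:R * phi) = 1 ->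
  (forall n, exists t, P n = (cabs (P n))%:C * cis t /\ `|t - phi| < theta) ->
  P n @[n --> \oo] --> p -> P n ^+ k @[n --> \oo] --> (1 : R[i]) -> p = cis phi.
Proof.
move=> k0 kth kphi sec Pp Pk.
have pk : p ^+ k = 1 := cvg_eq (fun=> erefl) (ccvgX (k := k) Pp) Pk.
have cp : cabs p = 1.
  apply: (@pexpIrn _ k k0); rewrite ?nnegrE ?cabs_ge0// -cabsX pk cabs1 expr1n//.
(* Rotating by -phi centres the sector on the positive axis without changing k-th powers. *)
pose Q n := P n * cis (- phi); pose qq := p * cis (- phi).
have Qq : Q n @[n --> \oo] --> qq.
  exact: (@cvgM R[i] _ _ _ P (fun=> cis (- phi)) p _ Pp (cvg_cst _)).
have cisk : cis (- phi) ^+ k = 1.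
  by rewrite -cisMn -mulr_natl mulrN cisN kphi invr1.
(* Re (Q^k) <= |P|^(k-1) Re Q is a closed condition, so it passes to the limit even though arguments
   need not; a unimodular number with real part at least 1 is 1. *)
have Re1 : 1 <= complex.Re qq.
  have c1 : cabs (P n) ^+ k.-1 * complex.Re (Q n) @[n --> \oo] --> 1 * complex.Re qq.
    apply: cvgM; last exact: cvg_Re.
    have -> : (1 : R) = cabs (p ^+ k.-1) by rewrite cabsX cp expr1n.
    by under eq_fun do rewrite -cabsX; apply/cvg_cabs/ccvgX.
  have c2 : complex.Re (Q n ^+ k) @[n --> \oo] --> complex.Re (1 : R[i]).
    have -> : (fun n => complex.Re (Q n ^+ k)) = (fun n => complex.Re (P n ^+ k)).
      by apply: funext => n; rewrite /Q exprMn cisk mulr1.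
    exact: cvg_Re Pk.
  rewrite mul1r in c1; apply: (ler_cvg_to c2 c1); apply: nearW => n.
  have [t [Pt tphi]] := sec n; pose s := t - phi.
  have Qs : Q n = (cabs (P n))%:C * cis s by rewrite /Q {1}Pt -mulrA -cisD.
  have ReM (a : R) (x : R[i]) : complex.Re (a%:C * x) = a * complex.Re x.
    by case: x => x y; rewrite /= mul0r subr0.
  rewrite Qs exprMn -rcX -cisMn !ReM mulrA -exprSr prednK//.
  rewrite ler_wpM2l ?exprn_ge0 ?cabs_ge0//=.
  rewrite -(cos_norm (s *+ k)) -(cos_norm s) normrMn -mulr_natl.
  have k1 : (1 : R) <= k%:R by rewrite ler1n.
  have s0 := normr_ge0 s; have pi0 := @pi_ge0 R.
  have ks : k%:R * `|s| <= pi / 2 by apply: le_trans kth; rewrite ler_wpM2l// ltW.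
  have s_ks : `|s| <= k%:R * `|s| by rewrite ler_peMl.
  rewrite leNgt ltr_cos ?in_itv/=; first by rewrite -leNgt.
    by apply/andP; split; lra.
  by apply/andP; split; lra.
have cq : cabs qq = 1 by rewrite cabsM cp cabs_cis mulr1.
have qE : qq = 1.
  have := sqr_cabs qq; rewrite cq; have := le_trans (ler_norm _) (Re_le_cabs qq); rewrite cq.
  move: Re1; case: (qq) => a b /= a1 a2 ab.
  have -> : a = 1 by lra.
  have b2 : b ^+ 2 = 0 by nra.
  by have /eqP := b2; rewrite sqrf_eq0 => /eqP ->.
by rewrite -[LHS]mulr1 -(cis0 R) -(subrr phi) addrC cisD mulrA -/qq qE mul1r.
Qed.

End SectorLimit.

(** * Asymptotics of the orbits in a basin *)

Section OrbitsInBasin.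
Variables (R : realType) (d k l h : nat) (lambda : 'rV[R[i]]_d).
Variables (F : 'rV[R[i]]_d -> 'rV[R[i]]_d) (beta theta R0 C r : R).
Hypotheses (d2 : (2 <= d)%N) (k1 : (1 <= k)%N).
Hypothesis lambda1 : forall j, cabs (lambda 0 j) = 1.
Hypothesis reso : one_resonant lambda.
Hypotheses (C0 : 0 <= C) (r0 : 0 < r).
Hypothesis HF : forall (z : 'rV[R[i]]_d) (M : R), 0 <= M -> M < r ->
  (forall j, cabs (z 0 j) <= M) ->
  forall j, cabs (F z 0 j - normal_form k lambda z 0 j) <= C * M ^+ l.
Hypothesis beta0 : 0 < beta.
Hypothesis hbeta : (2 * k + 1)%:R < beta * (l + d - 1)%:R.
Hypothesis htheta : 0 < theta < pi / (2 * k)%:R.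

Lemma normal_formE (z : 'rV[R[i]]_d) j :
  normal_form k lambda z 0 j = lambda 0 j * z 0 j * (1 - coord_prod z ^+ k / (k * d)%:R).
Proof.
by rewrite /normal_form mxE mul_mx_diag mxE; ring.
Qed.

Lemma W_lower_bound (z : 'rV[R[i]]_d) j : W beta z ->
  cabs (coord_prod z) <= cabs (z 0 j) * (cabs (coord_prod z) `^ beta) ^+ d.-1.
Proof.
move=> Wz; set M := _ `^ beta.
rewrite {1}/coord_prod cabs_prod (bigD1 j)//= ler_wpM2l ?cabs_ge0//.
apply: (@le_trans _ _ (\prod_(i | i != j) M)).
  by apply: ler_prod => i _; rewrite cabs_ge0 ltW.
rewrite prodr_const [X in _ ^+ X <= _](_ : _ = d.-1)//.
by rewrite -[d in RHS]card_ord -(cardC1 j); apply: eq_card.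
Qed.

Lemma W_step_error (z : 'rV[R[i]]_d) j : W beta z -> z 0 j != 0 ->
  coord_prod z != 0 -> cabs (coord_prod z) <= 1 -> cabs (coord_prod z) `^ beta < r ->
  cabs ((F z 0 j - normal_form k lambda z 0 j) / (lambda 0 j * z 0 j)) <=
    C * cabs (coord_prod z ^+ k) ^+ 2.
Proof.
move=> Wz zj0 u0 u1 ur; set b := cabs (coord_prod z); set M := b `^ beta.
have b0 : 0 < b by rewrite cabs_gt0.
have M0 : 0 <= M by exact: powR_ge0.
rewrite cabsf cabsM lambda1 mul1r ler_pdivrMr ?cabs_gt0//.
apply: le_trans (HF M0 ur (fun j => ltW (Wz j)) j) _; rewrite -mulrA ler_wpM2l//.
rewrite cabsX -exprM -/b.
have d1 : (0 < d)%N by rewrite ltnW.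
have hM : M ^+ (l + d - 1) <= b ^+ (2 * k + 1).
  have -> : M ^+ (l + d - 1) = b `^ (beta * (l + d - 1)%:R).
    by rewrite powRrM powR_mulrn ?powR_ge0.
  have -> : b ^+ (2 * k + 1) = b `^ (2 * k + 1)%:R by rewrite powR_mulrn// ltW.
  by apply: ger_powR; [rewrite b0 u1|exact: ltW].
have low := W_lower_bound j Wz; rewrite -/b -/M in low.
(* After multiplication by b = |pi(z)| the lower bound for |z^j| applies in the form b <= |z^j|
   M^(d-1). The exponent 2k+1 is 2k for |x|^2 plus 1 for this factor b. *)
rewrite -(ler_pM2r b0); apply: (@le_trans _ _ (M ^+ l * (cabs (z 0 j) * M ^+ d.-1))).
  by rewrite ler_wpM2l ?exprn_ge0.
have -> : M ^+ l * (cabs (z 0 j) * M ^+ d.-1) = cabs (z 0 j) * M ^+ (l + d - 1).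
  by rewrite -addnBA// subn1 exprD mulrCA.
have -> : b ^+ (k * 2) * cabs (z 0 j) * b = cabs (z 0 j) * b ^+ (2 * k + 1).
  by rewrite addn1 exprSr mulnC; ring.
by rewrite ler_wpM2l ?cabs_ge0.
Qed.

(** The k-th power of the product of the limits is 1 by comparison with the model; which k-th root
    of unity occurs is decided by the sector. *)
Lemma basin_orbit_asymptotics (z : nat -> 'rV[R[i]]_d) (q : nat -> R) :
  0 < q 0%N < 1 ->
  (forall n, q n.+1 = q n * (1 - q n ^+ (k * d) / (k * d)%:R)) ->
  (forall n, B k h R0 theta beta (z n)) -> (forall n, z n.+1 = F (z n)) ->
  (forall j, z n 0 j @[n --> \oo] --> (0 : R[i])) ->
  exists a : 'rV[R[i]]_d, [/\ forall j, a 0 j != 0,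
    forall j, z n 0 j / (lambda 0 j ^+ n * (q n)%:C) @[n --> \oo] --> a 0 j &
    \prod_j a 0 j = (\prod_j cabs (a 0 j))%:C * cis (2 * pi * h%:R / k%:R)].
Proof.
move=> q0 qS zB zS zcvg.
have d0 : (0 < d)%N by exact: ltnW.
have p1 : (1 < k * d)%N by rewrite (leq_trans d2)// leq_pmull.
pose u n := coord_prod (z n).
have u0 n : u n != 0 by have [_ [_ [t [[]]]]] := zB n.
have z0 n j : z n 0 j != 0.
  by have := u0 n; apply: contraNneq => zj; rewrite /u /coord_prod (bigD1 j)//= zj mul0r.
have ucvg : u n @[n --> \oo] --> (0 : R[i]).
  have := @cvg_prod R _ (index_enum 'I_d) (fun j n => z n 0 j) (fun=> 0) zcvg.
  by rewrite prodr_const card_ord expr0n gtn_eqF.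
have [N0 N0P] : exists N, forall n, (N <= n)%N ->
    cabs (u n) <= 1 /\ cabs (u n) `^ beta < r.
  move/ccvgP : ucvg => /(_ (Num.min 1 (r `^ beta^-1))) [|N NP].
    by rewrite lt_min ltr01 powR_gt0.
  exists N => n /NP; rewrite subr0 lt_min => /andP[u1 ur]; split; first exact: ltW.
  have -> : r = (r `^ beta^-1) `^ beta by rewrite -powRrM mulVf ?gt_eqF// powRr1// ltW.
  by rewrite gt0_ltr_powR// nnegrE ?cabs_ge0 ?powR_ge0.
have l0 j : lambda 0 j != 0 by exact: lambda_neq0.
pose eps n j := (F (z n) 0 j - normal_form k lambda (z n) 0 j) / (lambda 0 j * z n 0 j).
have [||||acvg xcvg] := @normalized_orbit_cvg R d k (lambda 0) (fun n => z n 0) eps q C N0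
   p1 l0 (one_resonant_prod lambda1 reso d0) q0 qS (fun n _ => u0 n).
- have := ccvgX (k := k) ucvg; rewrite expr0n gtn_eqF//.
- move=> n j _; rewrite zS /eps -/(coord_prod (z n)) mulrDr -normal_formE.
  by rewrite mulrC divfK ?mulf_neq0// addrC subrK.
- exact: C0.
- move=> n j Nn; have [u1 ur] := N0P n Nn; have [Wz _] := zB n.
  exact: (W_step_error Wz (z0 n j) (u0 n) u1 ur).
have /choice[a aP] : forall j, exists a : R[i], a != 0 /\
    z n 0 j / (lambda 0 j ^+ n * (q n)%:C) @[n --> \oo] --> a.
  by move=> j; have [a a0 ac] := acvg j; exists a.
exists (\row_j a j); split=> [j|j|]; rewrite ?mxE; [exact: (aP j).1|exact: (aP j).2|].
(* The multipliers cancel in the product, leaving pi(z_n) over a positive number: the argument is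
   that of pi(z_n), so it obeys the sector condition. *)
pose P n := \prod_j (z n 0 j / (lambda 0 j ^+ n * (q n)%:C)).
have qn0 n : 0 < q n := model_gt0 p1 q0 qS n.
have qC n : ((q n)%:C : R[i]) != 0 by rewrite -cabs_gt0 cabs_real_ge0// ltW.
have PE n : P n = u n / (q n ^+ d)%:C.
  rewrite /P big_split/= -(big_morph _ (@invfM R[i]) (@invr1 _)) big_split/=.
  rewrite prodrXl (one_resonant_prod lambda1 reso d0) expr1n mul1r prodr_const card_ord.
  by rewrite -rcX.
have Pcvg : P n @[n --> \oo] --> \prod_j a j.
  by apply: cvg_prod => j; exact: (aP j).2.
have pE : \prod_j a j = cis (2 * pi * h%:R / k%:R).
  have kR : (0 : R) < k%:R by rewrite ltr0n.
  apply: (@sector_limit R k _ theta P _ k1).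
  - case/andP: htheta => _ /ltW; rewrite natrM => /(ler_wpM2l (ltW kR)) /le_trans; apply.
    by rewrite le_eqVlt; apply/orP; left; apply/eqP; field; rewrite gt_eqF.
  - rewrite mulrC divfK ?gt_eqF//; exact: (cis_2pi_int _ (Posz h)).
  - move=> n; have [_ [_ [t [[_ ut] tt]]]] := zB n; exists t; split => //.
    rewrite PE cabsf {1}/u ut -/(u n) -/(cis t) cabs_real_ge0 ?exprn_ge0 ?ltW//.
    by rewrite rcM rcV mulrAC.
  - exact: Pcvg.
  - rewrite (_ : (fun n => P n ^+ k) = (fun n => u n ^+ k / (q n ^+ (k * d))%:C)).
      exact: xcvg.
    by apply: funext => n; rewrite PE expr_div_n -rcX -exprM [(d * k)%N]mulnC.
rewrite (eq_bigr a) => [|j _]; last by rewrite mxE.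
rewrite pE -[LHS]mul1r; congr (_ * _).
rewrite (eq_bigr (fun j => cabs (a j))) => [|j _]; last by rewrite mxE.
by rewrite -cabs_prod pE cabs_cis.
Qed.

End OrbitsInBasin.

(** * Relative errors under one backward step *)

Section BackwardStep.
Variable R : realType.

Lemma expr1B_le (t : R) (n : nat) : 0 <= t <= 1 ->
  (1 - t) ^+ n <= 1 - n%:R * t + n%:R ^+ 2 * t ^+ 2.
Proof.
move=> /andP[t0 t1]; elim: n => [|n IH]; first by rewrite expr0 mul0r subr0 expr0n mul0r addr0.
have n0 : (0 : R) <= n%:R by [].
have h1 : (1 - t) ^+ n.+1 <= (1 - t) * (1 - n%:R * t + n%:R ^+ 2 * t ^+ 2).
  by rewrite exprS ler_wpM2l//; lra.
have h2 : 0 <= n%:R ^+ 2 * t ^+ 2 * t by rewrite !mulr_ge0 ?sqr_ge0.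
have h3 : 0 <= n%:R * t ^+ 2 by rewrite mulr_ge0 ?sqr_ge0.
have h4 : 0 <= t ^+ 2 := sqr_ge0 t.
rewrite -natr1; lra.
Qed.

(* If xi = q^p, then A q^(p+1) decreases along the model by the relative amount
   (1 + 1/p) xi + O(xi^2), while one backward step amplifies the relative errors
   delta by at most 1 + xi + O(xi^2); the gap xi/p absorbs the error terms eps. *)
Lemma backward_contraction (d k : nat) (D C : R) : (0 < k * d)%N -> 0 <= D -> 0 <= C ->
  exists2 H : R, 0 < H & forall (q : R) (x : R[i]) (del del' eps : 'I_d -> R[i]),
    0 < q -> H * q <= 1 ->
    let p := (k * d)%N in let xi := q ^+ p in let A := 4 * p%:R * C in
    x = xi%:C * (\prod_j (1 + del j)) ^+ k -> cabs x <= D * xi ->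
    (forall j, (1 - xi / p%:R)%:C * (1 + del' j) = (1 + del j) * (1 - x / p%:R + eps j)) ->
    (forall j, cabs (eps j) <= C * xi ^+ 2 * q) ->
    (forall j, cabs (del' j) <= A * (q * (1 - xi / p%:R)) ^+ p.+1) ->
    forall j, cabs (del j) <= A * q ^+ p.+1.
Proof.
move=> p0 D0 C0; set p := (k * d)%N in p0 *.
have p1 : (1 : R) <= p%:R by rewrite ler1n.
have pp0 : (0 : R) < p%:R by rewrite ltr0n.
pose A := 4 * p%:R * C.
(* [D2] is the a priori bound for del/xi, [D3] bounds the quadratic part of the product expansion,
   [D4] collects all second-order terms of the amplification factor. *)
pose D2 := 2 * (D + 2); pose D3 := 4 ^+ p * D2; pose D4 := D2 + D3 + D2 * D3.
pose E := p.+2%:R ^+ 2 + D4.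
have A0 : 0 <= A by rewrite mulr_ge0// mulr_ge0.
have D20 : 0 <= D2 by rewrite mulr_ge0// addr_ge0.
have D30 : 0 <= D3 by rewrite mulr_ge0// exprn_ge0.
have D40 : 0 <= D4 by rewrite !addr_ge0// mulr_ge0.
have E0 : 0 <= E by rewrite addr_ge0// exprn_ge0.
pose H := A + C + 4 * (D + C) + D2 + 2 * p%:R * E + 8.
have pE0 : 0 <= 2 * p%:R * E by rewrite mulr_ge0// mulr_ge0.
exists H; first by rewrite /H; lra.
move=> q x del del' eps q0 Hq; cbv zeta; rewrite -/A; set xi := q ^+ p => xE xD rel epsC del'A.
have xi0 : 0 < xi by rewrite exprn_gt0.
have q8 : 8 * q <= 1.
  by apply: le_trans Hq; rewrite ler_pM2r// /H; lra.
have q1 : q <= 1 by lra.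
have xiq : xi <= q by rewrite -[leRHS]expr1 ler_wiXn2l// ltW.
have small (c : R) : 0 <= c -> c <= H -> c * xi <= 1.
  by move=> c0 cH; apply: le_trans Hq; rewrite ler_pM// ltW.
have s1 : A * q + C * xi <= 1.
  apply: le_trans (_ : (A + C) * q <= _); first by rewrite mulrDl lerD2l ler_wpM2l.
  by apply: le_trans Hq; rewrite ler_pM2r// /H; lra.
have s2 := small (4 * (D + C)) ltac:(lra) ltac:(rewrite /H; lra).
have s3 := small D2 D20 ltac:(rewrite /H; lra).
have s4 := small (2 * p%:R * E) pE0 ltac:(rewrite /H; lra).
have s5 := small 8 ltac:(by []) ltac:(rewrite /H; lra).
have xx : xi ^+ 2 <= xi by rewrite expr2 ler_piMr// ?ltW//; lra.
have xip : xi / p%:R <= xi by rewrite ler_pdivrMr// ler_peMr// ltW.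
have xip0 : 0 < xi / p%:R by rewrite divr_gt0.
have Aq : A * q ^+ p.+1 = A * xi * q by rewrite exprSr mulrA.
have epsC2 j : cabs (eps j) <= C * xi.
  apply: le_trans (epsC j) _; rewrite -mulrA ler_wpM2l// (le_trans _ xx)//.
  by rewrite ler_piMr// sqr_ge0.
have del'1 j : cabs (del' j) <= A * xi * q.
  apply: le_trans (del'A j) _; rewrite -Aq ler_wpM2l//; apply: lerXn2r; rewrite ?nnegrE ?(ltW q0)//.
    by rewrite mulr_ge0 ?(ltW q0)//; lra.
  by rewrite ler_piMr ?(ltW q0)//; lra.
have pC : (p%:R : R[i]) != 0 by rewrite pnatr_eq0 -lt0n.
have xp : cabs (x / p%:R) <= cabs x.
  by rewrite cabsf cabs_nat ler_pdivrMr// ler_peMr ?cabs_ge0.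
(* A crude bound by xi, from |x| <= D xi alone; it makes the terms quadratic in del negligible in
   the linearization below. *)
have ap j : cabs (del j) <= D2 * xi.
  have den : 2^-1 <= cabs (1 - x / p%:R + eps j).
    have := cabs_addl (1 - x / p%:R) (eps j); have := cabs_subl 1 (x / p%:R).
    by rewrite cabs1; have := epsC2 j; lra.
  have eq1 : del j * (1 - x / p%:R + eps j) =
      del' j * (1 - xi / p%:R)%:C + ((x - xi%:C) / p%:R - eps j).
    have := rel j; rewrite rcB rcM rcV rc_nat rc1 => h.
    apply: (@addrI _ (1 - x / p%:R + eps j)).
    by rewrite -[X in X + _ * _]mul1r -mulrDl -h; field.
  have b1 : cabs (del' j * (1 - xi / p%:R)%:C) <= A * xi * q.
    rewrite cabsM cabs_real_ge0; last by lra.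
    by rewrite (le_trans _ (del'1 j))// ler_piMr ?cabs_ge0//; lra.
  have b2 : cabs ((x - xi%:C) / p%:R) <= (D + 1) * xi.
    rewrite cabsf cabs_nat ler_pdivrMr// (le_trans (cabsB _ _))//.
    rewrite cabs_real_ge0 ?(ltW xi0)//; apply: (@le_trans _ _ ((D + 1) * xi)); first lra.
    by rewrite ler_peMr// mulr_ge0 ?(ltW xi0)// addr_ge0.
  have b3 : cabs (del j) * cabs (1 - x / p%:R + eps j) <= A * xi * q + (D + 1) * xi + C * xi ^+ 2.
    rewrite -cabsM eq1; apply: le_trans (cabsD _ _) _.
    have := cabsB ((x - xi%:C) / p%:R) (eps j).
    have : C * xi ^+ 2 * q <= C * xi ^+ 2 by rewrite ler_piMr// mulr_ge0 ?sqr_ge0.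
    by have := epsC j; lra.
  have b4 : xi * (A * q + C * xi) <= xi * 1 by rewrite ler_pM2l.
  have b5 : cabs (del j) * 2^-1 <= cabs (del j) * cabs (1 - x / p%:R + eps j).
    by rewrite ler_wpM2l ?cabs_ge0.
  have b6 : A * xi * q + C * xi ^+ 2 = xi * (A * q + C * xi) by ring.
  by rewrite /D2; lra.
move=> j.
(* The coordinates interact only through x, where their errors enter summed; at a coordinate of
   maximal error the sum is at most d times that error. *)
have [j1 j1P] : exists j1, forall i, cabs (del i) <= cabs (del j1).
  have := @arg_maxP _ R _ j xpredT (fun i => cabs (del i)) isT.
  by case=> i _ iP; exists i => i'; exact: iP.
apply: le_trans (j1P j) _; rewrite Aq; set De := cabs (del j1) in j1P *.
have De0 : 0 <= De := cabs_ge0 _.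
have DeD : De <= D2 * xi := ap j1.
have Y1 : cabs ((\prod_j (1 + del j)) ^+ k - 1) <= De * (p%:R + D3 * xi).
  have m01 : 0 <= De <= 1 by rewrite De0; clear -DeD s3; lra.
  have h1 := exp_prod1D_expand k m01 j1P; rewrite -/p in h1.
  set Y := _ ^+ k in h1 *.
  have h2 : cabs (k%:R * \sum_j del j) <= p%:R * De.
    rewrite cabsM cabs_nat /p natrM -mulrA ler_wpM2l//.
    apply: le_trans (cabs_sum _ _ _) _; apply: le_trans (ler_sum _ (fun i _ => j1P i)) _.
    by rewrite sumr_const card_ord -[leLHS]mulr_natl.
  have h3 : Y - 1 = (Y - (1 + k%:R * \sum_j del j)) + k%:R * \sum_j del j by ring.
  have h4 : 4 ^+ p * De ^+ 2 <= De * (D3 * xi).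
    by rewrite /D3 expr2 -[4 ^+ p * D2 * xi]mulrA mulrCA ler_wpM2l// ler_wpM2l ?exprn_ge0.
  by rewrite h3; apply: le_trans (cabsD _ _) _; rewrite mulrDr; clear -h1 h2 h4; lra.
have xxi : cabs (xi%:C - x) <= xi * (De * (p%:R + D3 * xi)).
  have -> : xi%:C - x = - (xi%:C * ((\prod_j (1 + del j)) ^+ k - 1)) by rewrite xE; ring.
  by rewrite cabsN cabsM cabs_real_ge0 ?(ltW xi0)// ler_pM2l.
(* The relation solved for del at the maximal coordinate: x deviates from xi by at most p xi De to
   first order, and division by p leaves the amplification xi De. *)
have main : (1 - xi / p%:R) * De <= (1 - xi / p%:R) * cabs (del' j1) +
    (1 + De) * (cabs (xi%:C - x) / p%:R + cabs (eps j1)).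
  have e1 : (1 - xi / p%:R)%:C * del j1 = (1 - xi / p%:R)%:C * del' j1 -
      (1 + del j1) * ((xi%:C - x) / p%:R + eps j1).
    have := rel j1; rewrite rcB rcM rcV rc_nat rc1 => h.
    have -> : (1 - xi%:C / p%:R) * del' j1 =
        (1 - xi%:C / p%:R) * (1 + del' j1) - (1 - xi%:C / p%:R) by ring.
    by rewrite h; field.
  have t0 : 0 <= 1 - xi / p%:R by clear -xip s5; lra.
  rewrite -[X in X * De](cabs_real_ge0 t0) -cabsM e1.
  apply: le_trans (cabsB _ _) _; rewrite !cabsM cabs_real_ge0// lerD2l.
  rewrite ler_pM ?cabs_ge0//; first by rewrite -[X in _ <= X + _](cabs1 R) cabsD.
  by apply: le_trans (cabsD _ _) _; rewrite cabsf cabs_nat.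
have xp2 : cabs (xi%:C - x) / p%:R <= xi * De * (1 + D3 * xi).
  rewrite ler_pdivrMr//; apply: le_trans xxi _.
  have : 0 <= xi * De * (D3 * xi) by apply: mulr_ge0; apply: mulr_ge0 => //; exact: ltW.
  move=> w0; have : xi * De * (D3 * xi) * 1 <= xi * De * (D3 * xi) * p%:R by rewrite ler_wpM2l.
  lra.
have g1 : (1 + De) * (cabs (xi%:C - x) / p%:R) <= xi * De * (1 + D4 * xi).
  apply: (@le_trans _ _ ((1 + D2 * xi) * (xi * De * (1 + D3 * xi)))).
    by rewrite ler_pM ?addr_ge0 ?divr_ge0 ?cabs_ge0 ?lerD2l ?(ltW pp0).
  have -> : (1 + D2 * xi) * (xi * De * (1 + D3 * xi)) =
    xi * De * (1 + (D2 + D3 + D2 * D3 * xi) * xi) by ring.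
  rewrite ler_wpM2l ?mulr_ge0 ?(ltW xi0)// lerD2l ler_pM2r// /D4 lerD2l.
  by apply: ler_piMr; [exact: mulr_ge0|clear -s5 xi0; lra].
have g2 : (1 + De) * cabs (eps j1) <= 2 * (C * xi ^+ 2 * q).
  by rewrite ler_pM ?cabs_ge0 ?addr_ge0//; clear -DeD s3; lra.
set t := xi / p%:R in main xip xip0 *.
(* The exponent p+2 is p+1 from the width at the next index plus 1 from the factor 1 - t of the
   relation. *)
have g3 : (1 - t) * cabs (del' j1) <= A * xi * q * (1 - t) ^+ p.+2.
  have -> : A * xi * q * (1 - t) ^+ p.+2 = (1 - t) * (A * (q * (1 - t)) ^+ p.+1).
    by rewrite exprMn -Aq; rewrite (exprS (1 - t) p.+1); ring.
  by rewrite ler_wpM2l//; clear -xip s5; lra.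
have t01 : 0 <= t <= 1 by clear -xip0 xip s5; apply/andP; split; lra.
have g4 := expr1B_le p.+2 t01.
have g5 : p.+2%:R * t = xi + 2 * t.
  by rewrite /t -addn2 natrD; field; rewrite gt_eqF.
(* This fixes the 4 in A = 4 p C: the remainder may take half of t = xi/p times the width. *)
have g6 : 2 * (C * xi ^+ 2 * q) = A * xi * q * (t / 2).
  by rewrite /A /t; field; rewrite gt_eqF.
have Axq : 0 <= A * xi * q by apply: mulr_ge0; [apply: mulr_ge0 => //|]; exact: ltW.
have g7 : p.+2%:R ^+ 2 * t ^+ 2 <= p.+2%:R ^+ 2 * xi ^+ 2.
  by rewrite ler_wpM2l ?sqr_ge0//; apply: lerXn2r; rewrite ?nnegrE ?(ltW xip0) ?(ltW xi0).
(* The other half of the gap pays for all second-order terms. *)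
have g8 : E * xi ^+ 2 <= t / 2.
  have : 2 * p%:R * E * xi * t <= 1 * t by rewrite ler_pM2r.
  have -> : 2 * p%:R * E * xi * t = 2 * (E * xi ^+ 2) by rewrite /t; field; rewrite gt_eqF.
  by move=> h; clear -h; lra.
have g9 : E * xi ^+ 2 = p.+2%:R ^+ 2 * xi ^+ 2 + D4 * xi ^+ 2 by rewrite /E mulrDl.
have fac : 0 < 1 - t - xi - D4 * xi ^+ 2.
  have h : 0 <= p.+2%:R ^+ 2 * xi ^+ 2 by rewrite mulr_ge0 ?sqr_ge0.
  by clear -h g8 g9 s5 xip xi0; lra.
have fin : (1 - t - xi - D4 * xi ^+ 2) * De <= (1 - t - xi - D4 * xi ^+ 2) * (A * xi * q).
  have f1 : (1 - t - xi - D4 * xi ^+ 2) * De <= A * xi * q * (1 - t) ^+ p.+2 + A * xi * q * (t / 2).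
    by rewrite -g6; rewrite mulrDr in main; clear -main g1 g2 g3; lra.
  apply: le_trans f1 _; rewrite -mulrDr mulrC ler_wpM2r//.
  by rewrite g5 in g4; clear -g4 g7 g8 g9; lra.
by rewrite ler_pM2l in fin.
Qed.

End BackwardStep.

(** * Backward shooting through tubes around an orbit of the normal form *)

Section Shooting.
Variables (R : realType) (d k l : nat) (lambda : 'rV[R[i]]_d).
Variables (F G : 'rV[R[i]]_d -> 'rV[R[i]]_d) (C r : R) (q : nat -> R) (a : 'rV[R[i]]_d).
Hypothesis d0 : (0 < d)%N.
Hypothesis p1 : (1 < k * d)%N.
Hypothesis hl : (2 * k * d + 1 < l)%N.
Hypothesis lambda1 : forall j, cabs (lambda 0 j) = 1.
Hypothesis lambdap : \prod_j lambda 0 j = 1.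
Hypotheses (C0 : 0 <= C) (r0 : 0 < r).
Hypothesis HF : forall (z : 'rV[R[i]]_d) (M : R), 0 <= M -> M < r ->
  (forall j, cabs (z 0 j) <= M) ->
  forall j, cabs (F z 0 j - normal_form k lambda z 0 j) <= C * M ^+ l.
Hypothesis HG : forall e : R, 0 < e -> exists2 rho : R, 0 < rho &
  forall y : 'rV[R[i]]_d, (forall j, cabs (y 0 j) < rho) ->
    F (G y) = y /\ forall j, cabs (G y 0 j) < e.
Hypothesis q0 : 0 < q 0%N < 1.
Hypothesis qS : forall n, q n.+1 = q n * (1 - q n ^+ (k * d) / (k * d)%:R).
Hypothesis a0 : forall j, a 0 j != 0.
Hypothesis ak : (\prod_j a 0 j) ^+ k = 1.

(** An exact orbit of the normal form: since prod lambda = 1 and (prod a)^k = 1, its value of pi^k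
    is q_n^(kd). *)
Definition model_point n j : R[i] := lambda 0 j ^+ n * (q n)%:C * a 0 j.

(** A polydisc in relative coordinates, whose relative radius shrinks faster than one backward step
    can expand. *)
Definition tube (A : R) n : set 'rV[R[i]]_d :=
  [set w : 'rV[R[i]]_d | forall j, cabs (w 0 j / model_point n j - 1) <= A * q n ^+ (k * d).+1].

Let qn0 n : 0 < q n := model_gt0 p1 q0 qS n.
Let qn1 n : q n < 1 := model_lt1 p1 q0 qS n.

Lemma cabs_model_point n j : cabs (model_point n j) = q n * cabs (a 0 j).
Proof. by rewrite !cabsM cabsX lambda1 expr1n mul1r cabs_real_ge0// ltW. Qed.

Lemma model_point_neq0 n j : model_point n j != 0.
Proof. by rewrite -cabs_gt0 cabs_model_point mulr_gt0// cabs_gt0. Qed.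

Lemma tubeE A n : tube A n = [set w : 'rV[R[i]]_d | forall j,
  cabs (w 0 j - model_point n j) <= A * q n ^+ (k * d).+1 * cabs (model_point n j)].
Proof.
have E w j : cabs (w / model_point n j - 1) = cabs (w - model_point n j) / cabs (model_point n j).
  by rewrite -cabsf; congr cabs; field; exact: model_point_neq0.
have m0 j : 0 < cabs (model_point n j) by rewrite cabs_gt0 model_point_neq0.
by apply/seteqP; split => w /= wA j; have := wA j; rewrite E ler_pdivrMr.
Qed.

Lemma compact_tube A n : compact (tube A n).
Proof. by rewrite tubeE; exact: compact_box. Qed.

Lemma cabs_coord_prod_le (w : 'rV[R[i]]_d) (M : R) :
  (forall j, cabs (w 0 j) <= M) -> cabs (coord_prod w ^+ k) <= M ^+ (k * d).
Proof.
move=> wM; have M0 : 0 <= M := le_trans (cabs_ge0 _) (wM (Ordinal d0)).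
rewrite cabsX mulnC exprM; apply: lerXn2r; rewrite ?nnegrE ?exprn_ge0 ?cabs_ge0//.
rewrite cabs_prod -[d in leRHS]card_ord -prodr_const.
by apply: ler_prod => j _; rewrite cabs_ge0 wM.
Qed.

(** The local inverse supplies a preimage known only to be small. Its coordinates are first shown to
    be comparable to q_m, which turns the remainder of F into a relative error as
    [backward_contraction] requires. *)
Lemma backward_step : exists A N, 0 <= A /\ forall m, (N <= m)%N ->
  forall y, tube A m.+1 y -> exists2 w, tube A m w & F w = y.
Proof.
set p := (k * d)%N; have p0 : (0 < p)%N := ltnW p1.
have pR : (1 : R) <= p%:R by rewrite ler1n.
have pR0 : (0 : R) < p%:R by rewrite ltr0n.
have ac j : 0 < cabs (a 0 j) by rewrite cabs_gt0.
pose Ma := \sum_j cabs (a 0 j).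
have aMa j : cabs (a 0 j) <= Ma.
  by rewrite /Ma (bigD1 j)//= lerDl sumr_ge0// => i _; exact: cabs_ge0.
have j0 : 'I_d := Ordinal d0.
have Ma0 : 0 < Ma := lt_le_trans (ac j0) (aMa j0).
(* A positive lower bound for all |a j|, obtained without taking a minimum. *)
pose ma := (\sum_j (cabs (a 0 j))^-1)^-1.
have ama0 j : (cabs (a 0 j))^-1 <= ma^-1.
  by rewrite invrK (bigD1 j)//= lerDl sumr_ge0// => i _; rewrite invr_ge0 cabs_ge0.
have ma0 : 0 < ma by rewrite -invr_gt0; apply: lt_le_trans (ama0 j0); rewrite invr_gt0.
have ama j : ma <= cabs (a 0 j) by rewrite -lef_pV2 ?posrE.
pose B := 4 * Ma; have B0 : 0 < B by rewrite mulr_gt0.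
(* Remainder C (B Q)^l divided by the lower bound Q ma / 16 for the coordinates of the preimage. *)
pose C1 := 16 * C * B ^+ l / ma.
have Bl0 : 0 < B ^+ l by rewrite exprn_gt0.
have C10 : 0 <= C1 by rewrite divr_ge0 ?(ltW ma0)// mulr_ge0 ?(ltW Bl0)// mulr_ge0.
have [H H0 HP] := backward_contraction p0 (exprn_ge0 p (ltW B0)) C10.
pose A := 4 * p%:R * C1.
have A0 : 0 <= A by rewrite mulr_ge0// mulr_ge0.
(* In this radius the remainder is at most a quarter of the largest coordinate. *)
pose eta := Num.min r (4 * (C + 1))^-1.
have eta0 : 0 < eta by rewrite lt_min r0 invr_gt0 mulr_gt0// ltr_wpDl.
have [etar etaC] : eta <= r /\ eta <= (4 * (C + 1))^-1 by rewrite !ge_min !lexx orbT.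
have eta4 : eta <= 4^-1 /\ C * eta <= 4^-1.
  have h : eta * (4 * (C + 1)) <= 1 by rewrite -ler_pdivlMr ?mul1r// mulr_gt0// ltr_wpDl.
  have : 0 <= C * eta by rewrite mulr_ge0// ltW.
  by split; lra.
have [rho rho0 rhoP] := HG eta0.
(* One summand for each smallness condition; Q < 1/S implies them all. *)
pose S := H + 2 * A + 2 * Ma / rho + 8 * C * B ^+ l / ma + 1.
have t1 : 0 <= 2 * Ma / rho by rewrite divr_ge0 ?(ltW rho0)// mulr_ge0// ltW.
have t2 : 0 <= 8 * C * B ^+ l / ma.
  by rewrite divr_ge0 ?(ltW ma0)// mulr_ge0 ?(ltW Bl0)// mulr_ge0.
have S0 : 0 < S by rewrite /S; lra.
have Si0 : 0 < S^-1 by rewrite invr_gt0.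
have [N NP] := model_small p1 q0 qS Si0.
exists A, N; split => // m Nm y yt.
have Q0 := qn0 m; set Q := q m in Q0 *.
have SQ : S * Q < 1 by rewrite -ltr_pdivlMl// mulr1; exact: NP.
have smallS (c : R) : c <= S -> c * Q < 1.
  by move=> cS; apply: le_lt_trans SQ; rewrite ler_pM2r.
have c1 := smallS H ltac:(rewrite /S; lra).
have c2 := smallS (2 * A) ltac:(rewrite /S; lra).
have c3 := smallS (2 * Ma / rho) ltac:(rewrite /S; lra).
have c4 := smallS (8 * C * B ^+ l / ma) ltac:(rewrite /S; lra).
have Q1 : Q <= 1 := ltW (qn1 m).
set xi := Q ^+ p.
have xi0 : 0 < xi by rewrite exprn_gt0.
have xi1 : xi <= 1 by rewrite exprn_ile1 ?(ltW Q0).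
have xip : xi / p%:R <= 2^-1.
  have p2 : (2 : R) <= p%:R by rewrite ler_nat.
  by rewrite ler_pdivrMr//; lra.
have xip0 : 0 < xi / p%:R by rewrite divr_gt0.
have q'E : q m.+1 = Q * (1 - xi / p%:R) by rewrite qS -/p -/Q.
set Q' := q m.+1 in q'E.
have Q'0 : 0 < Q' := qn0 m.+1.
have Q'Q : Q' <= Q by rewrite q'E ler_piMr ?(ltW Q0)//; lra.
have Q'2 : Q / 2 <= Q' by rewrite q'E ler_pM2l//; lra.
have QMa : 0 < Q * Ma by rewrite mulr_gt0.
have Qma : 0 < Q * ma by rewrite mulr_gt0.
have dy j : cabs (y 0 j - model_point m.+1 j) <= 2^-1 * cabs (model_point m.+1 j).
  move: yt; rewrite tubeE => /(_ j) /le_trans; apply; rewrite ler_wpM2r ?cabs_ge0//.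
  rewrite -/p -/Q' exprSr; apply: (@le_trans _ _ (A * (1 * Q))).
    by rewrite ler_wpM2l// ler_pM ?exprn_ge0 ?(ltW Q'0)// exprn_ile1 ?(ltW Q'0)// (le_trans Q'Q).
  by lra.
have yub j : cabs (y 0 j) <= 2 * Q * Ma.
  have := cabs_subl (y 0 j) (model_point m.+1 j); have := dy j.
  rewrite cabs_model_point -/Q'.
  have : Q' * cabs (a 0 j) <= Q * Ma by rewrite ler_pM ?(ltW Q'0) ?cabs_ge0.
  lra.
have ylb j : Q * ma / 4 <= cabs (y 0 j).
  have := cabs_subl (model_point m.+1 j) (y 0 j); rewrite cabsBC; have := dy j.
  rewrite cabs_model_point -/Q'.
  have : Q / 2 * ma <= Q' * cabs (a 0 j).
    by rewrite ler_pM ?(ltW ma0)// divr_ge0 ?(ltW Q0).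
  lra.
have [Fw weta] : F (G y) = y /\ forall j, cabs (G y 0 j) < eta.
  apply: rhoP => j; apply: le_lt_trans (yub j) _.
  have -> : 2 * Q * Ma = 2 * Ma / rho * Q * rho by field; rewrite gt_eqF.
  by rewrite -[ltRHS]mul1r ltr_pM2r.
set w := G y in Fw weta; exists w => //.
set x := coord_prod w ^+ k.
pose e j := F w 0 j - normal_form k lambda w 0 j.
have x4 : cabs x <= 4^-1.
  apply: le_trans (cabs_coord_prod_le (fun j => ltW (weta j))) _.
  apply: le_trans eta4.1; rewrite -[leRHS]expr1 ler_wiXn2l// ?(ltW eta0)//; lra.
have xp : cabs (x / p%:R) <= 4^-1.
  by rewrite cabsf cabs_nat ler_pdivrMr// (le_trans x4)//; lra.
have x34 : 3 / 4 <= cabs (1 - x / p%:R).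
  by have := cabs_subl 1 (x / p%:R); rewrite cabs1; lra.
have x2 : cabs (1 - x / p%:R) <= 2.
  by have := cabsB 1 (x / p%:R); rewrite cabs1; lra.
have nfE j : normal_form k lambda w 0 j = lambda 0 j * w 0 j * (1 - x / p%:R).
  by rewrite normal_formE.
have cnf j : cabs (normal_form k lambda w 0 j) = cabs (w 0 j) * cabs (1 - x / p%:R).
  by rewrite nfE !cabsM lambda1 mul1r.
have [j1 j1P] : exists j1, forall i, cabs (w 0 i) <= cabs (w 0 j1).
  have := @arg_maxP _ R _ j0 xpredT (fun i => cabs (w 0 i)) isT.
  by case=> i _ iP; exists i => i'; exact: iP.
set M := cabs (w 0 j1) in j1P.
have M0 : 0 <= M := cabs_ge0 _.
have eM j : cabs (e j) <= C * M ^+ l.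
  by apply: HF => //; exact: lt_le_trans (weta j1) etar.
have l2 : (2 <= l)%N by rewrite (leq_trans _ hl)// addn1.
(* At the largest coordinate (3/4) M - M/4 <= |y| <= 2 Q Ma, hence B = 4 Ma. *)
have MB : M <= B * Q.
  have h1 : C * M ^+ l <= 4^-1 * M.
    apply: (@le_trans _ _ (C * M ^+ 2)).
      rewrite ler_wpM2l// ler_wiXn2l//; have := ltW (weta j1); rewrite -/M; lra.
    rewrite expr2 mulrA ler_wpM2r//; apply: le_trans eta4.2.
    by rewrite ler_wpM2l//; exact: ltW (weta j1).
  have h2 := cabs_subl (normal_form k lambda w 0 j1) (- e j1).
  rewrite opprK cabsN cnf -/M in h2.
  have h3 : normal_form k lambda w 0 j1 + e j1 = y 0 j1 by rewrite /e addrC subrK Fw.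
  rewrite h3 in h2.
  have h4 : M * (3 / 4) <= M * cabs (1 - x / p%:R) by rewrite ler_wpM2l.
  have := eM j1; have := yub j1; rewrite /B; lra.
have eB j : cabs (e j) <= C * B ^+ l * Q ^+ l.
  apply: le_trans (eM j) _; rewrite -mulrA ler_wpM2l// -exprMn.
  by apply: lerXn2r; rewrite ?nnegrE// mulr_ge0 ?(ltW B0) ?(ltW Q0).
have wlb j : Q * ma / 16 <= cabs (w 0 j).
  have h1 : C * B ^+ l * Q ^+ l <= Q * ma / 8.
    apply: (@le_trans _ _ (C * B ^+ l * Q ^+ 2)).
      by rewrite ler_wpM2l ?mulr_ge0 ?(ltW Bl0)// ler_wiXn2l// ltW.
    have -> : C * B ^+ l * Q ^+ 2 = 8 * C * B ^+ l / ma * Q * (Q * ma / 8).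
      by field; rewrite gt_eqF.
    rewrite ler_piMl ?(ltW c4)// divr_ge0// mulr_ge0 ?(ltW Q0) ?(ltW ma0)//.
  have h2 := cabs_subl (y 0 j) (e j).
  have h3 : y 0 j - e j = normal_form k lambda w 0 j by rewrite /e Fw opprB addrC subrK.
  rewrite h3 cnf in h2.
  have h4 : cabs (w 0 j) * cabs (1 - x / p%:R) <= cabs (w 0 j) * 2 by rewrite ler_wpM2l ?cabs_ge0.
  by have := eB j; have := ylb j; lra.
have w0 j : w 0 j != 0.
  by rewrite -cabs_gt0 (lt_le_trans _ (wlb j))// divr_gt0// mulr_gt0.
have l0 j : lambda 0 j != 0 by rewrite -cabs_gt0 lambda1.
have QC : (Q%:C : R[i]) != 0 by rewrite -cabs_gt0 cabs_real_ge0// ltW.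
pose eps j := e j / (lambda 0 j * w 0 j).
pose del j := w 0 j / model_point m j - 1.
pose del' j := y 0 j / model_point m.+1 j - 1.
move=> j; rewrite -/Q -/(del j) -/p.
apply: (HP Q x del del' eps Q0 (ltW c1)) => //.
- have -> : \prod_j (1 + del j) = coord_prod w / ((Q ^+ d)%:C * \prod_j a 0 j).
    rewrite (eq_bigr (fun j => w 0 j / model_point m j)) => [|i _]; last first.
      by rewrite /del addrC subrK.
    rewrite big_split/= -(big_morph _ (@invfM R[i]) (@invr1 _)) /model_point !big_split/=.
    by rewrite prodrXl lambdap expr1n mul1r prodr_const card_ord -/Q -rcX.
  rewrite expr_div_n exprMn ak mulr1 -rcX -exprM [(d * k)%N]mulnC -/p -/x -/xi mulrC divfK//.
  by rewrite -cabs_gt0 cabs_real_ge0 ?(ltW xi0).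
- rewrite -exprMn; exact: (cabs_coord_prod_le (fun i => le_trans (j1P i) MB)).
- move=> i; rewrite /del /del' ![1 + (_ - 1)]addrC !subrK /model_point -/Q' q'E rcM exprS.
  have yE : y 0 i = lambda 0 i * w 0 i * (1 - x / p%:R + eps i).
    by rewrite mulrDr -nfE /eps mulrC divfK ?mulf_neq0// addrC /e subrK Fw.
  have aux (L Ln s T b v E : R[i]) : [&& L != 0, Ln != 0, s != 0, T != 0 & b != 0] ->
      T * (L * v * E / (L * Ln * (s * T) * b)) = v / (Ln * s * b) * E.
    by move=> /and5P[? ? ? ? ?]; field; apply/and5P; split.
  rewrite yE; apply: aux; apply/and5P; split; [exact: l0|exact/expf_neq0/l0|exact: QC| |exact: a0].
  have T0 : 0 < 1 - xi / p%:R by lra.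
  by rewrite -cabs_gt0 cabs_real_ge0 // ltW.
- move=> i; rewrite /eps cabsf cabsM lambda1 mul1r ler_pdivrMr ?cabs_gt0//.
  apply: le_trans (eB i) _.
  have h1 : C1 * xi ^+ 2 * Q * (Q * ma / 16) <= C1 * xi ^+ 2 * Q * cabs (w 0 i).
    by rewrite ler_wpM2l// mulr_ge0 ?(ltW Q0)// mulr_ge0 ?sqr_ge0.
  apply: le_trans _ h1.
  (* The exponent needed is 2p + 2, one more than in the relative error xi^2 Q; it is at most l
     because l > 2p + 1. *)
  have -> : C1 * xi ^+ 2 * Q * (Q * ma / 16) = C * B ^+ l * Q ^+ (2 * p + 2).
    rewrite exprD [(2 * p)%N]mulnC exprM -/xi /C1; field; by rewrite gt_eqF.
  rewrite ler_wpM2l ?mulr_ge0 ?(ltW Bl0)// ler_wiXn2l ?(ltW Q0)//.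
  by apply: leq_trans hl; rewrite /p mulnA addn1 addn2.
- by move=> i; rewrite -q'E; exact: yt.
Qed.

Lemma model_point_tube A n : 0 <= A -> tube A n (\row_j model_point n j).
Proof.
move=> A0' j; rewrite mxE divff ?model_point_neq0// subrr cabs0 mulr_ge0// exprn_ge0//.
exact: ltW.
Qed.

(** Pulling a model point back n times gives an orbit segment staying in n+1 tubes. The initial
    points lie in a compact tube, and a limit of them works for all n. *)
Lemma shadowing (A : R) (N : nat) : 0 <= A ->
  (forall m, (N <= m)%N -> forall y, tube A m.+1 y -> exists2 w, tube A m w & F w = y) ->
  (forall m, (N <= m)%N -> forall y, tube A m y -> {for y, continuous F}) ->
  exists z, forall s, tube A (N + s)%N (iter s F z).
Proof.
move=> A0' back Fc.
have fin n m : (N <= m)%N -> exists x, forall s, (s <= n)%N -> tube A (m + s)%N (iter s F x).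
  elim: n m => [|n IH] m Nm.
    exists (\row_j model_point m j) => s; rewrite leqn0 => /eqP ->.
    by rewrite addn0; exact: model_point_tube.
  have [x xP] := IH m.+1 (leqW Nm).
  have [|w wt Fw] := back m Nm x; first by have := xP 0%N; rewrite addn0; exact.
  exists w => -[_|s]; first by rewrite addn0.
  by rewrite ltnS iterSr Fw -addSnnS; exact: xP.
have /choice[x xP] : forall n, exists x, forall s, (s <= n)%N -> tube A (N + s)%N (iter s F x).
  by move=> n; exact: fin.
(* An ultrafilter plays the part of a convergent subsequence: along it every iterate converges, by
   continuity of F at the limit point just placed in a closed tube. *)
have [U [UU xU]] := ultraFilterLemma (fmap_proper_filter x eventually_filter).
have Us s : U [set w | tube A (N + s)%N (iter s F w)].
  by apply: xU; exists s => // n /= sn; exact: xP.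
have [z [zt Uz]] : tube A N `&` [set z | U --> z] !=set0.
  have := @compact_tube A N; rewrite compact_ultra => /(_ U UU); apply.
  by have := Us 0%N; rewrite addn0.
exists z; suff H s : tube A (N + s)%N (iter s F z) /\ (iter s F w) @[w --> U] --> iter s F z.
  by move=> s; have [] := H s.
elim: s => [|s [st sc]]; first by rewrite addn0.
have Sc : (iter s.+1 F w) @[w --> U] --> iter s.+1 F z.
  apply: (@cvg_comp _ _ _ (iter s F) F _ _ _ sc).
  exact: (Fc (N + s)%N (leq_addr _ _) _ st).
split => //.
have ct : closed (tube A (N + s.+1)%N).
  apply: compact_closed; last exact: compact_tube.
  exact: norm_hausdorff.
exact: (@closed_cvg _ _ U _ (iter s.+1 F) (tube A (N + s.+1)%N) ct (Us s.+1) _ Sc).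
Qed.

End Shooting.

(** * Thin tubes lie in the basin *)

Section TubeInBasin.
Variable R : realType.

Lemma arg_near1 (theta : R) : 0 < theta -> exists2 e : R, 0 < e &
  forall y : R[i], cabs (y - 1) < e -> exists s, y = (cabs y)%:C * cis s /\ `|s| < theta.
Proof.
move=> th0; pose th := Num.min theta pi.
have th'0 : 0 < th by rewrite lt_min th0 pi_gt0.
have [tht thp] : th <= theta /\ th <= pi by rewrite !ge_min !lexx orbT.
pose c := cos th.
have c1 : c < 1.
  rewrite /c -cos0 ltr_cos ?in_itv/= ?lexx ?pi_ge0//.
  by rewrite (ltW th'0) thp.
have cm : -1 <= c := cos_geN1 _.
(* Chosen so that Re y >= 1 - e exceeds c (1 + e) >= c |y| when c > 0; for c <= 0 positivity of Re y
   is enough. *)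
pose e := (1 - c) / 4; have e0 : 0 < e by rewrite /e; lra.
have e2 : e <= 2^-1 by rewrite /e; lra.
exists e => // y ye.
have yr1 : cabs y <= 1 + e.
  by have := cabsD (y - 1) 1; rewrite subrK cabs1; lra.
have Rey : 1 - e <= complex.Re y.
  have := le_trans (Re_le_cabs (y - 1)) (ltW ye).
  by rewrite raddfB/= ler_norml => /andP[]; lra.
have y0 : 0 < cabs y by have := le_trans (ler_norm _) (Re_le_cabs y); lra.
have [|s [/andP[s1 s2] ys cs]] := @cis_exists R (y / (cabs y)%:C).
  by rewrite cabsf cabs_real_ge0 ?cabs_ge0// divff// gt_eqF.
exists s; split.
  by rewrite -ys mulrC divfK// -cabs_gt0 cabs_real_ge0// ltW.
apply: lt_le_trans tht; rewrite ltNge; apply/negP => ths.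
have sp : `|s| <= pi by rewrite ler_norml s1 s2.
have : cos `|s| <= c.
  rewrite leNgt /c ltr_cos ?in_itv/= ?normr_ge0 ?sp ?(ltW th'0) ?thp//.
  by rewrite -leNgt.
rewrite cos_norm cs -rcV mulrC.
have -> : complex.Re ((cabs y)^-1%:C * y) = (cabs y)^-1 * complex.Re y.
  by case: (y) => a b /=; rewrite mul0r subr0.
rewrite mulrC ler_pdivrMr//.
have : c * cabs y <= Num.max 0 c * (1 + e).
  have h : c <= Num.max 0 c by rewrite le_max lexx orbT.
  have h0 : 0 <= Num.max 0 c by rewrite le_max lexx.
  apply: (@le_trans _ _ (Num.max 0 c * cabs y)); first by rewrite ler_pM2r.
  by rewrite ler_wpM2l.
have [cn|cp] := leP c 0.
  rewrite /e in Rey e2 *; lra.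
have : c * e <= e by rewrite ler_piMl ?(ltW e0)// ltW.
rewrite /e in Rey e2 *; lra.
Qed.

Variables (d k h : nat) (lambda : 'rV[R[i]]_d) (q : nat -> R) (a : 'rV[R[i]]_d).
Variables (beta theta R0 A : R).
Hypothesis d0 : (0 < d)%N.
Hypothesis p1 : (1 < k * d)%N.
Hypothesis lambda1 : forall j, cabs (lambda 0 j) = 1.
Hypothesis lambdap : \prod_j lambda 0 j = 1.
Hypothesis q0 : 0 < q 0%N < 1.
Hypothesis qS : forall n, q n.+1 = q n * (1 - q n ^+ (k * d) / (k * d)%:R).
Hypothesis a0 : forall j, a 0 j != 0.
Hypothesis ap : \prod_j a 0 j = cis (2 * pi * h%:R / k%:R).
Hypothesis hbeta : 0 < beta < d%:R^-1.
Hypothesis theta0 : 0 < theta.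
Hypothesis R00 : 0 < R0.
Hypothesis A0 : 0 <= A.

(** In a tube pi(w) = Q^d cis(phi) Y with Y close to 1. Hence |w^j| = O(Q) is below |pi(w)|^beta
    because d beta < 1, pi(w)^k is nearly a small positive number, and the argument is nearly
    phi. *)
Lemma tube_in_B : exists N, forall m, (N <= m)%N ->
  tube k lambda q a A m `<=` B k h R0 theta beta.
Proof.
have [k0 _] : (0 < k)%N /\ (0 < d)%N by apply/andP; rewrite -muln_gt0 ltnW.
case/andP: hbeta => beta0 betad.
have dR : (0 : R) < d%:R by rewrite ltr0n.
have kR : (0 : R) < k%:R by rewrite ltr0n.
pose phi : R := 2 * pi * h%:R / k%:R.
have phik : cis phi ^+ k = 1.
  by rewrite -cisMn -mulr_natr /phi divfK ?gt_eqF//; exact: (cis_2pi_int _ (Posz h)).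
have db : 0 < 1 - d%:R * beta.
  by rewrite subr_gt0 mulrC -ltr_pdivlMr// mul1r.
pose Ma := \sum_j cabs (a 0 j).
have aMa j : cabs (a 0 j) <= Ma.
  by rewrite /Ma (bigD1 j)//= lerDl sumr_ge0// => i _; exact: cabs_ge0.
have j0 : 'I_d := Ordinal d0.
have Ma0 : 0 < Ma by apply: lt_le_trans (aMa j0); rewrite cabs_gt0.
have [K KE] : exists K : nat -> R, forall i, K i = ((i * d)%:R + 4 ^+ (i * d)) * A.
  by exists (fun i => ((i * d)%:R + 4 ^+ (i * d)) * A).
have K0 i : 0 <= K i by rewrite KE mulr_ge0// addr_ge0// exprn_ge0.
have [e e0 eP] := arg_near1 theta0.
(* Solves 4 Ma b = b^(d beta) for b; below [b0] the left side is smaller. *)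
pose b0 := ((4 * Ma)^-1) `^ (1 - d%:R * beta)^-1.
have b00 : 0 < b0 by rewrite powR_gt0// invr_gt0 mulr_gt0.
pose rho := (2 * R0)^-1; have rho0 : 0 < rho by rewrite invr_gt0 mulr_gt0.
pose S := A + 2 * K 1%N + 2 * K k + K 1%N / e + b0^-1 + rho^-1 + 1.
have Ke : 0 <= K 1%N / e by rewrite divr_ge0 ?(ltW e0).
have bi : 0 < b0^-1 by rewrite invr_gt0.
have ri : 0 < rho^-1 by rewrite invr_gt0.
have A1 := A0; have k10 := K0 1%N; have kk0 := K0 k.
have S0 : 0 < S by rewrite /S; lra.
have Si0 : 0 < S^-1 by rewrite invr_gt0.
have [N NP] := model_small p1 q0 qS Si0.
exists N => m Nm w wt.
have Q0 : 0 < q m := model_gt0 p1 q0 qS m; set Q := q m in Q0 wt *.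
have Q1 : Q <= 1 := ltW (model_lt1 p1 q0 qS m).
have SQ : S * Q < 1 by rewrite -ltr_pdivlMl// mulr1; exact: NP.
have smallS (c : R) : c <= S -> c * Q < 1.
  by move=> cS; apply: le_lt_trans SQ; rewrite ler_pM2r.
have c1 := smallS A ltac:(rewrite /S; lra).
have c2 := smallS (2 * K 1%N) ltac:(rewrite /S; lra).
have c3 := smallS (2 * K k) ltac:(rewrite /S; lra).
have c4 := smallS (K 1%N / e) ltac:(rewrite /S; lra).
have c5 := smallS b0^-1 ltac:(rewrite /S; lra).
have c6 := smallS rho^-1 ltac:(rewrite /S; lra).
pose mp := model_point lambda q a m.
have mp0 j : mp j != 0 by apply: (@model_point_neq0 R d k lambda q a p1 lambda1 q0 qS a0).
pose del j := w 0 j / mp j - 1.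
pose tau := A * Q ^+ (k * d).+1.
have delt j : cabs (del j) <= tau by exact: wt.
have tau0 : 0 <= tau by rewrite mulr_ge0// exprn_ge0// ltW.
have tauQ : tau <= A * Q.
  by rewrite ler_wpM2l// -[leRHS]expr1 ler_wiXn2l// ltW.
have m01 : 0 <= tau <= 1 by rewrite tau0; lra.
pose Y := \prod_j (1 + del j).
have Yi i : cabs (Y ^+ i - 1) <= K i * Q.
  have h1 := exp_prod1D_expand i m01 delt; rewrite -/Y in h1.
  have h2 : cabs (i%:R * \sum_j del j) <= (i * d)%:R * tau.
    rewrite cabsM cabs_nat natrM -mulrA ler_wpM2l//.
    apply: le_trans (cabs_sum _ _ _) _; apply: le_trans (ler_sum _ (fun j _ => delt j)) _.
    by rewrite sumr_const card_ord -[leLHS]mulr_natl.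
  have h3 : Y ^+ i - 1 = (Y ^+ i - (1 + i%:R * \sum_j del j)) + i%:R * \sum_j del j by ring.
  have h4 : 4 ^+ (i * d) * tau ^+ 2 <= 4 ^+ (i * d) * (A * Q).
    rewrite ler_wpM2l ?exprn_ge0// (le_trans _ tauQ)// expr2 ler_piMr//.
    by case/andP: m01.
  have h5 : (i * d)%:R * tau <= (i * d)%:R * (A * Q) by rewrite ler_wpM2l.
  rewrite h3; apply: le_trans (cabsD _ _) _; rewrite KE; lra.
have Y1 : cabs (Y - 1) <= K 1%N * Q by have := Yi 1%N; rewrite expr1.
have Ylb : 2^-1 <= cabs Y.
  have := cabs_subl 1 (1 - Y).
  by rewrite (_ : 1 - (1 - Y) = Y) ?cabs1 ?(cabsBC 1); [lra|ring].
have uE : coord_prod w = (Q ^+ d)%:C * cis phi * Y.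
  rewrite /coord_prod (eq_bigr (fun j => mp j * (1 + del j))) => [|j _]; last first.
    by rewrite /del addrC subrK mulrC divfK.
  rewrite big_split/= -/Y; congr (_ * _); rewrite /mp /model_point !big_split/= ap -/phi.
  by rewrite prodrXl lambdap expr1n mul1r prodr_const card_ord -rcX.
have uc : cabs (coord_prod w) = Q ^+ d * cabs Y.
  by rewrite uE !cabsM cabs_cis mulr1 cabs_real_ge0// exprn_ge0// ltW.
have Qd0 : 0 < Q ^+ d by rewrite exprn_gt0.
split.
  move=> j; have -> : w 0 j = mp j * (1 + del j) by rewrite /del addrC subrK mulrC divfK.
  have h1 : cabs (mp j * (1 + del j)) <= 2 * Ma * Q.
    rewrite cabsM /mp (cabs_model_point a p1 lambda1 q0 qS) -/Q.
    have h2 : cabs (1 + del j) <= 2 by have := cabsD 1 (del j); rewrite cabs1; have := delt j; lra.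
    have h3 : Q * cabs (a 0 j) <= Q * Ma by rewrite ler_pM2l.
    apply: (@le_trans _ _ (Q * Ma * 2)); last by lra.
    by rewrite ler_pM ?cabs_ge0// mulr_ge0 ?cabs_ge0// ltW.
  (* Halving Q absorbs |Y| >= 1/2, so that b^d <= |pi(w)|. *)
  apply: le_lt_trans h1 _; set b := Q / 2.
  have b0' : 0 < b by rewrite divr_gt0.
  have bb0 : b < b0.
    have : b0^-1 * Q * b0 < 1 * b0 by rewrite ltr_pM2r.
    by rewrite mulrAC mulVf ?gt_eqF// !mul1r /b; lra.
  have h2 : b ^+ d <= cabs (coord_prod w).
    rewrite uc /b expr_div_n ler_pM2l// (le_trans _ Ylb)//.
    rewrite lef_pV2 ?posrE ?exprn_gt0// -[leLHS]expr1 ler_weXn2l//; lra.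
  have h3 : (b ^+ d) `^ beta <= cabs (coord_prod w) `^ beta.
    by rewrite ge0_ler_powR ?(ltW beta0)// nnegrE ?cabs_ge0 ?exprn_ge0 ?(ltW b0').
  apply: lt_le_trans h3; rewrite -powR_mulrn ?(ltW b0')// -powRrM.
  have -> : 2 * Ma * Q = 4 * Ma * b by rewrite /b; field.
  have h4 : b = b `^ (d%:R * beta) * b `^ (1 - d%:R * beta).
    rewrite -powRD; last by rewrite (gt_eqF b0') implybT.
    by rewrite addrC subrK powRr1// ltW.
  have h5 : b `^ (1 - d%:R * beta) < (4 * Ma)^-1.
    have -> : (4 * Ma)^-1 = b0 `^ (1 - d%:R * beta).
      by rewrite /b0 -powRrM mulVf ?gt_eqF// powRr1// invr_ge0 mulr_ge0// ltW.
    by rewrite gt0_ltr_powR// nnegrE ltW.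
  have P0 : 0 < b `^ (d%:R * beta) by rewrite powR_gt0.
  rewrite {1}h4 mulrCA -[ltRHS]mulr1 ltr_pM2l//.
  by rewrite mulrC -ltr_pdivlMr ?mulr_gt0// mul1r.
split.
  set xi := Q ^+ (k * d).
  have xi0 : 0 < xi by rewrite exprn_gt0.
  have xiQ : xi <= Q by rewrite -[leRHS]expr1 ler_wiXn2l// ?(ltW Q0)// ltnW.
  have xir : xi < rho.
    apply: le_lt_trans xiQ _.
    have : rho^-1 * Q * rho < 1 * rho by rewrite ltr_pM2r.
    by rewrite mulrAC mulVf ?gt_eqF// !mul1r.
  have -> : coord_prod w ^+ k = xi%:C * Y ^+ k.
    by rewrite uE !exprMn phik mulr1 -rcX -exprM [(d * k)%N]mulnC.
  rewrite -/rho.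
  (* The disc is tangent to the imaginary axis at 0, so size alone is not enough: the gain xi
     towards the centre must beat the deviation xi |Y^k - 1|. *)
  have -> : xi%:C * Y ^+ k - rho%:C = xi%:C * (Y ^+ k - 1) - (rho - xi)%:C by rewrite rcB; ring.
  apply: le_lt_trans (cabsB _ _) _; rewrite cabsM !cabs_real_ge0 ?(ltW xi0)//; last by lra.
  have : xi * cabs (Y ^+ k - 1) <= xi * (K k * Q) by rewrite ler_pM2l.
  have : xi * (K k * Q) < xi * 1 by rewrite ltr_pM2l//; lra.
  lra.
have [|s [Ys sth]] := eP Y.
  apply: le_lt_trans Y1 _.
  have : K 1%N / e * Q * e < 1 * e by rewrite ltr_pM2r.
  by rewrite mulrAC divfK ?gt_eqF// mul1r.
exists (phi + s); split; last by rewrite -/phi [phi + s]addrC addrK.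
split; first by rewrite -cabs_gt0 uc mulr_gt0//; lra.
rewrite uc -/(cis (phi + s)) cisD rcM uE {1}Ys; ring.
Qed.

End TubeInBasin.

(** * Local inverse, continuity and orbits in a uniform basin *)

Section Germ.
Variables (R : realType) (d : nat).

Lemma automorphism_germ_local_inverse (U : set 'rV[R[i]]_d)
    (F : 'rV[R[i]]_d -> 'rV[R[i]]_d) : automorphism_germ U F ->
  exists G : 'rV[R[i]]_d -> 'rV[R[i]]_d, forall e : R, 0 < e ->
    exists2 rho : R, 0 < rho & forall y : 'rV[R[i]]_d, (forall j, cabs (y 0 j) < rho) ->
      F (G y) = y /\ forall j, cabs (G y 0 j) < e.
Proof.
move=> [_ _ _ [V [G [V0 [_ dG] G0 _ /nbhs_rVcP[r1 r10 FG]]]]].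
exists G => e e0.
have /continuous_rVP/(_ e e0)[r2 r20 Gc] := differentiable_continuous (dG 0 V0).
exists (Num.min r1 r2); first by rewrite lt_min r10.
move=> y yr; split.
  by apply: FG => j; rewrite mxE sub0r cabsN; have := yr j; rewrite lt_min => /andP[].
move=> j; have := Gc y; rewrite G0 => /(_ _ j); rewrite mxE sub0r cabsN; apply => i.
by rewrite mxE sub0r cabsN; have := yr i; rewrite lt_min => /andP[].
Qed.

Lemma holomorphic_on_continuous (U : set 'rV[R[i]]_d)
    (F : 'rV[R[i]]_d -> 'rV[R[i]]_d) z : holomorphic_on U F -> U z -> {for z, continuous F}.
Proof. by move=> [_ dF] /dF; exact: differentiable_continuous. Qed.

Lemma uniform_local_basin_cvg (F : 'rV[R[i]]_d -> 'rV[R[i]]_d) (A : set 'rV[R[i]]_d) z :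
  uniform_local_basin F A -> A z ->
  (forall n, A (iter n F z)) /\ iter n F z @[n --> \oo] --> (0 : 'rV[R[i]]_d).
Proof.
move=> [FA Fu] Az; split.
  by elim=> // n IH; apply: FA; exists (iter n F z).
have zA : [set z] `<=` A by move=> _ ->.
have := @uniform_subset_cvg 'rV[R[i]]_d 'rV[R[i]]_d (fun=> (0 : 'rV[R[i]]_d)) A [set z]
  ((fun n (x : 'rV[R[i]]_d) => iter n F x) @ \oo) _ zA Fu.
by rewrite uniform_set1 => h; exact: h.
Qed.

End Germ.


Theorem proposition4p7 (R : realType) (d k l : nat)
  (lambda : 'rV[R[i]]_d) (U : set 'rV[R[i]]_d)
  (F : 'rV[R[i]]_d -> 'rV[R[i]]_d) (beta0 theta0 R0 : R) (h : 'I_k) :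
  (2 <= d)%N -> (1 <= k)%N -> (2 * k * d + 1 < l)%N ->
  (forall j, cabs (lambda 0 j) = 1) ->
  one_resonant lambda ->
  automorphism_germ U F ->
  (fun z => F z - normal_form k lambda z)
    =O_ (0 : 'rV[R[i]]_d) (fun z : 'rV[R[i]]_d => `|z| ^+ l : R[i]) ->
  0 < beta0 < d%:R^-1 ->
  (2 * k + 1)%:R < beta0 * (l + d - 1)%:R ->
  0 < theta0 < pi / (2 * k)%:R ->
  0 < R0 ->
  (forall h' : 'I_k, B k h' R0 theta0 beta0 `<=` U /\
     uniform_local_basin F (B (d := d) k h' R0 theta0 beta0)) ->
  [/\ forall z : 'rV[R[i]]_d, B k h R0 theta0 beta0 z ->
        [/\ cvg (abs_direction (iter n F z) @[n --> \oo]),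
            positive_unit (limit_abs_direction F z),
            accumulation_directions (fun n => iter n F z) =
              omega k h (limit_abs_direction F z) &
            cvg0_tangent_to (fun n => iter n F z)
              (cone_over (omega k h (limit_abs_direction F z)))],
      forall v : 'rV[R]_d, positive_unit v ->
        exists2 z : 'rV[R[i]]_d, B k h R0 theta0 beta0 z &
          limit_abs_direction F z = v &
      \bigcup_(z in B (d := d) k h R0 theta0 beta0)
          accumulation_directions (fun n => iter n F z) =
        [set w : 'rV[R[i]]_d | [/\ forall j, w 0 j != 0, norm2 w = 1 &
                                   arg_sum k h w]] ].
Proof.
move=> d2 k1 hl lambda1 reso germF FO hbeta hbetal htheta R00 basins.
have d0 : (0 < d)%N := ltnW d2.
have p1 : (1 < k * d)%N by rewrite (leq_trans d2)// leq_pmull.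
have lambdap := one_resonant_prod lambda1 reso d0.
have [C [r [/ltW C0 r0 FC]]] := bigO_rVP FO.
have {FC}HF (z : 'rV[R[i]]_d) (M : R) : 0 <= M -> M < r -> (forall j, cabs (z 0 j) <= M) ->
    forall j, cabs (F z 0 j - normal_form k lambda z 0 j) <= C * M ^+ l.
  by move=> M0 Mr zM j; have := FC z M M0 Mr zM j; rewrite !mxE.
have [BU basin] := basins h.
have [beta00 _] := andP hbeta; have [theta00 _] := andP htheta.
pose q n : R := iter n (fun x => x * (1 - x ^+ (k * d) / (k * d)%:R)) 2^-1.
have q0 : 0 < q 0%N < 1 by rewrite /q/=; apply/andP; split; lra.
have qS n : q n.+1 = q n * (1 - q n ^+ (k * d) / (k * d)%:R) by [].
have qn0 n : 0 < q n := model_gt0 p1 q0 qS n.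
have limE z v : abs_direction (iter n F z) @[n --> \oo] --> v -> limit_abs_direction F z = v.
  exact: cvg_lim.
have part1 (z : 'rV[R[i]]_d) : B k h R0 theta0 beta0 z ->
    [/\ cvg (abs_direction (iter n F z) @[n --> \oo]),
        positive_unit (limit_abs_direction F z),
        accumulation_directions (fun n => iter n F z) = omega k h (limit_abs_direction F z) &
        cvg0_tangent_to (fun n => iter n F z)
          (cone_over (omega k h (limit_abs_direction F z)))].
  move=> Bz; have [zB zcvg] := uniform_local_basin_cvg basin Bz.
  have zc j : iter n F z 0 j @[n --> \oo] --> (0 : R[i]).
    apply/ccvgP => e e0; have /cvg_rVP/(_ e e0)[N _ NP] := zcvg.
    by exists N => n /NP/(_ j); rewrite mxE cabsBC.
  have [a [a0 za ap]] := @basin_orbit_asymptotics R d k l h lambda F beta0 theta0 R0 C r d2 k1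
    lambda1 reso C0 r0 HF beta00 hbetal htheta (fun n => iter n F z) q q0 qS zB (fun=> erefl) zc.
  have [vc vu acc] := orbit_directions d0 lambda1 reso qn0 a0 za ap.
  have ow := omega_direction a0 ap.
  rewrite (limE _ _ vc) acc; split => //; first by apply/cvg_ex; exists (abs_direction a).
  split => //; first exact: (closed_cone_omega d0 vu (ex_intro _ _ ow)).
    move=> n; apply/eqP => z0; have [_ [_ [t [[/negP]]]]] := zB n; case.
    by rewrite z0 /coord_prod; apply/eqP; rewrite (bigD1 (Ordinal d0))//= mxE mul0r.
  rewrite acc => w ww; exists 1; split => //; exists w => //.
  by rewrite rc1 scale1r.
have part2 (v : 'rV[R]_d) : positive_unit v ->
    exists2 z : 'rV[R[i]]_d, B k h R0 theta0 beta0 z & limit_abs_direction F z = v.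
  move=> [v0 v1]; have j0 : 'I_d := Ordinal d0.
  pose phi : R := 2 * pi * h%:R / k%:R.
  have kR : (0 : R) < k%:R by rewrite ltr0n.
  have dR : (0 : R) < d%:R by rewrite ltr0n.
  pose pv := \prod_j v 0 j.
  have pv0 : 0 < pv by rewrite prodr_gt0.
  (* Scaling by [c] makes the product of the moduli c v^j equal to 1, as the model orbit
     requires. *)
  pose c := pv `^ (- d%:R^-1).
  have c0 : 0 < c by rewrite powR_gt0.
  have cd : c ^+ d * pv = 1.
    rewrite -powR_mulrn ?(ltW c0)// /c -powRrM mulNr mulVf ?gt_eqF// powRN powRr1 ?(ltW pv0)//.
    by rewrite mulVf// gt_eqF.
  (* The whole argument phi is put into one coordinate; only the sum of arguments is prescribed. *)
  pose a : 'rV[R[i]]_d := \row_j ((c * v 0 j)%:C * (if j == j0 then cis phi else 1)).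
  have ca j : cabs (a 0 j) = c * v 0 j.
    rewrite mxE cabsM cabs_real_ge0 ?mulr_ge0 ?(ltW c0) ?(ltW (v0 j))//.
    by case: ifP; rewrite ?cabs_cis ?cabs1 mulr1.
  have a0 j : a 0 j != 0 by rewrite -cabs_gt0 ca mulr_gt0.
  have ap : \prod_j a 0 j = cis phi.
    rewrite (eq_bigr (fun j => (c * v 0 j)%:C * (if j == j0 then cis phi else 1)));
      last by move=> j _; rewrite mxE.
    rewrite big_split/= -rc_prod big_split/= prodr_const card_ord cd.
    by rewrite -big_mkcond/= big_pred1_eq rc1 mul1r.
  have ak : (\prod_j a 0 j) ^+ k = 1.
    by rewrite ap -cisMn -mulr_natr divfK ?gt_eqF//; exact: (cis_2pi_int _ (Posz h)).
  have [G HG] := automorphism_germ_local_inverse germF.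
  have [A [N1 [A0 back]]] := @backward_step R d k l lambda F G C r q a d0 p1 hl lambda1 lambdap
    C0 r0 HF HG q0 qS a0 ak.
  have [N2 tB] := @tube_in_B R d k h lambda q a beta0 theta0 R0 A d0 p1 lambda1 lambdap q0 qS a0 ap
    hbeta theta00 R00 A0.
  pose N := maxn N1 N2.
  have [z zt] := @shadowing R d k lambda F q a p1 lambda1 q0 qS a0 A N A0
    (fun m Nm => back m (leq_trans (leq_maxl _ _) Nm))
    (fun m Nm y yt => let: And4 _ holF _ _ := germF in
       holomorphic_on_continuous holF (BU y (tB m (leq_trans (leq_maxr _ _) Nm) y yt))).
  exists z; first by apply: (tB N (leq_maxr _ _)); have := zt 0%N; rewrite addn0.
  (* The orbit found starts at tube index [N], so in its own time it follows lambda^N a; neither the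
     moduli nor the product change. *)
  pose a' : 'rV[R[i]]_d := \row_j (lambda 0 j ^+ N * a 0 j).
  have l0 j : lambda 0 j != 0 := lambda_neq0 lambda1 j.
  have ca' j : cabs (a' 0 j) = c * v 0 j.
    by rewrite mxE cabsM cabsX lambda1 expr1n mul1r ca.
  have a'0 j : a' 0 j != 0 by rewrite -cabs_gt0 ca' mulr_gt0.
  have a'p : \prod_j a' 0 j = (\prod_j cabs (a' 0 j))%:C * cis phi.
    have E : \prod_j a' 0 j = cis phi.
      rewrite (eq_bigr (fun j => lambda 0 j ^+ N * a 0 j)) => [|j _]; last by rewrite mxE.
      by rewrite big_split/= prodrXl lambdap expr1n mul1r.
    by rewrite -cabs_prod E cabs_cis rc1 mul1r.
  have za j : iter s F z 0 j / (lambda 0 j ^+ s * (q (N + s)%N)%:C) @[s --> \oo] --> a' 0 j.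
    have m0 s := @model_point_neq0 R d k lambda q a p1 lambda1 q0 qS a0 (N + s)%N j.
    have E s : iter s F z 0 j / (lambda 0 j ^+ s * (q (N + s)%N)%:C) =
        (iter s F z 0 j / model_point lambda q a (N + s)%N j) * a' 0 j.
      rewrite mxE /model_point exprD; field.
      rewrite a0 !expf_neq0//= andbT.
      by rewrite -cabs_gt0 cabs_real_ge0// ltW.
    have one : iter s F z 0 j / model_point lambda q a (N + s)%N j @[s --> \oo] --> (1 : R[i]).
      apply/ccvgP => e e0.
      have A1 : 0 < A + 1 by rewrite ltr_wpDl.
      have [M MP] := model_small p1 q0 qS (divr_gt0 e0 A1).
      exists M => s Ms; apply: le_lt_trans (zt s j) _.
      have Q0 := qn0 (N + s)%N; have Q1 := ltW (model_lt1 p1 q0 qS (N + s)%N).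
      have := MP (N + s)%N (leq_trans Ms (leq_addl _ _)); rewrite ltr_pdivlMr//.
      apply: le_lt_trans; rewrite mulrC exprSr; set Q := q _ in Q0 Q1 *.
      have h1 : A * (Q ^+ (k * d) * Q) <= A * (1 * Q).
        by rewrite ler_wpM2l// ler_wpM2r ?(ltW Q0)// exprn_ile1 ?(ltW Q0).
      lra.
    have := @cvgM R[i] _ _ _ _ (fun=> a' 0 j) 1 _ one (cvg_cst _).
    by rewrite mul1r => h1; under eq_fun do rewrite E; exact: h1.
  have [vc _ _] := orbit_directions d0 lambda1 reso (fun s => qn0 (N + s)%N) a'0 za a'p.
  rewrite (limE _ _ vc); apply/rowP => j; rewrite abs_directionE ca'.
  have -> : norm2 a' = c.
    rewrite norm2E (eq_bigr (fun j => c ^+ 2 * v 0 j ^+ 2)) => [|i _]; last by rewrite ca' exprMn.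
    rewrite -mulr_sumr sqrtrM ?sqr_ge0// sqrtr_sqr ger0_norm ?(ltW c0)//.
    by rewrite -/(enorm v) v1 mulr1.
  by rewrite mulrAC divff ?mul1r// gt_eqF.
split => //; apply/seteqP; split => w.
  move=> [z Bz]; have [_ [vp v1] -> _] := part1 z Bz => -[wv aw]; split => //.
    by move=> j; rewrite -cabs_gt0 -vabsE wv.
  by rewrite /norm2 wv.
(* Realize the moduli |w| by an orbit; its accumulation set is the full torus [omega] over |w|,
   which contains [w]. *)
move=> [w0 w1 aw].
have [|z Bz zv] := part2 (vabs w).
  by split => [j|//]; rewrite vabsE cabs_gt0.
by exists z => //; have [_ _ -> _] := part1 z Bz; rewrite zv.
Qed.
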